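(* Let $B(x,y,D_x,D_y)$ be a linear partial differential operator with polynomial coefficients on $\mathbb{R}^2$. Let $\sigma=\mathcal{F}^{-1}(e^{-iP(\xi,\eta)})\in\mathcal{S}'(\mathbb{R}^2)$ for some $P\in\mathbb{R}[\xi,\eta]$ and $\sigma_1=q(D_1,D_2)\sigma$ for some $q\in\mathbb{C}[\xi,\eta]$ never vanishing on $\mathbb{R}^2$. Then $Q^{(\sigma)}[w]=\sigma*\mathrm{Wig}[w]$ and $Q^{(\sigma_1)}[w]=\sigma_1*\mathrm{Wig}[w]$ satisfy, for $w\in\mathcal{S}'(\mathbb{R}^2)$, $$Q^{(\sigma_1)}[Bw]=\widetilde{AB}\,Q^{(\sigma)}[w],$$ where $A$ is the operator defined by $A(M_1,M_2,D_1,D_2)=q(D_1+D_2,M_2-M_1)$, and $\widetilde{AB}$ is obtained from the composition $AB$ by the transformation $C\mapsto\tilde C$ defined in the context. Moreover, $B$ is regular if and only if $\widetilde{AB}$ is regular.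
   Context: Notation. $M_1w(x,y)=xw(x,y)$, $M_2w(x,y)=yw(x,y)$, $D_1=D_x=-i\partial_x$, $D_2=D_y=-i\partial_y$, acting on $\mathcal{S}'(\mathbb{R}^2)$. The Fourier transform is $\mathcal{F}f(\xi,\eta)=\widehat f(\xi,\eta)=\int e^{-i(x\xi+y\eta)}f(x,y)\,dx\,dy$, extended to $\mathcal{S}'(\mathbb{R}^2)$. The Wigner-like transform is $\mathrm{Wig}[w](x,y)=\int_{\mathbb{R}} e^{-ity}w(x+\frac12t,x-\frac12t)\,dt$; it is the composition of the linear change of variables $Tw(x,t)=w(x+\frac12t,x-\frac12t)$ and the partial Fourier transform in $t$, and as such is defined (and invertible) on $\mathcal{S}(\mathbb{R}^2)$ and on $\mathcal{S}'(\mathbb{R}^2)$. For $w\in\mathcal{S}'(\mathbb{R}^2)$ and $\tau\in\{\sigma,\sigma_1\}$, $\tau*\mathrm{Wig}[w]$ is defined as $\mathcal{F}^{-1}(\widehat\tau\cdot\widehat{\mathrm{Wig}[w]})$, where $\widehat\sigma=e^{-iP}$ and $\widehat{\sigma_1}=q\,e^{-iP}$. A linear partial differential operator $C$ with polynomial coefficients is written $C(M_1,M_2,D_1,D_2)=\sum c_{mnhk}M_1^mM_2^nD_1^hD_2^k$; for operators $X_1,X_2,Y_1,Y_2$, $C(X_1,X_2,Y_1,Y_2)$ means $\sum c_{mnhk}X_1^mX_2^nY_1^hY_2^k$. Note that $D_1+D_2$ and $M_2-M_1$ commute, so $q(D_1+D_2,M_2-M_1)$ is unambiguous. Transformation $C\mapsto\tilde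 C$ (depending on $P$): with $P_1=(\partial_\xi P)(D_1,D_2)$ and $P_2=(\partial_\eta P)(D_1,D_2)$, $$\tilde{C}(M_1,M_2,D_1,D_2)=C\left(M_1-\tfrac12D_2-P_1,\;M_1+\tfrac12D_2-P_1,\;\tfrac12D_1+M_2-P_2,\;\tfrac12D_1-M_2+P_2\right).$$ Definition. A linear operator $A$ on $\mathcal{S}'(\mathbb{R}^n)$ is regular if for all $u\in\mathcal{S}'(\mathbb{R}^n)$: $Au\in\mathcal{S}(\mathbb{R}^n)$ implies $u\in\mathcal{S}(\mathbb{R}^n)$. *)

(* Defs.v *)
From HB Require Import structures.
From mathcomp Require Import all_boot all_order all_algebra.
From mathcomp Require Import all_classical all_reals all_analysis.
From mathcomp Require Import complex.
From mathcomp Require mpoly.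
(* The notations of multinomials clash with those of MathComp-Analysis. *)
Import -(notations) mpoly.
Import Order.TTheory GRing.Theory Num.Theory.
Import numFieldNormedType.Exports.

Set Implicit Arguments.
Unset Strict Implicit.
Unset Printing Implicit Defensive.

Local Open Scope ring_scope.
Local Open Scope classical_set_scope.
Local Open Scope complex_scope.

Section ComplexFunctions.
Context {R : realType}.
Implicit Types (f : R * R -> R[i]) (z : R * R) (j : 'I_2) (t : R).

Definition cabs (c : R[i]) : R := complex.Re `|c|.

Definition expi t : R[i] := cos t +i* sin t.

Definition coord j z : R := if j == ord0 then z.1 else z.2.

Definition slice f j z : R -> R[i] :=
  fun t => if j == ord0 then f (t, z.2) else f (z.1, t).

Definition pderivable f j z : Prop :=
  derivable (fun t => complex.Re (slice f j z t)) (coord j z) 1 /\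
  derivable (fun t => complex.Im (slice f j z t)) (coord j z) 1.

Definition pd j f : R * R -> R[i] := fun z =>
  (fun t => complex.Re (slice f j z t))^`() (coord j z) +i*
  (fun t => complex.Im (slice f j z t))^`() (coord j z).

(* C^oo: all iterated partial derivatives, in any order, exist and are
   continuous. *)
Definition smooth f : Prop := forall s : seq 'I_2,
  let g := foldr pd f s in
  [/\ continuous (fun z => complex.Re (g z)),
      continuous (fun z => complex.Im (g z)) &
      forall j z, pderivable g j z].

Definition pd2 (m n : nat) f : R * R -> R[i] :=
  iter m (pd ord0) (iter n (pd ord_max) f).

(* sup_z |x^a y^b d_x^m d_y^n f(x,y)| <= K *)
Definition seminorm_le (a b m n : nat) f (K : R) : Prop :=
  forall z, `|z.1| ^+ a * `|z.2| ^+ b * cabs (pd2 m n f z) <= K.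

Definition schwartz f : Prop :=
  smooth f /\ forall a b m n, exists K, seminorm_le a b m n f K.

(* Smooth functions all of whose derivatives have polynomial growth. *)
Definition slowly_increasing f : Prop :=
  smooth f /\ forall m n, exists k : nat, exists K : R,
    forall z, cabs (pd2 m n f z) <= K * (1 + `|z.1| + `|z.2|) ^+ k.

Definition cintegral d (T : measurableType d)
    (mu : {measure set T -> \bar R}) (g : T -> R[i]) : R[i] :=
  Rintegral mu setT (fun x => complex.Re (g x)) +i*
  Rintegral mu setT (fun x => complex.Im (g x)).

Definition integral1 (g : R -> R[i]) : R[i] :=
  cintegral (@lebesgue_measure R) g.

Definition integral2 f : R[i] :=
  cintegral ((@lebesgue_measure R) \x (@lebesgue_measure R))%E f.

Definition fourier f : R * R -> R[i] := fun zeta =>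
  integral2 (fun z => expi (- (z.1 * zeta.1 + z.2 * zeta.2)) * f z).

Definition fourier_inv f : R * R -> R[i] := fun z =>
  ((2 * pi) ^- 2)%:C *
  integral2 (fun zeta => expi (z.1 * zeta.1 + z.2 * zeta.2) * f zeta).

(* (x, y) |-> \int e^{-ity} f(x,t) dt *)
Definition fourier_snd f : R * R -> R[i] := fun z =>
  integral1 (fun t => expi (- (t * z.2)) * f (z.1, t)).

End ComplexFunctions.

(* A distribution is a functional on functions on R^2 of which only the values
   on Schwartz functions matter: linearity and continuity are required, and
   equality is tested, on Schwartz functions only. *)
Definition distr (R : realType) : Type := (R * R -> R[i]) -> R[i].

HB.instance Definition _ (R : realType) :=
  GRing.Lmodule.copy (distr R) ((R * R -> R[i]) -> R[i]).

Section Distributions.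
Context {R : realType}.
Implicit Types (u v w tau : distr R) (phi psi f : R * R -> R[i]) (j : 'I_2).

Definition deq u v : Prop := forall phi, schwartz phi -> u phi = v phi.

(* The topology of S(R^2) is the one defined by the seminorms
   sup |x^a y^b d_x^m d_y^n phi|. *)
Definition tempered u : Prop :=
  (forall (c : R[i]) phi psi, schwartz phi -> schwartz psi ->
     u (c *: phi + psi) = c * u phi + u psi) /\
  (forall phi, schwartz phi -> forall eps : R, 0 < eps ->
     exists N : nat, exists2 delta : R, 0 < delta &
     forall psi, schwartz psi ->
       (forall a b m n, (a <= N)%N -> (b <= N)%N -> (m <= N)%N -> (n <= N)%N ->
          seminorm_le a b m n (psi - phi) delta) ->
       cabs (u psi - u phi) <= eps).

(* The distribution defined by a function. *)
Definition reg f : distr R := fun phi => integral2 (fun z => f z * phi z).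

Definition in_schwartz u : Prop := exists2 f, schwartz f & deq u (reg f).

Definition regular (A : distr R -> distr R) : Prop :=
  forall u, tempered u -> in_schwartz (A u) -> in_schwartz u.

(* Operators on distributions, by transposition. *)
Definition mulf f u : distr R := fun phi => u (fun z => f z * phi z).

Definition M j : distr R -> distr R := mulf (fun z => (coord j z)%:C).

(* <D_j u, phi> = <u, - D_j phi> with D_j phi = -i d_j phi *)
Definition D j u : distr R := fun phi => u ('i *: pd j phi).

Definition fourierD u : distr R := fun phi => u (fourier phi).

Definition fourierD_inv u : distr R := fun phi => u (fourier_inv phi).

Definition fourierD_snd u : distr R := fun phi => u (fourier_snd phi).

(* Tw(x,t) = w(x + t/2, x - t/2): the change of variables has Jacobian 1 in
   absolute value and inverse (a,b) |-> ((a + b)/2, a - b). *)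
Definition Tvar u : distr R := fun phi =>
  u (fun z => phi ((z.1 + z.2) / 2, z.1 - z.2)).

Definition Wig w : distr R := fourierD_snd (Tvar w).

(* The slowly increasing function that is the Fourier transform of tau
   (0 if there is none). *)
Definition fourier_symbol tau : R * R -> R[i] :=
  xget (fun=> 0) [set f | slowly_increasing f /\ deq (fourierD tau) (reg f)].

(* tau * v = F^{-1} (F tau . F v) *)
Definition conv tau v : distr R :=
  fourierD_inv (mulf (fourier_symbol tau) (fourierD v)).

Definition Q tau w : distr R := conv tau (Wig w).

End Distributions.

Section Substitution.
Context {R : realType}.

(* opsubst p X = \sum_m p_m X_0^(m_0) \o X_1^(m_1) \o ... , the last operator
   acting first *)
Definition opsubst (V : lmodType R[i]) n (p : mpoly n R[i])
    (X : 'I_n -> V -> V) : V -> V := fun v =>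
  \sum_(m <- msupp p)
    mcoeff m p *: foldr (fun k w => iter (m k) (X k) w) v (enum 'I_n).

Definition ops2 V (X1 X2 : V -> V) : 'I_2 -> V -> V :=
  fun k => nth id [:: X1; X2] k.

Definition ops4 V (X1 X2 Y1 Y2 : V -> V) : 'I_4 -> V -> V :=
  fun k => nth id [:: X1; X2; Y1; Y2] k.

Definition eval2 (p : mpoly 2 R[i]) (z : R * R) : R[i] :=
  meval (fun k => (coord k z)%:C) p.

Definition evalR2 (p : mpoly 2 R) (z : R * R) : R :=
  meval (fun k => coord k z) p.

End Substitution.

Local Notation M1 := (M ord0).
Local Notation M2 := (M ord_max).
Local Notation D1 := (D ord0).
Local Notation D2 := (D ord_max).

Section PDO.
Context {R : realType}.
Implicit Types (b c : mpoly 4 R[i]) (P : mpoly 2 R) (q : mpoly 2 R[i]).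

(* A partial differential operator with polynomial coefficients is given by the
   polynomial \sum c_mnhk X_0^m X_1^n X_2^h X_3^k of its coefficients; it acts
   as C(M_1, M_2, D_1, D_2). *)
Definition pdo c : distr R -> distr R := opsubst c (ops4 M1 M2 D1 D2).

Definition varX (k : nat) : mpoly 4 R[i] := mpolyX R[i] (mnm1 (inord k : 'I_4)).

(* Left composition with M_1, M_2, D_1, D_2, on coefficients: by the Leibniz
   rule D_j \o a(x,y) D^h = a D_j D^h + (D_j a) D^h. *)
Definition LM (j : nat) b : mpoly 4 R[i] := varX j * b.
Definition LD (j : nat) b : mpoly 4 R[i] :=
  varX (2 + j) * b - 'i *: mderiv (inord j : 'I_4) b.

(* Coefficients of the composition of the operators with coefficients c and b *)
Definition pdo_comp c b : mpoly 4 R[i] :=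
  opsubst c (ops4 (LM 0) (LM 1) (LD 0) (LD 1)) b.

(* Coefficients of q(D_1 + D_2, M_2 - M_1) *)
Definition pdo_A q : mpoly 4 R[i] :=
  opsubst q (ops2 (fun b => LD 0 b + LD 1 b) (fun b => LM 1 b - LM 0 b)) 1.

(* (d_j P)(D_1, D_2) *)
Definition PD P (j : 'I_2) : distr R -> distr R :=
  opsubst (map_mpoly (real_complex R) (mderiv j P)) (ops2 D1 D2).

Definition tilde P c : distr R -> distr R :=
  opsubst c (ops4
    (fun u => M1 u - 2^-1 *: D2 u - PD P ord0 u)
    (fun u => M1 u + 2^-1 *: D2 u - PD P ord0 u)
    (fun u => 2^-1 *: D1 u + M2 u - PD P ord_max u)
    (fun u => 2^-1 *: D1 u - M2 u + PD P ord_max u)).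

Definition sigma P : distr R :=
  fourierD_inv (reg (fun zeta => expi (- evalR2 P zeta))).

Definition sigma1 P q : distr R := opsubst q (ops2 D1 D2) (sigma P).

End PDO.

(* Main.v *)
(* Every operator of the statement is, up to equality on Schwartz functions, the
   transpose of an operator on S(R^2), and the set of distributions modulo that
   equality carries the relations of the Weyl algebra.  Tracking [M_j] and [D_j]
   through the change of variables, the two Fourier transforms and the
   multiplication by [e^{-iP}] gives [Q X = X~ Q] for the four generators, hence
   [Q C = C~ Q]; moreover [D_1 Q = Q (D_1 + D_2)] and [D_2 Q = Q (M_2 - M_1)],
   so that [Q^(sigma_1) B = q(D_1, D_2) Q^(sigma) B = Q^(sigma) A B].
   For the regularity both [Q^(sigma)] and [Q^(sigma_1)] must be transposes of
   automorphisms of S(R^2) whose own transposes preserve S(R^2).  This needs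
   Fourier inversion and the slow increase of [1/q], which is the Lojasiewicz
   inequality [|q(z)| >= c (1 + |z|)^-N], obtained here from quantifier
   elimination for real closed fields. *)

(* Distributions are bare functionals compared on Schwartz functions only, so the operator
   identities are not equalities of functions. They are proved for a partial equivalence [eqd],
   reflexive exactly at the functionals linear on Schwartz functions, and operator substitution is
   studied over any relation of this kind. The analysis rests on closure principles: a class of
   differentiable bounded functions stable under partial derivatives and coordinate multiplications
   lies in S(R^2), and similarly for operators, so that a continuity proof reduces to algebraic
   relations and one sup estimate. The plane Fourier transform is a composite of two partial
   transforms and two exchanges of coordinates; inversion is therefore needed in one variable only.
   Since the convolution selects the symbol of tau by choice, that symbol must be shown unique.
   Q^(sigma) transports the argument of the operator and Q^(sigma_1) its value; only the inverse of
   the latter involves 1/q. The exponent in the Lojasiewicz bound comes from cusps 0 < m <= s^-N, s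
   >= s0, on which the sign of a polynomial in (s, m) is constant. *)
From HB Require Import structures.
From mathcomp Require Import all_boot all_order all_algebra.
From mathcomp Require Import all_classical all_reals all_analysis.
From mathcomp Require Import measurable_realfun complex.
From mathcomp Require mpoly.
From mathcomp Require ordered_qelim qe_rcf polyrcf.
From mathcomp Require Import ring lra.
Require Import Defs.
Import -(notations) mpoly.
Import Order.TTheory GRing.Theory Num.Theory.
Import numFieldNormedType.Exports.
Set Implicit Arguments.
Unset Strict Implicit.
Unset Printing Implicit Defensive.
Local Open Scope ring_scope.
Local Open Scope classical_set_scope.
Local Open Scope complex_scope.

(** * Complex valued functions *)

Section ComplexModulus.
Context {R : realType}.
Implicit Types (c d : R[i]) (x : R).

Lemma normC_cabs c : `|c| = (cabs c)%:C.
Proof. by rewrite /cabs normc_def. Qed.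

Lemma cabs_ge0 c : 0 <= cabs c.
Proof. by rewrite -lecR -normC_cabs normr_ge0. Qed.

Lemma cabs0 : cabs (0 : R[i]) = 0.
Proof. by apply: complexI; rewrite -normC_cabs normr0. Qed.

Lemma cabs_eq0 c : (cabs c == 0) = (c == 0).
Proof. by rewrite -[RHS]normr_eq0 normC_cabs eq_complex /= eqxx andbT. Qed.

Lemma cabsM c d : cabs (c * d) = cabs c * cabs d.
Proof. by apply: complexI; rewrite -normC_cabs normrM !normC_cabs rmorphM. Qed.

Lemma cabsN c : cabs (- c) = cabs c.
Proof. by apply: complexI; rewrite -!normC_cabs normrN. Qed.

Lemma cabsV c : cabs c^-1 = (cabs c)^-1.
Proof. by apply: complexI; rewrite -normC_cabs normfV normC_cabs fmorphV. Qed.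

Lemma cabsX c n : cabs (c ^+ n) = cabs c ^+ n.
Proof. by apply: complexI; rewrite -normC_cabs normrX normC_cabs rmorphXn. Qed.

Lemma cabsD c d : cabs (c + d) <= cabs c + cabs d.
Proof. by rewrite -lecR rmorphD /= -!normC_cabs ler_normD. Qed.

Lemma cabs_real x : cabs x%:C = `|x|.
Proof. by rewrite /cabs normc_def /= expr0n /= addr0 sqrtr_sqr. Qed.

Definition ci : R[i] := 0 +i* 1.

Lemma iE : ('i%R : R[i]) = ci.
Proof. by rewrite -complexiE. Qed.

Lemma sqr_ci : ci * ci = -1.
Proof. exact: sqr_i. Qed.

Lemma cabs_ci : cabs ci = 1.
Proof. by rewrite /cabs normc_def /= expr0n /= add0r expr1n sqrtr1. Qed.

Lemma sqr_cabs c : cabs c ^+ 2 = complex.Re c ^+ 2 + complex.Im c ^+ 2.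
Proof.
by rewrite /cabs normc_def /= sqr_sqrtr // addr_ge0 ?sqr_ge0.
Qed.

Lemma Re_le_cabs c : `|complex.Re c| <= cabs c.
Proof.
rewrite -(@ler_pXn2r _ 2) ?nnegrE ?cabs_ge0 ?normr_ge0 // sqr_cabs.
by rewrite real_normK ?num_real // lerDl sqr_ge0.
Qed.

Lemma Im_le_cabs c : `|complex.Im c| <= cabs c.
Proof.
rewrite -(@ler_pXn2r _ 2) ?nnegrE ?cabs_ge0 ?normr_ge0 // sqr_cabs.
by rewrite real_normK ?num_real // lerDr sqr_ge0.
Qed.

Lemma cabs_le_ReIm c : cabs c <= `|complex.Re c| + `|complex.Im c|.
Proof.
rewrite {1}(complexE c) (le_trans (cabsD _ _)) // cabsM -/ci cabs_ci mul1r.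
by rewrite !cabs_real.
Qed.

Lemma complexP c d :
  complex.Re c = complex.Re d -> complex.Im c = complex.Im d -> c = d.
Proof. by case: c d => ? ? [? ?] /= -> ->. Qed.

Lemma ReD c d : complex.Re (c + d) = complex.Re c + complex.Re d.
Proof. by case: c d => ? ? [? ?]. Qed.

Lemma ImD c d : complex.Im (c + d) = complex.Im c + complex.Im d.
Proof. by case: c d => ? ? [? ?]. Qed.

Lemma ReM c d : complex.Re (c * d) =
  complex.Re c * complex.Re d - complex.Im c * complex.Im d.
Proof. by case: c d => ? ? [? ?]. Qed.

Lemma ImM c d : complex.Im (c * d) =
  complex.Re c * complex.Im d + complex.Im c * complex.Re d.
Proof. by case: c d => ? ? [? ?]. Qed.

Lemma cabs_expi x : cabs (expi x) = 1.
Proof. by rewrite /cabs normc_def /= cos2Dsin2 sqrtr1. Qed.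

Lemma expiD x y : expi (x + y) = expi x * expi y.
Proof.
by apply: complexP; rewrite ?ReM ?ImM /= ?cosD ?sinD // addrC.
Qed.

Lemma expi0 : expi (0 : R) = 1.
Proof. by rewrite /expi cos0 sin0. Qed.

Lemma expiN x : expi x * expi (- x) = 1.
Proof. by rewrite -expiD subrr expi0. Qed.

End ComplexModulus.

Section ComplexDerivative.
Context {R : realType}.
Implicit Types (h k : R -> R[i]) (t : R) (c d e : R[i]).

Definition is_cderive h t d : Prop :=
  is_derive t (1 : R) (fun s => complex.Re (h s)) (complex.Re d) /\
  is_derive t (1 : R) (fun s => complex.Im (h s)) (complex.Im d).

Lemma is_cderive_eq h t d e : is_cderive h t d -> d = e -> is_cderive h t e.
Proof. by move=> ? <-. Qed.

Lemma is_cderive_cst c t : is_cderive (fun=> c) t 0.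
Proof. by split; apply: is_derive_cst. Qed.

Lemma is_cderiveD h k t d e : is_cderive h t d -> is_cderive k t e ->
  is_cderive (fun s => h s + k s) t (d + e).
Proof.
move=> [h1 h2] [k1 k2]; split; rewrite ?ReD ?ImD.
- under eq_fun do rewrite ReD; exact: is_deriveD.
- under eq_fun do rewrite ImD; exact: is_deriveD.
Qed.

Lemma is_cderiveM h k t d e : is_cderive h t d -> is_cderive k t e ->
  is_cderive (fun s => h s * k s) t (d * k t + h t * e).
Proof.
move=> [h1 h2] [k1 k2]; split.
- under eq_fun do rewrite ReM.
  apply: is_derive_eq; rewrite ReD !ReM /GRing.scale /=; ring.
- under eq_fun do rewrite ImM.
  apply: is_derive_eq; rewrite ImD !ImM /GRing.scale /=; ring.
Qed.

Lemma is_cderiveZ c h t d : is_cderive h t d ->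
  is_cderive (fun s => c * h s) t (c * d).
Proof.
move=> hd; apply: is_cderive_eq; first by apply: is_cderiveM hd; apply: is_cderive_cst.
by rewrite mul0r add0r.
Qed.

Lemma is_cderive_real (f : R -> R) t (d : R) :
  is_derive t (1 : R) f d -> is_cderive (fun s => (f s)%:C) t d%:C.
Proof. by move=> ?; split => //=; apply: is_derive_cst. Qed.

Lemma is_cderive_expi (f : R -> R) t (d : R) : is_derive t (1 : R) f d ->
  is_cderive (fun s => expi (f s)) t (ci * d%:C * expi (f t)).
Proof.
move=> fd; split.
- rewrite (_ : (fun s => _) = cos \o f) //.
  apply: is_derive_eq.
  rewrite !ReM !ImM /= /GRing.scale /=; ring.
- rewrite (_ : (fun s => _) = sin \o f) //.
  apply: is_derive_eq.
  rewrite !ImM !ReM /= /GRing.scale /=; ring.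
Qed.

Lemma is_cderive_comp h (f : R -> R) t d (e : R) :
  is_derive t (1 : R) f e -> is_cderive h (f t) d ->
  is_cderive (fun s => h (f s)) t (e%:C * d).
Proof.
move=> fd [h1 h2]; split.
- rewrite (_ : (fun s => _) = (fun s => complex.Re (h s)) \o f) //.
  apply: is_derive_eq; rewrite ReM /= /GRing.scale /=; ring.
- rewrite (_ : (fun s => _) = (fun s => complex.Im (h s)) \o f) //.
  apply: is_derive_eq; rewrite ImM /= /GRing.scale /=; ring.
Qed.

End ComplexDerivative.

(* Sealed versions of the notions of the statement: [done] and the unification
   algorithm would otherwise unfold them at great cost. *)
HB.lock Definition partial (R : realType) (j : 'I_2) (f : R * R -> R[i]) :
  R * R -> R[i] := pd j f.
HB.lock Definition Smooth (R : realType) (f : R * R -> R[i]) : Prop := smooth f.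
HB.lock Definition Schwartz (R : realType) (f : R * R -> R[i]) : Prop := schwartz f.
HB.lock Definition SlowlyIncreasing (R : realType) (f : R * R -> R[i]) : Prop :=
  slowly_increasing f.
Arguments partial {R}.

Section PartialDerivative.
Context {R : realType}.
Implicit Types (f g : R * R -> R[i]) (z : R * R) (j : 'I_2) (c d e : R[i]).

Lemma partialE : partial = pd :> ('I_2 -> (R * R -> R[i]) -> _).
Proof. by rewrite partial.unlock. Qed.

Lemma SmoothE f : Smooth f = smooth f. Proof. by rewrite Smooth.unlock. Qed.

Lemma SchwartzE f : Schwartz f = schwartz f. Proof. by rewrite Schwartz.unlock. Qed.

Lemma SlowlyIncreasingE f : SlowlyIncreasing f = slowly_increasing f.
Proof. by rewrite SlowlyIncreasing.unlock. Qed.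

Definition has_pd j f z d := is_cderive (slice f j z) (coord j z) d.

Lemma has_pdP j f z d : has_pd j f z d -> pderivable f j z /\ partial j f z = d.
Proof.
move=> [h1 h2]; split; first by split; exact: ex_derive.
by rewrite partialE /pd !derive1E !derive_val; case: d {h1 h2}.
Qed.

Lemma partial_eq j f z d : has_pd j f z d -> partial j f z = d.
Proof. by case/has_pdP. Qed.

Lemma pderivable_has_pd j f z : pderivable f j z -> has_pd j f z (partial j f z).
Proof. by case=> h1 h2; split; rewrite partialE /pd /=;
  [have := derivableP h1|have := derivableP h2]; rewrite -derive1E. Qed.

Lemma has_pd_eq j f z d e : has_pd j f z d -> d = e -> has_pd j f z e.
Proof. by move=> ? <-. Qed.

Lemma slice_coord j f z : slice f j z (coord j z) = f z.
Proof. by rewrite /slice /coord; case: (j == ord0); case: z. Qed.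

Lemma has_pd_cst j c z : has_pd j (fun=> c) z 0.
Proof.
rewrite /has_pd (_ : slice _ j z = fun=> c); first exact: is_cderive_cst.
by apply/funext => t; rewrite /slice; case: ifP.
Qed.

Lemma has_pdD j f g z d e : has_pd j f z d -> has_pd j g z e ->
  has_pd j (fun z => f z + g z) z (d + e).
Proof.
move=> hf hg; rewrite /has_pd.
rewrite (_ : slice _ j z = fun t => slice f j z t + slice g j z t).
  exact: is_cderiveD.
by apply/funext => t; rewrite /slice; case: ifP.
Qed.

Lemma has_pdM j f g z d e : has_pd j f z d -> has_pd j g z e ->
  has_pd j (fun z => f z * g z) z (d * g z + f z * e).
Proof.
move=> hf hg; rewrite /has_pd.
rewrite (_ : slice _ j z = fun t => slice f j z t * slice g j z t).
  by have := is_cderiveM hf hg; rewrite !slice_coord.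
by apply/funext => t; rewrite /slice; case: ifP.
Qed.

Lemma has_pdZ j c f z d : has_pd j f z d -> has_pd j (fun z => c * f z) z (c * d).
Proof.
move=> hf; apply: has_pd_eq; first by apply: has_pdM hf; apply: has_pd_cst.
by rewrite mul0r add0r.
Qed.

Lemma has_pd_coord j k z :
  has_pd j (fun z => (coord k z)%:C) z (j == k)%:R%:C.
Proof.
rewrite /has_pd /slice /coord.
case: (unliftP ord0 j) => [j'|] ->; case: (unliftP ord0 k) => [k'|] ->;
  rewrite ?eqxx ?(negbTE (neq_lift _ _)) ?[lift _ _ == ord0]eq_sym
    ?(negbTE (neq_lift _ _)) /=.
- rewrite ord1 [k']ord1 eqxx; apply: is_cderive_real; exact: is_derive_id.
- exact: is_cderive_cst.
- exact: is_cderive_cst.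
- apply: is_cderive_real; exact: is_derive_id.
Qed.

Lemma has_pd_expi j (f : R * R -> R) z (d : R) :
  has_pd j (fun z => (f z)%:C) z d%:C ->
  has_pd j (fun z => expi (f z)) z (ci * d%:C * expi (f z)).
Proof.
move=> [hf _]; rewrite /has_pd.
pose s t := if j == ord0 then f (t, z.2) else f (z.1, t).
have E : (fun t => complex.Re (slice (fun z => (f z)%:C) j z t)) = s.
  by apply/funext => t; rewrite /slice /s; case: ifP.
rewrite E /= in hf.
rewrite (_ : slice _ j z = fun t => expi (s t)); last first.
  by apply/funext => t; rewrite /slice /s; case: ifP.
have := is_cderive_expi hf; rewrite /s /coord.
by case: (j == ord0); case: (z).
Qed.

Lemma ord2P (j : 'I_2) : j = ord0 \/ j = ord_max.
Proof. by case: j => [[|[|]] // i]; [left|right]; apply: val_inj. Qed.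

End PartialDerivative.

(** * Smooth, slowly increasing and Schwartz functions *)

Section MeanValue.
Context {R : realType}.
Implicit Types (g dg : R -> R) (a b t K : R).

(** The position of [c] is expressed by its distance to [a], so that one statement covers both
    orders of the endpoints. *)
Lemma MVT_any g dg a b : (forall t, is_derive t (1 : R) g (dg t)) ->
  exists2 c, `|c - a| <= `|b - a| & g b - g a = dg c * (b - a).
Proof.
move=> gd.
have cg : continuous g.
  by move=> t; apply: differentiable_continuous; apply/derivable1_diffP; exact: ex_derive.
have [ab|ba] := leP a b.
  have [c /andP[]] := @MVT_segment R g dg a b ab (fun t _ => gd t)
    (continuous_subspaceT cg).
  rewrite !bnd_simp => h1 h2 E; exists c => //.
  by rewrite !ger0_norm ?subr_ge0 // lerB.
have [c /andP[]] := @MVT_segment R g dg b a (ltW ba) (fun t _ => gd t)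
  (continuous_subspaceT cg).
rewrite !bnd_simp => h1 h2 E; exists c.
  by rewrite !ler0_norm ?subr_le0 // ?lerN2 ?lerB // ltW.
by rewrite -[LHS]opprB E -mulrN opprB.
Qed.

Lemma lipschitz_of_derive g dg a b K : (forall t, is_derive t (1 : R) g (dg t)) ->
  (forall c, `|c - a| <= `|b - a| -> `|dg c| <= K) ->
  `|g b - g a| <= K * `|b - a|.
Proof.
move=> gd hK; have [c hc ->] := MVT_any a b gd.
by rewrite normrM ler_wpM2r // hK.
Qed.

End MeanValue.

(** * Symmetry of second derivatives *)

Section Clairaut.
Context {R : realType}.
Implicit Types (h : R * R -> R).

(** Mean value theorem in x for the difference of two horizontal slices, then in y for [h1]. The
    second difference on the left is symmetric in the two variables, so it equally yields the other
    mixed derivative. *)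
Lemma mixed_difference h h1 h12 (a b t : R) : 0 <= t ->
  (forall x y : R, is_derive x (1 : R) (fun s => h (s, y)) (h1 (x, y))) ->
  (forall x y : R, is_derive y (1 : R) (fun s => h1 (x, s)) (h12 (x, y))) ->
  exists p : R * R, [/\ `|p.1 - a| <= t, `|p.2 - b| <= t &
    h (a + t, b + t) - h (a + t, b) - h (a, b + t) + h (a, b) =
    h12 p * t ^+ 2].
Proof.
move=> t0 d1 d2.
have d (x : R) : is_derive x (1 : R) (fun s => h (s, b + t) - h (s, b))
    (h1 (x, b + t) - h1 (x, b)) by apply: is_deriveB.
have [c hc Ec] := MVT_any a (a + t) d.
have [e he Ee] := MVT_any b (b + t) (d2 c).
exists (c, e); split => /=.
- by move: hc; rewrite addrAC subrr add0r (ger0_norm t0).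
- by move: he; rewrite addrAC subrr add0r (ger0_norm t0).
- rewrite expr2 mulrA.
  have -> : h12 (c, e) * t = h1 (c, b + t) - h1 (c, b).
    by rewrite Ee addrAC subrr add0r.
  move: Ec; rewrite [a + t - a]addrAC subrr add0r => <-; ring.
Qed.

(** If the mixed derivatives differed at [z], continuity would keep each of them within [e], half
    the gap, of its value on a small square, where both compute the same second difference. *)
Lemma clairaut h h1 h2 h12 h21 (z : R * R) :
  (forall x y : R, is_derive x (1 : R) (fun s => h (s, y)) (h1 (x, y))) ->
  (forall x y : R, is_derive y (1 : R) (fun s => h (x, s)) (h2 (x, y))) ->
  (forall x y : R, is_derive y (1 : R) (fun s => h1 (x, s)) (h12 (x, y))) ->
  (forall x y : R, is_derive x (1 : R) (fun s => h2 (s, y)) (h21 (x, y))) ->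
  {for z, continuous h12} -> {for z, continuous h21} -> h12 z = h21 z.
Proof.
case: z => a b d1 d2 d12 d21 c12 c21.
apply/eqP/negPn/negP => ne.
pose e := `|h12 (a, b) - h21 (a, b)| / 2.
have e0 : 0 < e by rewrite divr_gt0 // normr_gt0 subr_eq0.
move/cvgrPdist_lt: c12 => /(_ e e0) /nbhs_ballP[r1 /= r10 B1].
move/cvgrPdist_lt: c21 => /(_ e e0) /nbhs_ballP[r2 /= r20 B2].
pose t := Num.min r1 r2 / 2.
have m0 : 0 < Num.min r1 r2 by rewrite lt_min r10 r20.
have t0 : 0 < t by rewrite divr_gt0.
have tr1 : t < r1.
  rewrite /t ltr_pdivrMr //; apply: (@le_lt_trans _ _ r1).
    by rewrite ge_min lexx.
  by rewrite ltr_pMr // ltr1n.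
have tr2 : t < r2.
  rewrite /t ltr_pdivrMr //; apply: (@le_lt_trans _ _ r2).
    by rewrite ge_min lexx orbT.
  by rewrite ltr_pMr // ltr1n.
have [p [p1 p2 Ep]] := @mixed_difference h h1 h12 a b t (ltW t0) d1 d12.
(* The same second difference, read with the coordinates exchanged. *)
have [q [q1 q2 Eq]] := @mixed_difference (fun z => h (z.2, z.1))
  (fun z => h2 (z.2, z.1)) (fun z => h21 (z.2, z.1)) b a t (ltW t0)
  (fun x y => d2 y x) (fun x y => d21 y x).
have E : h12 p = h21 (q.2, q.1).
  apply: (@mulIf _ (t ^+ 2)); first by rewrite expf_neq0 // gt_eqF.
  by rewrite -Ep -Eq /=; ring.
have {}B1 := B1 p; have {}B2 := B2 (q.2, q.1).
have /B1 : ball (a, b) r1 p.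
  by split => /=; rewrite /ball /= distrC (le_lt_trans _ tr1).
have /B2 : ball (a, b) r2 (q.2, q.1).
  by split => /=; rewrite /ball /= distrC (le_lt_trans _ tr2).
rewrite E => l2 l1.
have : `|h12 (a, b) - h21 (a, b)| < e + e.
  rewrite -(subrKA (h21 (q.2, q.1))) (le_lt_trans (ler_normD _ _)) //.
  by rewrite ltrD // distrC.
by rewrite -splitr ltxx.
Qed.

End Clairaut.

(** * Polynomial growth and closure principles for function classes *)

Section PolynomialGrowth.
Context {R : realType}.
Implicit Types (f g : R * R -> R[i]) (z : R * R) (j : 'I_2).

Definition weight z : R := 1 + `|z.1| + `|z.2|.

Lemma weight_ge1 z : 1 <= weight z.
Proof. by rewrite /weight -addrA lerDl addr_ge0. Qed.

Lemma weight_gt0 z : 0 < weight z.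
Proof. exact: lt_le_trans (weight_ge1 z). Qed.

Lemma coord_le_weight j z : `|coord j z| <= weight z.
Proof.
by rewrite /coord /weight; case: ifP => _;
  have := normr_ge0 z.1; have := normr_ge0 z.2; lra.
Qed.

Lemma weight_expr_le z k l : (k <= l)%N -> weight z ^+ k <= weight z ^+ l.
Proof. by move=> kl; rewrite ler_weXn2l // weight_ge1. Qed.

Definition poly_bounded f : Prop :=
  exists k : nat, exists K : R, forall z, cabs (f z) <= K * weight z ^+ k.

Lemma bound_ge0 k (K : R) f : (forall z, cabs (f z) <= K * weight z ^+ k) -> 0 <= K.
Proof.
move=> /(_ 0); rewrite /weight /= normr0 !addr0 expr1n mulr1.
exact/le_trans/cabs_ge0.
Qed.

Lemma poly_bounded_cst (c : R[i]) : poly_bounded (fun=> c).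
Proof. by exists 0%N, (cabs c) => z; rewrite expr0 mulr1. Qed.

Lemma poly_bounded_coord j : poly_bounded (fun z => (coord j z)%:C).
Proof.
by exists 1%N, 1 => z; rewrite mul1r expr1 cabs_real coord_le_weight.
Qed.

Lemma poly_boundedM f g : poly_bounded f -> poly_bounded g ->
  poly_bounded (fun z => f z * g z).
Proof.
move=> [k [K hK]] [l [L hL]]; exists (k + l)%N, (K * L) => z.
by rewrite cabsM exprD mulrACA ler_pM ?cabs_ge0.
Qed.

Lemma poly_boundedD f g : poly_bounded f -> poly_bounded g ->
  poly_bounded (fun z => f z + g z).
Proof.
move=> [k [K hK]] [l [L hL]]; exists (k + l)%N, (K + L) => z.
have K0 := bound_ge0 hK; have L0 := bound_ge0 hL.
apply: (le_trans (cabsD _ _)); rewrite mulrDl lerD //.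
- by apply: (le_trans (hK z)); rewrite ler_wpM2l // weight_expr_le // leq_addr.
- by apply: (le_trans (hL z)); rewrite ler_wpM2l // weight_expr_le // leq_addl.
Qed.

Lemma poly_bounded_bounded f (K : R) : (forall z, cabs (f z) <= K) -> poly_bounded f.
Proof. by move=> hK; exists 0%N, K => z; rewrite expr0 mulr1. Qed.

Lemma poly_bounded_locally f z : poly_bounded f -> exists K : R,
  forall z', `|z'.1 - z.1| <= 1 -> `|z'.2 - z.2| <= 1 -> cabs (f z') <= K.
Proof.
move=> [k [K hK]]; exists (K * (2 + weight z) ^+ k) => z' h1 h2.
apply: (le_trans (hK z')); rewrite ler_wpM2l ?(bound_ge0 hK) //.
apply: lerXn2r.
- by rewrite nnegrE ltW // weight_gt0.
- by rewrite nnegrE addr_ge0 // ltW // weight_gt0.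
have l1 : `|z'.1| <= 1 + `|z.1|.
  by rewrite -[z'.1](subrK z.1) (le_trans (ler_normD _ _)) // lerD2r.
have l2 : `|z'.2| <= 1 + `|z.2|.
  by rewrite -[z'.2](subrK z.2) (le_trans (ler_normD _ _)) // lerD2r.
by rewrite /weight; lra.
Qed.

Lemma has_pd0E f (x y : R) d :
  has_pd ord0 f (x, y) d <-> is_cderive (fun s => f (s, y)) x d.
Proof. by []. Qed.

Lemma has_pd1E f (x y : R) d :
  has_pd ord_max f (x, y) d <-> is_cderive (fun s => f (x, s)) y d.
Proof. by []. Qed.

(** The point is moved horizontally along y = b, then vertically; both mean value estimates stay in
    the region around [z] where [K] bounds the partial derivatives. *)
Lemma continuous_of_partials (f f1 f2 : R * R -> R) z (K : R) :
  (forall x y : R, is_derive x (1 : R) (fun s => f (s, y)) (f1 (x, y))) ->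
  (forall x y : R, is_derive y (1 : R) (fun s => f (x, s)) (f2 (x, y))) ->
  (forall z', `|z'.1 - z.1| <= 1 -> `|z'.2 - z.2| <= 1 ->
     `|f1 z'| <= K /\ `|f2 z'| <= K) ->
  {for z, continuous f}.
Proof.
case: z => a b d1 d2 hK.
have K0 : 0 <= K.
  by have [] := hK (a, b); rewrite /= ?subrr ?normr0 // => /(le_trans (normr_ge0 _)).
apply/cvgrPdist_lt => e e0; apply/(@nbhs_ballP _ (R * R)%type).
have D0 : 0 < 2 * (K + 1) by rewrite mulr_gt0 // ltr_wpDl.
(* Each of the two moves costs less than e / 2; K + 1 keeps the denominator positive when K = 0. *)
exists (Num.min 1 (e / (2 * (K + 1)))).
  by rewrite /= lt_min ltr01 divr_gt0.
move=> [x y] [] /=; rewrite /ball /= !lt_min => /andP[x1 xe] /andP[y1 ye].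
rewrite distrC in x1 xe; rewrite distrC in y1 ye.
have A : `|f (x, b) - f (a, b)| <= K * `|x - a|.
  apply: (@lipschitz_of_derive _ _ (fun s => f1 (s, b)) _ _ _ (d1^~ b)).
  move=> c hc; have [] := hK (c, b) => //=; last by rewrite subrr normr0.
  exact: le_trans hc (ltW _).
have B : `|f (x, y) - f (x, b)| <= K * `|y - b|.
  apply: (@lipschitz_of_derive _ _ (fun s => f2 (x, s)) _ _ _ (d2 x)).
  move=> c hc; have [] := hK (x, c) => //=; first exact: ltW.
  exact: le_trans hc (ltW _).
rewrite ltr_pdivlMr // in xe; rewrite ltr_pdivlMr // in ye.
rewrite distrC -(subrKA (f (x, b))) (le_lt_trans (ler_normD _ _)) //.
have := normr_ge0 (x - a); have := normr_ge0 (y - b).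
move: A B xe ye; set u := `|x - a|; set v := `|y - b| => A B xe ye v0 u0.
by apply: (le_lt_trans (lerD B A)); nra.
Qed.

Lemma continuous_of_partial f : (forall j z, pderivable f j z) ->
  (forall j, poly_bounded (partial j f)) ->
  continuous (fun z => complex.Re (f z)) /\ continuous (fun z => complex.Im (f z)).
Proof.
move=> df bf.
have d0 x y := pderivable_has_pd (df ord0 (x, y)).
have d1 x y := pderivable_has_pd (df ord_max (x, y)).
have B z : exists K : R, forall z', `|z'.1 - z.1| <= 1 -> `|z'.2 - z.2| <= 1 ->
    cabs (partial ord0 f z') <= K /\ cabs (partial ord_max f z') <= K.
  have [K hK] := poly_bounded_locally z (bf ord0).
  have [L hL] := poly_bounded_locally z (bf ord_max).
  exists (Num.max K L) => z' h1 h2.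
  by rewrite !le_max (hK _ h1 h2) (hL _ h1 h2) orbT.
split=> z; have [K hK] := B z.
- apply: (@continuous_of_partials _ (fun z => complex.Re (partial ord0 f z))
    (fun z => complex.Re (partial ord_max f z)) z K).
  + by move=> x y; case: (d0 x y).
  + by move=> x y; case: (d1 x y).
  + move=> z' h1 h2; have [? ?] := hK z' h1 h2.
    by split; apply: (le_trans (Re_le_cabs _)).
- apply: (@continuous_of_partials _ (fun z => complex.Im (partial ord0 f z))
    (fun z => complex.Im (partial ord_max f z)) z K).
  + by move=> x y; case: (d0 x y).
  + by move=> x y; case: (d1 x y).
  + move=> z' h1 h2; have [? ?] := hK z' h1 h2.
    by split; apply: (le_trans (Im_le_cabs _)).
Qed.

Definition partial2 m n f : R * R -> R[i] :=
  iter m (partial ord0) (iter n (partial ord_max) f).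

Lemma partial2E m n f : partial2 m n f = pd2 m n f.
Proof. by rewrite /partial2 partialE. Qed.

Lemma partial2_class (C : (R * R -> R[i]) -> Prop) :
  (forall f j, C f -> C (partial j f)) -> forall m n f, C f -> C (partial2 m n f).
Proof.
move=> Cpd m n f Cf; rewrite /partial2; elim: m => [|m IH] /=; last exact: Cpd.
by elim: n => [|n IH] //=; exact: Cpd.
Qed.

(** [smooth] demands continuity of every iterated derivative. The partials of a member of [C] are in
    [C], hence polynomially bounded, and this already forces continuity of the member; closure then
    treats all orders at once. *)
Lemma slowly_increasing_coind (C : (R * R -> R[i]) -> Prop) :
  (forall f j z, C f -> pderivable f j z) ->
  (forall f, C f -> poly_bounded f) ->
  (forall f j, C f -> C (partial j f)) ->
  forall f, C f -> SlowlyIncreasing f.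
Proof.
move=> Cd Cb Cpd f Cf; rewrite SlowlyIncreasingE; split.
  move=> s; rewrite -partialE; have Cg : C (foldr partial f s) by elim: s => //= j s IH; exact: Cpd.
  have [] := @continuous_of_partial (foldr partial f s).
  - by move=> j z; exact: Cd.
  - by move=> j; apply: Cb; exact: Cpd.
  by move=> c1 c2; split => // j z; exact: Cd.
by move=> m n; rewrite -partial2E; apply: Cb; exact: partial2_class.
Qed.

Definition mulc j f : R * R -> R[i] := fun z => (coord j z)%:C * f z.

Lemma iter_mulc j n f z : iter n (mulc j) f z = (coord j z)%:C ^+ n * f z.
Proof.
by elim: n => [|n IH] /=; rewrite ?expr0 ?mul1r // {1}/mulc IH exprS mulrA.
Qed.

Lemma seminormE a b f z : `|z.1| ^+ a * `|z.2| ^+ b * cabs (f z) =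
  cabs (iter a (mulc ord0) (iter b (mulc ord_max) f) z).
Proof. by rewrite !iter_mulc !cabsM !cabsX !cabs_real mulrA. Qed.

(** Since multiplication by the coordinates also stays in [C], every seminorm of [f] is the sup norm
    of another member of [C]. *)
Lemma schwartz_coind (C : (R * R -> R[i]) -> Prop) :
  (forall f j z, C f -> pderivable f j z) ->
  (forall f, C f -> exists K, forall z, cabs (f z) <= K) ->
  (forall f j, C f -> C (partial j f)) ->
  (forall f j, C f -> C (mulc j f)) ->
  forall f, C f -> Schwartz f.
Proof.
move=> Cd Cb Cpd Cm f Cf; rewrite SchwartzE; split.
  have Cb' g : C g -> poly_bounded g.
    by move=> /Cb[K hK]; exact: poly_bounded_bounded hK.
  by have := slowly_increasing_coind Cd Cb' Cpd Cf; rewrite SlowlyIncreasingE => -[].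
move=> a b m n.
have Citer j k g : C g -> C (iter k (mulc j) g).
  by move=> Cg; elim: k => //= k; exact: Cm.
have [K hK] : exists K, forall z,
    cabs (iter a (mulc ord0) (iter b (mulc ord_max) (partial2 m n f)) z) <= K.
  by apply: Cb; apply/Citer/Citer; exact: partial2_class.
by exists K => z; rewrite -partial2E seminormE.
Qed.

End PolynomialGrowth.

(** * Linear structure and commuting derivatives *)

Section Smooth.
Context {R : realType}.
Implicit Types (f g : R * R -> R[i]) (z : R * R) (j : 'I_2).

Lemma smooth_partial f j : Smooth f -> Smooth (partial j f).
Proof.
by rewrite !SmoothE partialE => sf s; have := sf (rcons s j); rewrite foldr_rcons.
Qed.

Lemma smooth_pderivable f j z : Smooth f -> pderivable f j z.
Proof. by rewrite SmoothE => /(_ [::]) []. Qed.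

Lemma smooth_has_pd f j z : Smooth f -> has_pd j f z (partial j f z).
Proof. by move=> sf; apply: pderivable_has_pd; exact: smooth_pderivable. Qed.

Lemma smooth_continuous f : Smooth f ->
  continuous (fun z => complex.Re (f z)) /\ continuous (fun z => complex.Im (f z)).
Proof. by rewrite SmoothE => /(_ [::]) []. Qed.

Lemma partial_comm f : Smooth f -> partial ord_max (partial ord0 f) = partial ord0 (partial ord_max f).
Proof.
move=> sf; apply/funext => z.
have s0 := smooth_partial ord0 sf; have s1 := smooth_partial ord_max sf.
have [cr ci] := smooth_continuous (smooth_partial ord_max s0).
have [cr' ci'] := smooth_continuous (smooth_partial ord0 s1).
apply: complexP.
- apply: (@clairaut _ (fun z => complex.Re (f z))
    (fun z => complex.Re (partial ord0 f z)) (fun z => complex.Re (partial ord_max f z)) _ _ z)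
    (cr z) (cr' z) => x y.
  + by case: (smooth_has_pd ord0 (x, y) sf).
  + by case: (smooth_has_pd ord_max (x, y) sf).
  + by case: (smooth_has_pd ord_max (x, y) s0).
  + by case: (smooth_has_pd ord0 (x, y) s1).
- apply: (@clairaut _ (fun z => complex.Im (f z))
    (fun z => complex.Im (partial ord0 f z)) (fun z => complex.Im (partial ord_max f z)) _ _ z)
    (ci z) (ci' z) => x y.
  + by case: (smooth_has_pd ord0 (x, y) sf).
  + by case: (smooth_has_pd ord_max (x, y) sf).
  + by case: (smooth_has_pd ord_max (x, y) s0).
  + by case: (smooth_has_pd ord0 (x, y) s1).
Qed.

Lemma smooth_iter j n f : Smooth f -> Smooth (iter n (partial j) f).
Proof. by move=> sf; elim: n => //= n; exact: smooth_partial. Qed.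

(** [partial2] takes the y derivatives before the x derivatives, so an x derivative applied directly
    to [f] has to be carried outwards past them. *)
Lemma partial2_partial0 m n f : Smooth f -> partial2 m n (partial ord0 f) = partial2 m.+1 n f.
Proof.
move=> sf; rewrite /partial2 [in RHS]iterSr; congr (iter m _ _).
elim: n => //= n IH; rewrite IH partial_comm //; exact: smooth_iter.
Qed.

Lemma partial2_partial1 m n f : partial2 m n (partial ord_max f) = partial2 m n.+1 f.
Proof. by rewrite /partial2 iterSr. Qed.

Lemma partial_lin j (c : R[i]) f g : Smooth f -> Smooth g ->
  partial j (c *: f + g) = c *: partial j f + partial j g.
Proof.
move=> sf sg; apply/funext => z; apply: partial_eq.
by apply: has_pdD; [apply: has_pdZ|]; exact: smooth_has_pd.
Qed.

Lemma smooth_lin (c : R[i]) f g : Smooth f -> Smooth g -> Smooth (c *: f + g).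
Proof.
rewrite !SmoothE => sf sg s; rewrite -partialE; have -> : foldr partial (c *: f + g) s = c *: foldr partial f s + foldr partial g s.
  elim: s => [|j s IH] //; rewrite [LHS]/= IH; apply: partial_lin; rewrite SmoothE.
    by move=> t; rewrite partialE -foldr_cat; exact: sf.
  by move=> t; rewrite partialE -foldr_cat; exact: sg.
have := sf s; rewrite -partialE => -[cr ci df].
have := sg s; rewrite -partialE => -[cr' ci' dg]; split.
- move=> z; rewrite (_ : (fun z => _) = fun z =>
     complex.Re c * complex.Re (foldr partial f s z)
      - complex.Im c * complex.Im (foldr partial f s z) + complex.Re (foldr partial g s z)).
    apply: cvgD; last exact: cr'.
    by apply: cvgB; apply: cvgMr; [exact: cr|exact: ci].
  by apply/funext => w; rewrite ReD -ReM.
- move=> z; rewrite (_ : (fun z => _) = fun z =>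
     complex.Re c * complex.Im (foldr partial f s z)
      + complex.Im c * complex.Re (foldr partial f s z) + complex.Im (foldr partial g s z)).
    apply: cvgD; last exact: ci'.
    by apply: cvgD; apply: cvgMr; [exact: ci|exact: cr].
  by apply/funext => w; rewrite ImD -ImM.
- move=> j z; have [] // := @has_pdP _ j (c *: foldr partial f s + foldr partial g s) z
    (c * partial j (foldr partial f s) z + partial j (foldr partial g s) z).
  by apply: has_pdD; [apply: has_pdZ|]; exact: pderivable_has_pd.
Qed.

Lemma partial2_lin m n (c : R[i]) f g : Smooth f -> Smooth g ->
  partial2 m n (c *: f + g) = c *: partial2 m n f + partial2 m n g.
Proof.
move=> sf sg; rewrite /partial2.
have -> : iter n (partial ord_max) (c *: f + g) =
    c *: iter n (partial ord_max) f + iter n (partial ord_max) g.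
  by elim: n => //= n ->; rewrite partial_lin //; exact: smooth_iter.
elim: m => //= m ->; rewrite partial_lin //; do 2 exact/smooth_iter/smooth_iter.
Qed.

Lemma schwartz_smooth f : Schwartz f -> Smooth f.
Proof. by rewrite SchwartzE SmoothE => -[]. Qed.

Lemma schwartz_lin (c : R[i]) f g : Schwartz f -> Schwartz g -> Schwartz (c *: f + g).
Proof.
rewrite !SchwartzE => -[+ bf] [+ bg]; rewrite -!SmoothE => sf sg.
split; first by rewrite -SmoothE; exact: smooth_lin.
move=> a b m n; have [K hK] := bf a b m n; have [L hL] := bg a b m n.
exists (cabs c * K + L) => z; rewrite -partial2E partial2_lin //.
apply: le_trans (_ : `|z.1| ^+ a * `|z.2| ^+ b *
   (cabs c * cabs (partial2 m n f z) + cabs (partial2 m n g z)) <= _).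
  rewrite ler_wpM2l ?mulr_ge0 ?exprn_ge0 // -cabsM; exact: (cabsD (c * _) _).
have {hK} := hK z; have {hL} := hL z; rewrite -!partial2E => hL hK.
rewrite mulrDr; apply: lerD hL; rewrite mulrCA.
exact: ler_wpM2l (cabs_ge0 c) _ _ hK.
Qed.

Lemma schwartz0 : Schwartz (0 : R * R -> R[i]).
Proof.
apply: (@schwartz_coind _ (fun f => f = 0)) => // [f j z|f|f j|f j] ->.
- by have [] := has_pdP (has_pd_cst j 0 z).
- by exists 0 => z; rewrite cabs0.
- by apply/funext => z; rewrite (partial_eq (has_pd_cst j 0 z)).
- by apply/funext => z; rewrite /mulc mulr0.
Qed.

Lemma schwartzZ (c : R[i]) f : Schwartz f -> Schwartz (c *: f).
Proof. by move=> sf; rewrite -[_ *: f]addr0; exact/schwartz_lin/schwartz0. Qed.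

Lemma schwartzB f g : Schwartz f -> Schwartz g -> Schwartz (f - g).
Proof. by move=> sf sg; rewrite addrC -scaleN1r; exact: schwartz_lin. Qed.

End Smooth.

Lemma mpoly_ring_ind n (A : comNzRingType) (C : mpoly n A -> Prop) :
  (forall c, C (mpolyC n c)) -> (forall k, C (mpolyX A (mnm1 k))) ->
  (forall p q, C p -> C q -> C (p + q)) -> (forall p q, C p -> C q -> C (p * q)) ->
  forall p, C p.
Proof.
move=> CC CX CD CM; elim/mpolyind => [|c m p _ _ Cp]; first by rewrite -mpolyC0.
apply: CD => //; rewrite -mul_mpolyC; apply: (CM) => //.
rewrite mpolyXE_id; apply: (big_ind C) => [||k _]; [by rewrite -mpolyC1 | exact: CM | ].
elim: (m k) => [|l IH]; first by rewrite expr0 -mpolyC1.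
by rewrite exprS; exact: CM.
Qed.

(** * Polynomials as functions on the plane *)

Section PolynomialFunctions.
Context {R : realType}.
Implicit Types (p q : mpoly 2 R[i]) (z : R * R) (j : 'I_2).

Lemma eval2C c : eval2 (mpolyC 2 c) = fun _ : R * R => c.
Proof. by apply/funext => z; exact: mevalC. Qed.

Lemma eval2X j : eval2 (mpolyX R[i] (mnm1 j)) = fun z => (coord j z)%:C.
Proof. by apply/funext => z; exact: mevalXU. Qed.

Lemma eval2D p q : eval2 (p + q) = fun z => eval2 p z + eval2 q z.
Proof. by apply/funext => z; exact: mevalD. Qed.

Lemma eval2M p q : eval2 (p * q) = fun z => eval2 p z * eval2 q z.
Proof. by apply/funext => z; exact: mevalM. Qed.

Lemma eval2_has_pd j p z : has_pd j (eval2 p) z (eval2 (mderiv j p) z).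
Proof.
elim/mpoly_ring_ind: p z => [c|k|p q Hp Hq|p q Hp Hq] z.
- by rewrite mderivC eval2C -mpolyC0 eval2C; exact: has_pd_cst.
- have -> : mderiv j (mpolyX R[i] (mnm1 k)) = mpolyC 2 (j == k)%:R.
    rewrite mderivX mnm1E [k == j]eq_sym; case: eqP => [->|_].
      rewrite scale1r (_ : mnm_sub _ _ = mnm0) ?mpolyX0 //.
      by apply/mnmP => l; rewrite mnmBE mnm0E subnn.
    by rewrite scale0r mpolyC0.
  rewrite eval2C eval2X; apply: has_pd_eq (has_pd_coord j k z) _.
  by case: (j == k).
- by rewrite mderivD !eval2D; exact: has_pdD.
- rewrite mderivM eval2M eval2D !eval2M; apply: has_pd_eq (has_pdM (Hp z) (Hq z)) _.
  by rewrite addrC.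
Qed.

Lemma partial_eval2 j p : partial j (eval2 p) = eval2 (mderiv j p).
Proof. by apply/funext => z; exact: partial_eq (eval2_has_pd j p z). Qed.

Lemma poly_bounded_eval2 p : poly_bounded (eval2 p).
Proof.
elim/mpoly_ring_ind: p => [c|k|p q Hp Hq|p q Hp Hq].
- by rewrite eval2C; exact: poly_bounded_cst.
- by rewrite eval2X; exact: poly_bounded_coord.
- by rewrite eval2D; exact: poly_boundedD.
- by rewrite eval2M; exact: poly_boundedM.
Qed.

Lemma slowly_increasing_eval2 p : SlowlyIncreasing (eval2 p).
Proof.
apply: (@slowly_increasing_coind _ (fun f => exists p, f = eval2 p)); last by exists p.
- by move=> _ j z [r ->]; have [] := has_pdP (eval2_has_pd j r z).
- by move=> _ [r ->]; exact: poly_bounded_eval2.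
- by move=> _ j [r ->]; exists (mderiv j r); rewrite partial_eval2.
Qed.

End PolynomialFunctions.

(** * Continuous operators on Schwartz functions *)

(** The condition imposed on [psi - phi] in [tempered]: a basic neighbourhood of 0 in S(R^2). *)
HB.lock Definition small (R : realType) (N : nat) (f : R * R -> R[i]) (delta : R) :
  Prop := forall a b m n, (a <= N)%N -> (b <= N)%N -> (m <= N)%N -> (n <= N)%N ->
    seminorm_le a b m n f delta.

Section ContinuousOperators.
Context {R : realType}.
Let fn := R * R -> R[i].
Implicit Types (f g phi psi : fn) (K L : fn -> fn) (z : R * R) (j : 'I_2) (c : R[i])
  (delta C : R) (N : nat).

Lemma smallP N f delta : small N f delta <-> forall a b m n,
  (a <= N)%N -> (b <= N)%N -> (m <= N)%N -> (n <= N)%N -> forall z,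
  cabs (iter a (mulc ord0) (iter b (mulc ord_max) (partial2 m n f)) z) <= delta.
Proof.
rewrite small.unlock; split=> h a b m n aN bN mN nN z.
- by rewrite -seminormE partial2E; exact: h.
- by rewrite -partial2E seminormE; exact: h.
Qed.

Lemma small_le N N' f delta delta' : (N <= N')%N -> delta <= delta' ->
  small N' f delta -> small N f delta'.
Proof.
move=> NN' dd /smallP h; apply/smallP => a b m n aN bN mN nN z.
by apply: le_trans dd; apply: h; exact: leq_trans NN'.
Qed.

(** The property being monotone in [N] and [C], maxima over the finitely many indices serve them
    all. *)
Lemma uniform_choice (P : nat -> nat -> R -> Prop) A :
  (forall a N N' C C', (N <= N')%N -> C <= C' -> P a N C -> P a N' C') ->
  (forall a, exists N, exists C, P a N C) ->
  exists N, exists C, forall a, (a <= A)%N -> P a N C.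
Proof.
move=> Pmono Pex; elim: A => [|A [N [C IH]]].
  by have [N [C h]] := Pex 0%N; exists N, C => a; rewrite leqn0 => /eqP ->.
have [N' [C' h]] := Pex A.+1.
exists (maxn N N'), (Num.max C C') => a; rewrite leq_eqVlt => /orP[/eqP->|aA].
- by apply: Pmono h; rewrite ?leq_maxr ?le_max ?lexx ?orbT.
- by apply: Pmono (IH a aA); rewrite ?leq_maxl ?le_max ?lexx.
Qed.

Lemma uniform_choice4 (P : nat -> nat -> nat -> nat -> nat -> R -> Prop) A :
  (forall a b m n N N' C C', (N <= N')%N -> C <= C' ->
     P a b m n N C -> P a b m n N' C') ->
  (forall a b m n, exists N, exists C, P a b m n N C) ->
  exists N, exists C, forall a b m n, (a <= A)%N -> (b <= A)%N -> (m <= A)%N ->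
    (n <= A)%N -> P a b m n N C.
Proof.
move=> Pmono Pex.
pose P3 a b m N C := forall n, (n <= A)%N -> P a b m n N C.
pose P2 a b N C := forall m, (m <= A)%N -> P3 a b m N C.
pose P1 a N C := forall b, (b <= A)%N -> P2 a b N C.
have M3 a b m N N' C C' : (N <= N')%N -> C <= C' -> P3 a b m N C -> P3 a b m N' C'.
  by move=> NN CC h n nA; exact: Pmono (h n nA).
have M2 a b N N' C C' : (N <= N')%N -> C <= C' -> P2 a b N C -> P2 a b N' C'.
  by move=> NN CC h m mA; exact: M3 (h m mA).
have M1 a N N' C C' : (N <= N')%N -> C <= C' -> P1 a N C -> P1 a N' C'.
  by move=> NN CC h b bA; exact: M2 (h b bA).
have [N [C h]] : exists N, exists C, forall a, (a <= A)%N -> P1 a N C.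
  apply: uniform_choice M1 _ => a.
  apply: uniform_choice => [b N N' C C'|b]; first exact: M2.
  apply: uniform_choice => [m N N' C C'|m]; first exact: M3.
  by apply: uniform_choice => [n N N' C C'|n]; [exact: Pmono|exact: Pex].
by exists N, C => a b m n aA bA mA nA; exact: h.
Qed.

Lemma schwartz_small phi N : Schwartz phi ->
  exists2 delta, 0 <= delta & small N phi delta.
Proof.
move=> sp.
have [_ [C h]] : exists N', exists C, forall a b m n, (a <= N)%N -> (b <= N)%N ->
    (m <= N)%N -> (n <= N)%N -> seminorm_le a b m n phi C.
  apply: (@uniform_choice4 (fun a b m n _ C => seminorm_le a b m n phi C)).
    by move=> a b m n _ _ C C' _ CC h z; exact: le_trans (h z) CC.
  move=> a b m n; have := sp; rewrite SchwartzE => -[_ /(_ a b m n)[C hC]].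
  by exists 0%N, C.
exists (Num.max 0 C); first by rewrite le_max lexx.
rewrite small.unlock => a b m n aN bN mN nN z.
by apply: (le_trans (h a b m n aN bN mN nN z)); rewrite le_max lexx orbT.
Qed.

(** Seminorms exist only through their upper bounds. Quantifying over every bound [delta] expresses
    that sup |K phi| is at most [C] times the largest seminorm of [phi] with indices up to [N]. *)
Definition op_bounded K : Prop := exists N, exists C, 0 <= C /\
  forall phi delta, Schwartz phi -> 0 <= delta -> small N phi delta ->
    forall z, cabs (K phi z) <= C * delta.

Definition op_continuous K : Prop :=
  (forall phi, Schwartz phi -> Schwartz (K phi)) /\
  forall N', exists N, exists C, 0 <= C /\
    forall phi delta, Schwartz phi -> 0 <= delta -> small N phi delta ->
      small N' (K phi) (C * delta).

Definition op_linear K : Prop := forall c phi psi, Schwartz phi -> Schwartz psi ->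
  K (c *: phi + psi) = c *: K phi + K psi.

Section Coinduction.
Variable P : (fn -> fn) -> Prop.
Hypothesis Pd : forall K phi j z, P K -> Schwartz phi -> pderivable (K phi) j z.
Hypothesis Pb : forall K, P K -> op_bounded K.
Hypothesis Pp : forall K j, P K -> exists2 L, P L &
  forall phi, Schwartz phi -> partial j (K phi) = L phi.
Hypothesis Pm : forall K j, P K -> exists2 L, P L &
  forall phi, Schwartz phi -> mulc j (K phi) = L phi.

Lemma op_iter (X : fn -> fn) K n :
  (forall K, P K -> exists2 L, P L & forall phi, Schwartz phi -> X (K phi) = L phi) ->
  P K -> exists2 L, P L & forall phi, Schwartz phi -> iter n X (K phi) = L phi.
Proof.
move=> hX PK; elim: n => [|n [L PL hL]]; first by exists K.
have [L' PL' hL'] := hX L PL; exists L' => // phi sp.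
by rewrite iterS hL // hL'.
Qed.

(** By [Pp] and [Pm], derivatives and coordinate multiples of [K phi] are again values [L phi] with
    [L] in the class. All seminorms of [K phi] are thus sup norms controlled by [Pb], and
    [uniform_choice4] makes finitely many such estimates uniform. *)
Lemma op_coind K : P K -> op_continuous K.
Proof.
move=> PK; split=> [phi sphi|N'].
  apply: (@schwartz_coind _ (fun f => exists2 K, P K & f = K phi)); last by exists K.
  - by move=> f j z [L PL ->]; exact: Pd.
  - move=> f [L /Pb[N [C [C0 hC]]] ->].
    have [d d0 hd] := schwartz_small N sphi.
    by exists (C * d) => z; exact: hC.
  - by move=> f j [L /(Pp j)[L' PL' hL'] ->]; exists L' => //; exact: hL'.
  - by move=> f j [L /(Pm j)[L' PL' hL'] ->]; exists L' => //; exact: hL'.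
pose B a b m n N C := forall phi delta,
  Schwartz phi -> 0 <= delta -> small N phi delta -> forall z,
  cabs (iter a (mulc ord0) (iter b (mulc ord_max) (partial2 m n (K phi))) z)
    <= C * delta.
have [||N [C h]] := @uniform_choice4 B N'; last first.
- exists N, (Num.max 0 C); split; first by rewrite le_max lexx.
  move=> phi d sphi d0 hd; apply/smallP => a b m n aN bN mN nN z.
  apply: (le_trans (h a b m n aN bN mN nN phi d sphi d0 hd z)).
  by rewrite ler_wpM2r // le_max lexx orbT.
- move=> a b m n.
  have [L1 P1 h1] := op_iter n (fun K => Pp ord_max (K := K)) PK.
  have [L2 P2 h2] := op_iter m (fun K => Pp ord0 (K := K)) P1.
  have [L3 P3 h3] := op_iter b (fun K => Pm ord_max (K := K)) P2.
  have [L4 /Pb[N [C [C0 hC]]] h4] := op_iter a (fun K => Pm ord0 (K := K)) P3.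
  exists N, C => phi d sphi d0 hd z.
  by rewrite /partial2 h1 // h2 // h3 // h4 //; exact: hC.
- move=> a b m n N1 N2 C1 C2 NN CC h phi d sphi d0 hd z.
  apply: (le_trans (h phi d sphi d0 _ z)); first exact: small_le hd.
  exact: ler_wpM2r.
Qed.

End Coinduction.

Lemma op_continuous_ext K L : (forall phi, Schwartz phi -> K phi = L phi) ->
  op_continuous K -> op_continuous L.
Proof.
move=> KL [K1 K2]; split=> [phi sp|N']; first by rewrite -KL //; exact: K1.
have [N [C [C0 h]]] := K2 N'; exists N, C; split => // phi d sp d0 hd.
by rewrite -KL //; exact: h.
Qed.

Lemma op_continuous_id : op_continuous id.
Proof.
by split=> // N; exists N, 1; split => // phi d _ _; rewrite mul1r.
Qed.

Lemma op_continuous_comp K L : op_continuous K -> op_continuous L ->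
  op_continuous (K \o L).
Proof.
move=> [K1 K2] [L1 L2]; split=> [phi sp|N']; first exact/K1/L1.
have [N [C [C0 h]]] := K2 N'; have [N1 [C1 [C10 h1]]] := L2 N.
exists N1, (C * C1); split; first exact: mulr_ge0.
move=> phi d sp d0 hd; rewrite -mulrA; apply: h; first exact: L1.
- exact: mulr_ge0.
- exact: h1.
Qed.

(** The class of all [K \o Y] with [Y] continuous is closed under derivatives and multiplications on
    the left, because the two intertwining relations push them to the right of [K]. One sup estimate
    for [K] remains. This serves the partial Fourier transform and the linear changes of
    variables. *)
Lemma op_continuous_intertwining K (Z W : 'I_2 -> fn -> fn) :
  (forall j, op_continuous (Z j)) -> (forall j, op_continuous (W j)) ->
  (forall j phi z, Schwartz phi -> has_pd j (K phi) z (K (Z j phi) z)) ->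
  (forall j phi, Schwartz phi -> mulc j (K phi) = K (W j phi)) ->
  op_bounded K -> op_continuous K.
Proof.
move=> cZ cW dK mK [N [C [C0 bK]]].
apply: (@op_coind (fun L => exists2 Y, op_continuous Y & L = K \o Y)) =>
  [L phi j z [Y [Y1 _] ->] sp|L [Y [Y1 Y2] ->]|L j [Y cY ->]|L j [Y cY ->]|].
- by have [] := has_pdP (dK j _ z (Y1 _ sp)).
- have [N1 [C1 [C10 h]]] := Y2 N; exists N1, (C * C1); split; first exact: mulr_ge0.
  move=> phi d sp d0 hd z; rewrite -mulrA.
  by apply: bK; [exact: Y1|exact: mulr_ge0|exact: h].
- exists (K \o (Z j \o Y)); first by exists (Z j \o Y) => //; exact: op_continuous_comp.
  by case: cY => Y1 _ phi sp; apply/funext => z; exact: partial_eq (dK _ _ _ (Y1 _ sp)).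
- exists (K \o (W j \o Y)); first by exists (W j \o Y) => //; exact: op_continuous_comp.
  by case: cY => Y1 _ phi sp; apply: mK; exact: Y1.
- by exists id => //; exact: op_continuous_id.
Qed.

Lemma op_linear_comp K L : op_linear K -> op_linear L ->
  (forall phi, Schwartz phi -> Schwartz (L phi)) -> op_linear (K \o L).
Proof. by move=> hK hL sL c phi psi sp ss; rewrite /= hL // hK //; exact: sL. Qed.

Lemma op_linear_scale K c phi : op_linear K -> Schwartz phi -> K (c *: phi) = c *: K phi.
Proof.
move=> lK sp; have K0 : K 0 = 0.
  have := lK (-1) 0 0 schwartz0 schwartz0.
  by rewrite scaler0 addr0 scaleN1r addrC subrr.
by have := lK c phi 0 sp schwartz0; rewrite addr0 K0 addr0.
Qed.

Lemma iter_mulc_lin j n c f g :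
  iter n (mulc j) (c *: f + g) = c *: iter n (mulc j) f + iter n (mulc j) g.
Proof.
apply/funext => z; rewrite iter_mulc /= !fctE !iter_mulc mulrDr.
by congr (_ + _); rewrite mulrCA.
Qed.

Lemma small_lin c N f g delta delta' : Smooth f -> Smooth g ->
  small N f delta -> small N g delta' -> small N (c *: f + g) (cabs c * delta + delta').
Proof.
move=> sf sg /smallP hf /smallP hg; apply/smallP => a b m n aN bN mN nN z.
rewrite partial2_lin // !iter_mulc_lin.
apply: (le_trans (cabsD _ _)); apply: lerD; last exact: hg.
by rewrite cabsM ler_wpM2l ?cabs_ge0 //; exact: hf.
Qed.

Lemma op_continuous_lin c K L : op_continuous K -> op_continuous L ->
  op_continuous (fun phi => c *: K phi + L phi).
Proof.
move=> [K1 K2] [L1 L2]; split=> [phi sp|N'].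
  by apply: schwartz_lin; [exact: K1|exact: L1].
have [N [C [C0 h]]] := K2 N'; have [N1 [C1 [C10 h1]]] := L2 N'.
exists (maxn N N1), (cabs c * C + C1); split.
  by rewrite addr_ge0 // mulr_ge0 // cabs_ge0.
move=> phi d sp d0 hd; rewrite mulrDl -mulrA.
apply: small_lin; [exact/schwartz_smooth/K1|exact/schwartz_smooth/L1| |].
- by apply: h => //; apply: small_le hd => //; exact: leq_maxl.
- by apply: h1 => //; apply: small_le hd => //; exact: leq_maxr.
Qed.

Lemma op_continuousZ c K : op_continuous K -> op_continuous (fun phi => c *: K phi).
Proof.
move=> hK; apply: (op_continuous_ext _ (op_continuous_lin (c - 1) hK hK)) => phi _.
by rewrite scalerBl scale1r subrK.
Qed.

Lemma schwartz_has_pd j z phi : Schwartz phi -> has_pd j phi z (partial j phi z).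
Proof. by move=> /schwartz_smooth; exact: smooth_has_pd. Qed.

Lemma op_continuous_partial j : op_continuous (partial j).
Proof.
have E m n phi : Schwartz phi ->
    partial2 m n (partial j phi) = partial2 (m + (j == ord0)) (n + (j == ord_max)) phi.
  by move=> /schwartz_smooth sp; have [->|->] := ord2P j;
    rewrite ?partial2_partial0 ?partial2_partial1 ?addn1 ?addn0.
split=> [phi sp|N].
  rewrite SchwartzE; split; first by rewrite -SmoothE; exact/smooth_partial/schwartz_smooth.
  move=> a b m n; have := sp; rewrite SchwartzE => -[_ H].
  by rewrite /seminorm_le -partial2E E // partial2E; exact: H.
exists N.+1, 1; split=> // phi d sp _ /smallP h; rewrite mul1r; apply/smallP => a b m n *.
by rewrite E //; apply: h; do [exact: leqW|rewrite -(addn1 N) leq_add // leq_b1].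
Qed.

Lemma partialD j f g : (forall z, pderivable f j z) -> (forall z, pderivable g j z) ->
  partial j (f + g) = partial j f + partial j g.
Proof.
move=> df dg; apply/funext => z; apply: partial_eq.
by apply: has_pdD; exact: pderivable_has_pd.
Qed.

Lemma slowly_increasing_smooth g : SlowlyIncreasing g -> Smooth g.
Proof. by rewrite SlowlyIncreasingE SmoothE => -[]. Qed.

Lemma slowly_increasing_poly_bounded g : SlowlyIncreasing g -> poly_bounded g.
Proof. by rewrite SlowlyIncreasingE => -[_ /(_ 0%N 0%N)]. Qed.

Lemma slowly_increasing_partial j g : SlowlyIncreasing g -> SlowlyIncreasing (partial j g).
Proof.
move=> sg; have sm := slowly_increasing_smooth sg.
have := sg; rewrite !SlowlyIncreasingE => -[_ h].
split; first by rewrite -SmoothE; exact: smooth_partial.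
move=> m n; rewrite -partial2E.
case: (ord2P j) => ->; rewrite ?partial2_partial0 ?partial2_partial1 // partial2E; exact: h.
Qed.

(** From 1 + |x| + |y| <= (1 + |x|)(1 + |y|) and (1 + |x|)^k <= 2^k (1 + |x|^k), the k-th power of
    the weight is at most 4^k times a product that expands into four monomials, each giving a
    seminorm; hence 4^(k+1). *)
Lemma small_weight k phi delta : small k phi delta ->
  forall z, weight z ^+ k * cabs (phi z) <= 4 ^+ k.+1 * delta.
Proof.
move=> /smallP h z.
have {}h a b : (a <= k)%N -> (b <= k)%N -> `|z.1| ^+ a * `|z.2| ^+ b * cabs (phi z) <= delta.
  by move=> ak bk; rewrite seminormE; exact: (h a b 0%N 0%N).
have one (x : R) : (1 + `|x|) ^+ k <= 2 ^+ k * (1 + `|x| ^+ k).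
  have [x1|x1] := leP `|x| 1.
    apply: (@le_trans _ _ (2 ^+ k)); last by rewrite ler_pMr ?exprn_gt0 // lerDl exprn_ge0.
    by apply: lerXn2r; rewrite ?nnegrE ?addr_ge0 //; lra.
  rewrite (@le_trans _ _ ((2 * `|x|) ^+ k)) //; last first.
    by rewrite exprMn ler_pM2l ?exprn_gt0 // lerDr.
  by apply: lerXn2r; rewrite ?nnegrE ?addr_ge0 ?mulr_ge0 //; lra.
have W : weight z ^+ k <= 4 ^+ k * ((1 + `|z.1| ^+ k) * (1 + `|z.2| ^+ k)).
  apply: (@le_trans _ _ ((1 + `|z.1|) ^+ k * (1 + `|z.2|) ^+ k)).
    rewrite -exprMn; apply: lerXn2r.
    - by rewrite nnegrE ltW // weight_gt0.
    - by rewrite nnegrE mulr_ge0 // addr_ge0.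
    - rewrite /weight mulrDr mulr1 mulrDl mul1r.
      by have := mulr_ge0 (normr_ge0 z.1) (normr_ge0 z.2); lra.
  apply: (le_trans (ler_pM _ _ (one z.1) (one z.2))); rewrite ?exprn_ge0 ?addr_ge0 //.
  have -> : 4 ^+ k = 2 ^+ k * 2 ^+ k :> R by rewrite -exprMn; congr (_ ^+ _); ring.
  by rewrite le_eqVlt; apply/orP; left; apply/eqP; ring.
apply: (le_trans (ler_wpM2r (cabs_ge0 _) W)).
rewrite exprSr -!mulrA ler_pM2l ?exprn_gt0 // mulrA.
have h00 := h 0%N 0%N (leq0n _) (leq0n _); have h0k := h 0%N k (leq0n _) (leqnn _).
have hk0 := h k 0%N (leqnn _) (leq0n _); have hkk := h k k (leqnn _) (leqnn _).
by rewrite !expr0 ?mul1r ?mulr1 in h00 h0k hk0; lra.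
Qed.

Definition mulop f phi : fn := fun z => f z * phi z.

(** The terms met when [f * phi] is derived repeatedly: the Leibniz rule distributes a derivative
    over the polynomial, [f] and [Y], and a coordinate factor is absorbed by the polynomial. *)
Inductive mul_class : (fn -> fn) -> Prop :=
| Mul_one p f Y : SlowlyIncreasing f -> op_continuous Y ->
    mul_class (fun phi z => eval2 p z * mulop f (Y phi) z)
| Mul_add K L : mul_class K -> mul_class L -> mul_class (fun phi => K phi + L phi).

Lemma mulop_has_pd j f phi z : SlowlyIncreasing f -> Schwartz phi ->
  has_pd j (mulop f phi) z (mulop (partial j f) phi z + mulop f (partial j phi) z).
Proof.
move=> sf sp; apply: has_pdM; last exact: schwartz_has_pd.
exact/smooth_has_pd/slowly_increasing_smooth.
Qed.

Lemma mul_class_pderivable K phi j z : mul_class K -> Schwartz phi ->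
  pderivable (K phi) j z.
Proof.
elim=> [p f Y sf [Y1 _]|K1 K2 _ IH1 _ IH2] sp.
  by have [] := has_pdP (has_pdM (eval2_has_pd j p z) (mulop_has_pd j z sf (Y1 _ sp))).
by have [] := has_pdP (has_pdD (pderivable_has_pd (IH1 sp)) (pderivable_has_pd (IH2 sp))).
Qed.

Lemma mul_class_continuous K : mul_class K -> op_continuous K.
Proof.
apply: op_coind => {K} [K phi j z|K|K j|K j].
- exact: mul_class_pderivable.
- elim=> [p f Y sf [Y1 Y2]|K1 K2 _ [N [C [C0 h]]] _ [N' [C' [C'0 h']]]].
    have [k [A hA]] := poly_boundedM (poly_bounded_eval2 p) (slowly_increasing_poly_bounded sf).
    have A0 := bound_ge0 hA.
    have [N [C [C0 h]]] := Y2 k.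
    exists N, (A * (4 ^+ k.+1 * C)); split; first by rewrite !mulr_ge0 // exprn_ge0.
    move=> phi d sp d0 hd z; rewrite /mulop mulrA cabsM.
    apply: (le_trans (ler_wpM2r (cabs_ge0 _) (hA z))).
    rewrite -!mulrA ler_wpM2l //; exact: small_weight (h _ _ sp d0 hd) z.
  exists (maxn N N'), (C + C'); split; first exact: addr_ge0.
  move=> phi d sp d0 hd z; rewrite mulrDl.
  apply: (le_trans (cabsD _ _)); apply: lerD.
    by apply: h => //; apply: small_le hd => //; exact: leq_maxl.
  by apply: h' => //; apply: small_le hd => //; exact: leq_maxr.
- elim=> [p f Y sf Yc|K1 K2 w1 [L1 v1 h1] w2 [L2 v2 h2]].
    exists (fun phi => (fun z => eval2 (mderiv j p) z * mulop f (Y phi) z) +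
      ((fun z => eval2 p z * mulop (partial j f) (Y phi) z) +
       (fun z => eval2 p z * mulop f ((partial j \o Y) phi) z))).
      do 2 (apply: Mul_add; first exact: Mul_one (slowly_increasing_partial j sf) Yc || exact: Mul_one).
      exact: Mul_one (op_continuous_comp (op_continuous_partial j) Yc).
    case: Yc => Y1 _ phi sp; apply/funext => z; rewrite !fctE -mulrDr; apply: partial_eq.
    exact: has_pdM (eval2_has_pd j p z) (mulop_has_pd j z sf (Y1 _ sp)).
  exists (fun phi => L1 phi + L2 phi); first exact: Mul_add.
  by move=> phi sp; rewrite partialD ?h1 ?h2 // => z; exact: mul_class_pderivable.
- elim=> [p f Y sf Yc|K1 K2 w1 [L1 v1 h1] w2 [L2 v2 h2]].
    exists (fun phi z => eval2 (mpolyX R[i] (mnm1 j) * p) z * mulop f (Y phi) z).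
      exact: Mul_one.
    by move=> phi _; apply/funext => z; rewrite eval2M eval2X -mulrA.
  exists (fun phi => L1 phi + L2 phi); first exact: Mul_add.
  move=> phi sp; rewrite -h1 // -h2 //; apply/funext => z; exact: mulrDr.
Qed.

Lemma op_continuous_mulop f : SlowlyIncreasing f -> op_continuous (mulop f).
Proof.
move=> sf; have := mul_class_continuous (Mul_one (mpolyC 2 1) sf op_continuous_id).
apply: op_continuous_ext => phi _; apply/funext => z.
by rewrite eval2C mul1r.
Qed.

Lemma mulop_lin f : op_linear (mulop f).
Proof.
move=> c phi psi _ _; apply/funext => z; rewrite /mulop !fctE.
by rewrite -![c *: _]/(c * _); ring.
Qed.

Lemma schwartz_mulop g phi : SlowlyIncreasing g -> Schwartz phi -> Schwartz (mulop g phi).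
Proof. by move=> /op_continuous_mulop[h _]; exact: h. Qed.

Lemma op_continuous_mulc j : op_continuous (mulc j).
Proof.
have := op_continuous_mulop (slowly_increasing_eval2 (mpolyX R[i] (mnm1 j))).
by apply: op_continuous_ext => phi _; rewrite eval2X.
Qed.

Lemma schwartz_mulc j phi : Schwartz phi -> Schwartz (mulc j phi).
Proof. by have [h _] := op_continuous_mulc j; exact: h. Qed.

Lemma schwartz_partial j phi : Schwartz phi -> Schwartz (partial j phi).
Proof. by have [h _] := op_continuous_partial j; exact: h. Qed.

Lemma tempered_comp (u : distr R) K : op_continuous K -> op_linear K ->
  tempered u -> tempered (fun phi => u (K phi)).
Proof.
move=> [K1 K2] linK [ulin ucont]; split.
  move=> c phi psi; rewrite -!SchwartzE => sp ss.
  by rewrite linK // ulin // -SchwartzE; exact: K1.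
move=> phi; rewrite -SchwartzE => sp e e0.
have := K1 _ sp; rewrite SchwartzE => /ucont /(_ e e0)[N [d d0 h]].
have [N1 [C [C0 hC]]] := K2 N.
have C1 : 0 < C + 1 by rewrite ltr_wpDl.
(* C + 1 is used as divisor because C may vanish. *)
exists N1, (d / (C + 1)); first exact: divr_gt0.
move=> psi; rewrite -SchwartzE => ss hs; apply: h.
  by rewrite -SchwartzE; exact: K1.
have sm : small N1 (psi - phi) (d / (C + 1)) by rewrite small.unlock.
have := hC _ _ (schwartzB ss sp) (ltW (divr_gt0 d0 C1)) sm.
have -> : K (psi - phi) = K psi - K phi.
  by rewrite addrC -scaleN1r linK // scaleN1r addrC.
move=> {}sm; have : small N (K psi - K phi) d.
  apply: small_le sm => //; rewrite mulrA ler_pdivrMr // mulrC.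
  by rewrite ler_wpM2l ?lerDl // ltW.
by rewrite small.unlock.
Qed.

Lemma op_linear_mulc j : op_linear (mulc j).
Proof. by move=> c phi psi _ _; exact: (iter_mulc_lin j 1). Qed.

Lemma op_linear_partial j : op_linear (partial j).
Proof. by move=> c phi psi sp ss; apply: partial_lin; exact: schwartz_smooth. Qed.

End ContinuousOperators.

(** * Integrals *)

Lemma is_cderive_unique (R : realType) (h : R -> R[i]) t d e :
  is_cderive h t d -> is_cderive h t e -> d = e.
Proof.
move=> [d1 d2] [e1 e2]; apply: complexP.
- by rewrite -(@derive_val _ _ _ _ _ _ _ d1) (@derive_val _ _ _ _ _ _ _ e1).
- by rewrite -(@derive_val _ _ _ _ _ _ _ d2) (@derive_val _ _ _ _ _ _ _ e2).
Qed.

Section ComplexContinuity.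
Context {R : realType} {T : topologicalType}.
Implicit Types (f g : T -> R[i]).

Definition ccontinuous f : Prop :=
  continuous (fun z => complex.Re (f z)) /\ continuous (fun z => complex.Im (f z)).

Lemma ccontinuous_cst (c : R[i]) : ccontinuous (fun=> c).
Proof. by split=> z; exact: cvg_cst. Qed.

Lemma ccontinuousD f g : ccontinuous f -> ccontinuous g ->
  ccontinuous (fun z => f z + g z).
Proof.
move=> [f1 f2] [g1 g2]; split=> z.
- by under eq_fun do rewrite ReD; apply: cvgD; [exact: f1|exact: g1].
- by under eq_fun do rewrite ImD; apply: cvgD; [exact: f2|exact: g2].
Qed.

Lemma ccontinuousM f g : ccontinuous f -> ccontinuous g ->
  ccontinuous (fun z => f z * g z).
Proof.
move=> [f1 f2] [g1 g2]; split=> z.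
- under eq_fun do rewrite ReM.
  by apply: cvgB; apply: cvgM; [exact: f1|exact: g1|exact: f2|exact: g2].
- under eq_fun do rewrite ImM.
  by apply: cvgD; apply: cvgM; [exact: f1|exact: g2|exact: f2|exact: g1].
Qed.

Lemma ccontinuous_real (r : T -> R) : continuous r -> ccontinuous (fun z => (r z)%:C).
Proof. by move=> cr; split=> z /=; [exact: cr|exact: cvg_cst]. Qed.

Lemma ccontinuous_expi (r : T -> R) : continuous r ->
  ccontinuous (fun z => expi (r z)).
Proof.
move=> cr; split=> z /=.
- by apply: (cvg_comp r cos); [exact: cr|exact: continuous_cos].
- by apply: (cvg_comp r sin); [exact: cr|exact: continuous_sin].
Qed.

End ComplexContinuity.

Lemma ccontinuous_comp (R : realType) (T U : topologicalType) (f : U -> R[i])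
  (h : T -> U) : continuous h -> ccontinuous f -> ccontinuous (f \o h).
Proof.
move=> ch [f1 f2]; split=> z.
- by apply: (cvg_comp h (fun z => complex.Re (f z))); [exact: ch|exact: f1].
- by apply: (cvg_comp h (fun z => complex.Im (f z))); [exact: ch|exact: f2].
Qed.

Section ComplexIntegral.
Context {R : realType} d {T : measurableType d} (mu : {measure set T -> \bar R}).
Implicit Types (g h : T -> R[i]).

Definition cintegrable g : Prop :=
  mu.-integrable setT (EFin \o (fun x => complex.Re (g x))) /\
  mu.-integrable setT (EFin \o (fun x => complex.Im (g x))).

Lemma eq_cintegral g h : (forall x, g x = h x) -> cintegral mu g = cintegral mu h.
Proof. by move=> /funext ->. Qed.

Lemma cintegralD g h : cintegrable g -> cintegrable h ->
  cintegral mu (fun x => g x + h x) = cintegral mu g + cintegral mu h.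
Proof.
move=> [g1 g2] [h1 h2]; apply: complexP; rewrite ?ReD ?ImD /cintegral /=.
- by under eq_Rintegral do rewrite ReD; exact: RintegralD.
- by under eq_Rintegral do rewrite ImD; exact: RintegralD.
Qed.

Lemma cintegralZ (c : R[i]) g : cintegrable g ->
  cintegral mu (fun x => c * g x) = c * cintegral mu g.
Proof.
move=> [g1 g2].
have Z r (f : T -> R) : mu.-integrable setT (EFin \o f) ->
    mu.-integrable setT (EFin \o (fun x => r * f x)).
  by move=> h; apply: (integrableZl _ r h).
apply: complexP; rewrite ?ReM ?ImM /cintegral /=.
- under eq_Rintegral do rewrite ReM.
  rewrite RintegralB //; [|exact: Z|exact: Z].
  by rewrite !RintegralZl.
- under eq_Rintegral do rewrite ImM.
  rewrite RintegralD //; [|exact: Z|exact: Z].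
  by rewrite !RintegralZl.
Qed.

(* The factor 2 (instead of 1) allows a proof by real and imaginary parts. *)
Lemma cabs_cintegral_le g (h : T -> R) : cintegrable g ->
  mu.-integrable setT (EFin \o h) -> (forall x, cabs (g x) <= h x) ->
  cabs (cintegral mu g) <= 2 * Rintegral mu setT h.
Proof.
move=> [g1 g2] hi gh.
apply: (le_trans (cabs_le_ReIm _)); rewrite /cintegral /= mulr2n mulrDl mul1r.
have N (f : T -> R) : mu.-integrable setT (EFin \o f) -> (forall x, `|f x| <= h x) ->
    `|Rintegral mu setT f| <= Rintegral mu setT h.
  move=> fi fh; apply: (le_trans (le_normr_Rintegral _ fi)) => //.
  apply: le_Rintegral => //.
  exact: (integrable_norm fi).
by apply: lerD; apply: N => // x; apply: le_trans (gh x);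
  [exact: Re_le_cabs|exact: Im_le_cabs].
Qed.

Lemma le_cintegrable g (h : T -> R) :
  measurable_fun setT (fun x => complex.Re (g x)) ->
  measurable_fun setT (fun x => complex.Im (g x)) ->
  mu.-integrable setT (EFin \o h) -> (forall x, cabs (g x) <= h x) ->
  cintegrable g.
Proof.
move=> m1 m2 hi gh.
have A (f : T -> R) : measurable_fun setT f -> (forall x, `|f x| <= h x) ->
    mu.-integrable setT (EFin \o f).
  move=> mf fh; apply: (le_integrable _ _ _ hi) => //.
    exact/measurable_EFinP.
  by move=> x _ /=; rewrite lee_fin (le_trans (fh x)) // ler_norm.
by split; apply: A => // x; apply: le_trans (gh x);
  [exact: Re_le_cabs|exact: Im_le_cabs].
Qed.

End ComplexIntegral.

(** * Borel measurability on the product of two lines *)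

Section MeasurablePlane.
Context {R : realType}.

(** Measurability refers to the product sigma-algebra; an open set is the countable union of the
    squares with rational centre and side data that it contains. *)
Lemma open_measurable_plane (U : set (R * R)) : open U -> measurable U.
Proof.
move=> oU.
pose B (k : rat * rat * nat) : set (R * R) :=
  ball (ratr k.1.1 : R) (k.2.+1%:R^-1) `*` ball (ratr k.1.2 : R) (k.2.+1%:R^-1).
have mB k : measurable (B k).
  by apply: measurableX; apply: open_measurable; exact: ball_open.
(* [F k] is the square [B k] when it lies in [U] and is empty otherwise, so the union can run over
   all indices. *)
pose F k := [set z | B k z /\ B k `<=` U].
have -> : U = \bigcup_k F k.
  apply/seteqP; split => [[x y] Uxy|z [k _ [Bz]]] /=; last exact.
  have /nbhs_ballP[e /= e0 eU] : nbhs (x, y) U by exact: open_nbhs_nbhs.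
  have [n n0 ne] : exists2 n, (0 < n)%N & n%:R^-1 < e / 2 :> R.
    have [n _ /(_ n (leqnn n)) h] := near_infty_natSinv_lt (PosNum (divr_gt0 e0 (ltr0Sn R 1))).
    by exists n.+1.
  case: n n0 ne => // n _ ne.
  have dense (a : R) : exists q : rat, `|ratr q - a| < n.+1%:R^-1.
    have h : a - n.+1%:R^-1 < a + n.+1%:R^-1.
      by rewrite ltrD2l (@lt_trans _ _ 0) // ?oppr_lt0 invr_gt0.
    have [q] := rat_in_itvoo h.
    by rewrite in_itv /= => qa; exists q; rewrite ltr_distl.
  have [p hp] := dense x; have [q hq] := dense y.
  exists (p, q, n) => //; split; first by split; rewrite /= /ball /=.
  have e2 : n.+1%:R^-1 + n.+1%:R^-1 < e by rewrite [ltRHS]splitr ltrD.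
  move=> [x' y'] [/= h1 h2]; apply: eU; split => /=; rewrite /ball /=;
    apply: lt_trans e2.
  - rewrite -(subrKA (ratr p)) (le_lt_trans (ler_normD _ _)) // distrC.
    by rewrite ltrD.
  - rewrite -(subrKA (ratr q)) (le_lt_trans (ler_normD _ _)) // distrC.
    by rewrite ltrD.
apply: countable_bigcupT_measurable => [|k]; first exact: countableP.
have [BU|BU] := pselect (B k `<=` U).
- by rewrite (_ : F k = B k) //; apply/seteqP; split => z /=; [case|].
- by rewrite (_ : F k = set0) //; apply/seteqP; split => z /= [].
Qed.

Lemma continuous_measurable_plane (f : R * R -> R) : continuous f ->
  measurable_fun setT f.
Proof.
move=> cf; apply: (measurability _ (RGenOInfty.measurableE R)) => A -[_ [x ->] <-].
rewrite setTI; apply: open_measurable_plane.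
by have /continuousP h := cf; apply: h; exact: interval_open.
Qed.

End MeasurablePlane.

(** * Integrals of functions dominated by 1/(1 + t^2) *)

Section Decay.
Context {R : realType}.
Implicit Types (g h : R -> R[i]) (f : R * R -> R[i]).
Local Notation mu := (@lebesgue_measure R).

Definition bump (t : R) : R := (oneDsqr t)^-1.

Lemma bump_gt0 t : 0 < bump t.
Proof. by rewrite invr_gt0 (lt_le_trans ltr01) // oneDsqr_ge1. Qed.

Lemma continuous_bump : continuous bump.
Proof. exact: continuous_oneDsqrV. Qed.

Lemma integrable_bump : mu.-integrable setT (EFin \o bump).
Proof.
apply/integrableP; split.
  apply: measurableT_comp => //; apply: continuous_measurable_fun.
  exact: continuous_bump.
under eq_integral => x _ do rewrite /= ger0_norm ?ltW ?bump_gt0 //.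
rewrite ge0_symfun_integralT; last 3 first.
- by move=> x; rewrite ltW ?bump_gt0.
- exact: continuous_bump.
- by move=> x; rewrite /bump /oneDsqr /= sqrrN.
rewrite -set_itvcy integral0y_oneDsqr.
by rewrite lte_mul_pinfty ?ltry.
Qed.

(** A concrete form of integrability that survives translations and bounded continuous factors. *)
Definition decay1 g : Prop :=
  ccontinuous g /\ exists C, forall t, cabs (g t) <= C * bump t.

(** The product majorant is integrable on the plane and puts every slice in [decay1]; Fubini for
    real valued integrals needs the inner integrals to be finite at every point. *)
Definition decay2 f : Prop :=
  ccontinuous f /\ exists C, forall z, cabs (f z) <= C * (bump z.1 * bump z.2).

Lemma decay1_bound_ge0 g C : (forall t, cabs (g t) <= C * bump t) -> 0 <= C.
Proof. by move=> /(_ 0) /(le_trans (cabs_ge0 _)); rewrite pmulr_lge0 // bump_gt0. Qed.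

Lemma decay2_bound_ge0 f C : (forall z, cabs (f z) <= C * (bump z.1 * bump z.2)) -> 0 <= C.
Proof.
by move=> /(_ 0) /(le_trans (cabs_ge0 _)); rewrite pmulr_lge0 // mulr_gt0 ?bump_gt0.
Qed.

Lemma decay1_integrable g : decay1 g -> cintegrable mu g.
Proof.
move=> [[c1 c2] [C hC]]; apply: (@le_cintegrable R _ _ mu g (fun t => C * bump t)) => //.
- exact: continuous_measurable_fun.
- exact: continuous_measurable_fun.
- exact: (integrableZl _ C integrable_bump).
Qed.

Lemma integrable_bump2 : (mu \x mu)%E.-integrable setT
  (EFin \o (fun z : R * R => bump z.1 * bump z.2)).
Proof.
have m2 : measurable_fun setT (fun z : R * R => bump z.1 * bump z.2).
  apply: continuous_measurable_plane => z; apply: cvgM.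
    by apply: (cvg_comp fst bump); [exact: cvg_fst|exact: continuous_bump].
  by apply: (cvg_comp snd bump); [exact: cvg_snd|exact: continuous_bump].
apply/integrable12ltyP; first exact/measurable_EFinP.
under eq_integral => x _.
  under eq_integral => y _ do
    rewrite /= ger0_norm ?mulr_ge0 ?ltW ?bump_gt0 // EFinM.
  rewrite integralZl //; last exact: integrable_bump.
  over.
rewrite /=; set I := (\int[_]_(_ in _) (bump _)%:E)%E.
have fI : I \is a fin_num.
  by apply: integrable_fin_num => //; exact: integrable_bump.
rewrite -(fineK fI) -/I integralZr //; last exact: integrable_bump.
by rewrite -/I -(fineK fI) -EFinM ltry.
Qed.

Lemma decay2_integrable f : decay2 f -> cintegrable (mu \x mu)%E f.
Proof.
move=> [[c1 c2] [C hC]].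
apply: (@le_cintegrable R _ _ (mu \x mu)%E f
  (fun z => C * (bump z.1 * bump z.2))) => //.
- exact: continuous_measurable_plane.
- exact: continuous_measurable_plane.
- exact: (integrableZl _ C integrable_bump2).
Qed.

Definition bump_mass : R := Rintegral mu setT bump.

Lemma bump_mass_ge0 : 0 <= bump_mass.
Proof. by apply: Rintegral_ge0 => x _; rewrite ltW ?bump_gt0. Qed.

Lemma cabs_integral1_le g C : decay1 g -> (forall t, cabs (g t) <= C * bump t) ->
  cabs (integral1 g) <= 2 * bump_mass * C.
Proof.
move=> dg hC.
apply: (le_trans (cabs_cintegral_le (decay1_integrable dg) _ hC)).
  exact: (integrableZl _ C integrable_bump).
by rewrite RintegralZl // -?mulrA ?[C * _]mulrC //; exact: integrable_bump.
Qed.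

Lemma integral1D g h : decay1 g -> decay1 h ->
  integral1 (fun t => g t + h t) = integral1 g + integral1 h.
Proof. by move=> dg dh; apply: cintegralD; exact: decay1_integrable. Qed.

Lemma integral1Z (c : R[i]) g : decay1 g -> integral1 (fun t => c * g t) = c * integral1 g.
Proof. by move=> dg; apply: cintegralZ; exact: decay1_integrable. Qed.

Lemma decay1M g h (K : R) : decay1 g -> ccontinuous h -> (forall t, cabs (h t) <= K) ->
  decay1 (fun t => h t * g t).
Proof.
move=> [cg [C hC]] ch hK; split; first exact: ccontinuousM.
exists (K * C) => t; rewrite cabsM -mulrA.
by apply: ler_pM; rewrite ?cabs_ge0.
Qed.

Lemma decay1Z (c : R[i]) g : decay1 g -> decay1 (fun t => c * g t).
Proof. by move=> dg; apply: (decay1M dg (ccontinuous_cst c) (K := cabs c)). Qed.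

Lemma decay1D g h : decay1 g -> decay1 h -> decay1 (fun t => g t + h t).
Proof.
move=> [cg [C hC]] [ch [D hD]]; split; first exact: ccontinuousD.
exists (C + D) => t; rewrite mulrDl; apply: (le_trans (cabsD _ _)).
by apply: lerD.
Qed.

Lemma decay2M f (h : R * R -> R[i]) (K : R) : decay2 f -> ccontinuous h -> (forall t, cabs (h t) <= K) ->
  decay2 (fun t => h t * f t).
Proof.
move=> [cg [C hC]] ch hK; split; first exact: ccontinuousM.
exists (K * C) => t; rewrite cabsM -mulrA.
by apply: ler_pM; rewrite ?cabs_ge0.
Qed.

Lemma continuous_pair1 (x : R) : continuous (fun y : R => (x, y)).
Proof. by move=> y; exact: (cvg_pair (cvg_cst x) cvg_id). Qed.

Lemma continuous_pair2 (y : R) : continuous (fun x : R => (x, y)).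
Proof. by move=> x; exact: (cvg_pair cvg_id (cvg_cst y)). Qed.

Lemma decay2_slice1 f x : decay2 f -> decay1 (fun y => f (x, y)).
Proof.
move=> [cf [C hC]]; split; first exact: (ccontinuous_comp (@continuous_pair1 x) cf).
by exists (C * bump x) => t; rewrite -mulrA; exact: hC.
Qed.

Lemma decay2_slice2 f y : decay2 f -> decay1 (fun x => f (x, y)).
Proof.
move=> [cf [C hC]]; split; first exact: (ccontinuous_comp (@continuous_pair2 y) cf).
by exists (C * bump y) => t; rewrite -mulrA [bump y * _]mulrC; exact: hC.
Qed.

Lemma Rintegral_fubini (r : R * R -> R) :
  (mu \x mu)%E.-integrable setT (EFin \o r) ->
  (forall x, mu.-integrable setT (EFin \o (fun y => r (x, y)))) ->
  (forall y, mu.-integrable setT (EFin \o (fun x => r (x, y)))) ->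
  Rintegral (mu \x mu)%E setT r = Rintegral mu setT (fun x => Rintegral mu setT (fun y => r (x, y)))
  /\ Rintegral (mu \x mu)%E setT r = Rintegral mu setT (fun y => Rintegral mu setT (fun x => r (x, y))).
Proof.
move=> ir i1 i2; rewrite /Rintegral; split.
- rewrite -(integral12_prod_meas1 ir); congr fine; apply: eq_integral => x _.
  by rewrite fineK //; apply: integrable_fin_num => //; exact: i1.
- rewrite -(integral21_prod_meas1 ir); congr fine; apply: eq_integral => y _.
  by rewrite fineK //; apply: integrable_fin_num => //; exact: i2.
Qed.

Lemma fubini_decay f : decay2 f ->
  integral2 f = integral1 (fun x => integral1 (fun y => f (x, y))) /\
  integral2 f = integral1 (fun y => integral1 (fun x => f (x, y))).
Proof.
move=> df; have [i1 i2] := decay2_integrable df.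
have s1 x := decay1_integrable (decay2_slice1 x df).
have s2 x := decay1_integrable (decay2_slice2 x df).
have [a1 a2] := Rintegral_fubini i1 (fun x => (s1 x).1) (fun y => (s2 y).1).
have [b1 b2] := Rintegral_fubini i2 (fun x => (s1 x).2) (fun y => (s2 y).2).
by split; apply: complexP; [exact: a1|exact: b1|exact: a2|exact: b2].
Qed.

Lemma ge0_integral_translation (r : R -> R) (s : R) : continuous r ->
  (forall t, 0 <= r t) ->
  (\int[mu]_t (r (t + s))%:E = \int[mu]_t (r t)%:E)%E.
Proof.
move=> cr r0.
have dF (x : R) : is_derive x (1 : R) (fun t : R => t + s) 1.
  by apply: is_derive_eq; rewrite addr0.
have F' : (fun t : R => t + s)^`() = cst 1.
  by apply/funext => x; rewrite derive1E derive_val.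
rewrite (@increasing_ge0_integration_by_substitutionT R (fun t => t + s) r) //.
- by apply: eq_integral => t _; rewrite F' fctE /= mulr1.
- by move=> x y xy; rewrite ltrD2r.
- by rewrite F' => x; exact: cvg_cst.
- by rewrite F'; exact: is_cvg_cst.
- by rewrite F'; exact: is_cvg_cst.
- exact: cvg_addrr_Ny.
- exact: cvg_addrr.
Qed.

(** Substitution is available for nonnegative integrands, hence the split into positive and negative
    parts, both continuous. *)
Lemma Rintegral_translation (r : R -> R) (s : R) : continuous r ->
  Rintegral mu setT (fun t => r (t + s)) = Rintegral mu setT r.
Proof.
move=> cr; rewrite /Rintegral; congr fine; rewrite [LHS]integralE [RHS]integralE.
have cp : continuous (fun t => Num.max (r t) 0).
  by apply: max_fun_continuous => // t; exact: cvg_cst.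
have cn : continuous (fun t => Num.max (- r t) 0).
  apply: max_fun_continuous => t; last exact: cvg_cst.
  by apply: cvgN; exact: cr.
have P (p : R -> R) :
    (\int[mu]_t (fun t => (p t)%:E)^\+ t = \int[mu]_t (Num.max (p t) 0)%:E)%E.
  by apply: eq_integral => t _; rewrite funeposE -EFin_max.
have N (p : R -> R) :
    (\int[mu]_t (fun t => (p t)%:E)^\- t = \int[mu]_t (Num.max (- p t) 0)%:E)%E.
  by apply: eq_integral => t _; rewrite funenegE -EFinN -EFin_max.
congr (_ - _)%E.
- rewrite [LHS](P (fun t => r (t + s))) [RHS](P r).
  by rewrite (ge0_integral_translation s cp) // => t; rewrite le_max lexx orbT.
- rewrite [LHS](N (fun t => r (t + s))) [RHS](N r).
  by rewrite (ge0_integral_translation s cn) // => t; rewrite le_max lexx orbT.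
Qed.

Lemma integral1_translation g (s : R) : ccontinuous g ->
  integral1 (fun t => g (t + s)) = integral1 g.
Proof.
move=> [c1 c2]; apply: complexP => /=.
- exact: (Rintegral_translation s c1).
- exact: (Rintegral_translation s c2).
Qed.

Lemma cderive_integral (f f1 : R -> R -> R[i]) (a C : R) :
  (forall s t, is_cderive (fun s => f s t) s (f1 s t)) ->
  (forall s, decay1 (f s)) ->
  (forall s t, `|s - a| < 1 -> cabs (f1 s t) <= C * bump t) ->
  is_cderive (fun s => integral1 (f s)) a (integral1 (f1 a)).
Proof.
move=> df ff hC.
have C0 : 0 <= C.
  have := hC a 0; rewrite subrr normr0 ltr01 => /(_ isT) /(le_trans (cabs_ge0 _)).
  by rewrite pmulr_lge0 // bump_gt0.
have aI : `]a - 1, a + 1[%classic a by rewrite /= in_itv /= ltrBlDr ltrDl ltr01.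
have I s : `]a - 1, a + 1[%classic s -> `|s - a| < 1.
  by rewrite /= in_itv /= => h; rewrite ltr_distl.
have intG : mu.-integrable setT (EFin \o (fun t => C * bump t)).
  exact: (integrableZl _ C integrable_bump).
have G0 t : 0 <= C * bump t by rewrite mulr_ge0 // ltW ?bump_gt0.
have key (p : R -> R -> R) (p1 : R -> R -> R) :
    (forall s t, is_derive s (1 : R) (fun s => p s t) (p1 s t)) ->
    (forall s, mu.-integrable setT (EFin \o p s)) ->
    (forall s t, `|s - a| < 1 -> `|p1 s t| <= C * bump t) ->
    is_derive a (1 : R) (fun s => Rintegral mu setT (p s)) (Rintegral mu setT (p1 a)).
  move=> dp ip bp.
  have E s t : partial1of2 p s t = p1 s t.
    by rewrite /partial1of2 derive1E; have := dp s t => ?; rewrite derive_val.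
  have der s t : `]a - 1, a + 1[%classic s -> setT t -> derivable (p ^~ t) s 1.
    by move=> _ _; have := dp s t => ?; exact: ex_derive.
  have ub s t : `]a - 1, a + 1[%classic s -> setT t ->
      `|partial1of2 p s t| <= C * bump t.
    by move=> /I sa _; rewrite E; exact: bp.
  apply: DeriveDef.
    exact: (derivable_under_integral measurableT aI (fun s _ => ip s) der G0 intG ub).
  rewrite -derive1E.
  rewrite (differentiation_under_integral measurableT aI (fun s _ => ip s) der G0 intG ub).
  by apply: eq_Rintegral => t _; rewrite E.
have ii s := decay1_integrable (ff s).
split => /=.
- apply: (key (fun s t => complex.Re (f s t)) (fun s t => complex.Re (f1 s t))).
  + by move=> s t; case: (df s t).
  + by move=> s; case: (ii s).
  + by move=> s t /(hC s t); apply: le_trans; exact: Re_le_cabs.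
- apply: (key (fun s t => complex.Im (f s t)) (fun s t => complex.Im (f1 s t))).
  + by move=> s t; case: (df s t).
  + by move=> s; case: (ii s).
  + by move=> s t /(hC s t); apply: le_trans; exact: Im_le_cabs.
Qed.

(** Peetre's inequality. After clearing denominators the difference of the two sides is 1 + (t +
    2s)^2 + 2 s^2 (t + s)^2. *)
Lemma bump_shift (s t : R) : bump (t + s) <= 2 * (1 + s ^+ 2) * bump t.
Proof.
rewrite /bump ler_pdivlMr ?(lt_le_trans ltr01 (oneDsqr_ge1 _)) //.
rewrite mulrC ler_pdivrMr ?(lt_le_trans ltr01 (oneDsqr_ge1 _)) // /oneDsqr.
have := mulr_ge0 (sqr_ge0 s) (sqr_ge0 (t + s)).
by have := sqr_ge0 (t + 2 * s); nra.
Qed.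

Lemma decay1_shift g s : decay1 g -> decay1 (fun t => g (t + s)).
Proof.
move=> [cg [D hD]]; have shift : continuous (fun t : R => t + s).
  by move=> t; apply: cvgD; [exact: cvg_id|exact: cvg_cst].
split; first exact: (ccontinuous_comp shift cg).
have D0 := decay1_bound_ge0 hD.
exists (D * (2 * (1 + s ^+ 2))) => t; apply: (le_trans (hD _)).
by rewrite -mulrA ler_wpM2l // bump_shift.
Qed.

(* The integral of [g (. + s)] does not depend on [s]. *)
Lemma integral1_derive (g g' : R -> R[i]) : (forall t, is_cderive g t (g' t)) ->
  decay1 g -> decay1 g' -> integral1 g' = 0.
Proof.
move=> gd dg dg'; have [_ [C hC]] := dg'.
have C0 := decay1_bound_ge0 hC.
have dgs s t : is_cderive (fun s => g (t + s)) s (g' (t + s)).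
  apply: is_cderive_eq.
    apply: (@is_cderive_comp _ g (fun s => t + s) s (g' (t + s)) 1) => //.
    by have := is_deriveD (is_derive_cst t s 1) (is_derive_id s 1); rewrite add0r.
  by rewrite mul1r.
(* For |s| < 1 the factor 2 (1 + s^2) of [bump_shift] is at most 4. *)
have bd s t : `|s - 0| < 1 -> cabs (g' (t + s)) <= C * 4 * bump t.
  rewrite subr0 => s1; apply: (le_trans (hC _)); rewrite -mulrA ler_wpM2l //.
  apply: (le_trans (bump_shift _ _)); rewrite ler_wpM2r ?(ltW (bump_gt0 _)) //.
  have : s ^+ 2 <= 1 by rewrite -[s ^+ 2]real_normK ?num_real // expr_le1 // ltW.
  by move=> s2; lra.
have := cderive_integral dgs (fun s => decay1_shift s dg) bd.
have -> : (fun s => integral1 (fun t => g (t + s))) = fun=> integral1 g.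
  by apply/funext => s; apply: integral1_translation; case: dg.
have -> : (fun t => g' (t + 0)) = g' by apply/funext => t; rewrite addr0.
by move=> h; exact: is_cderive_unique h (is_cderive_cst _ _).
Qed.

End Decay.

(** * Partial Fourier transform *)

HB.lock Definition pfourier (R : realType) (f : R * R -> R[i]) : R * R -> R[i] :=
  fourier_snd f.
Arguments pfourier {R}.

Section PartialFourier.
Context {R : realType}.
Implicit Types (f g phi psi : R * R -> R[i]) (z : R * R) (j : 'I_2) (c : R[i])
  (x y s t : R).

Lemma pfourierE f x y :
  pfourier f (x, y) = integral1 (fun t => expi (- (t * y)) * f (x, t)).
Proof. by rewrite pfourier.unlock. Qed.

Lemma bump_le1 t : bump t <= 1.
Proof. exact: oneDsqrV_le1. Qed.

(** (1 + x^2)(1 + y^2) |phi| expands into four weighted terms, each at most [delta]. *)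
Lemma small_decay N phi delta : (2 <= N)%N -> small N phi delta ->
  forall z, cabs (phi z) <= 4 * delta * (bump z.1 * bump z.2).
Proof.
move=> N2 /smallP h z.
have {}h a b : (a <= 2)%N -> (b <= 2)%N -> `|z.1| ^+ a * `|z.2| ^+ b * cabs (phi z) <= delta.
  move=> a2 b2; rewrite seminormE; apply: (h a b 0%N 0%N) => //; exact: leq_trans N2.
have h00 := h 0%N 0%N erefl erefl; have h02 := h 0%N 2%N erefl erefl.
have h20 := h 2%N 0%N erefl erefl; have h22 := h 2%N 2%N erefl erefl.
rewrite /bump -invfM ler_pdivlMr; last first.
  by rewrite mulr_gt0 // (lt_le_trans ltr01) // oneDsqr_ge1.
rewrite !real_normK ?num_real // !expr0 ?mul1r ?mulr1 in h00 h02 h20 h22.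
by rewrite /oneDsqr; lra.
Qed.

Lemma schwartz_ccontinuous phi : Schwartz phi -> ccontinuous phi.
Proof. by move=> /schwartz_smooth /smooth_continuous. Qed.

Lemma schwartz_decay phi : Schwartz phi -> decay2 phi.
Proof.
move=> sp; split; first exact: schwartz_ccontinuous.
have [d d0 hd] := schwartz_small 2 sp.
by exists (4 * d); exact: small_decay hd.
Qed.

Lemma continuousMr y : continuous (fun t => - (t * y)).
Proof. by move=> t; apply: cvgN; apply: cvgM; [exact: cvg_id|exact: cvg_cst]. Qed.

Lemma pfourier_decay phi x y : decay2 phi ->
  decay1 (fun t => expi (- (t * y)) * phi (x, t)).
Proof.
move=> sp; apply: (decay1M (K := 1)); first exact: decay2_slice1.
- exact/ccontinuous_expi/continuousMr.
- by move=> t; rewrite cabs_expi.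
Qed.

Lemma pfourier_lin : op_linear (@pfourier R).
Proof.
move=> c phi psi sp ss; apply/funext => -[x y]; rewrite !fctE !pfourierE.
have dp := pfourier_decay x y (schwartz_decay sp).
have ds := pfourier_decay x y (schwartz_decay ss).
rewrite -[c *: _]/(c * _) -(integral1Z c dp) -(integral1D (decay1Z c dp) ds).
by apply: eq_cintegral => t; rewrite -[c *: _]/(c * _); ring.
Qed.

Lemma cabs_pfourier_le phi C z : decay2 phi ->
  (forall z, cabs (phi z) <= C * (bump z.1 * bump z.2)) ->
  cabs (pfourier phi z) <= 2 * bump_mass * C.
Proof.
case: z => x y dp hC; rewrite pfourierE.
have C0 := decay2_bound_ge0 hC.
apply: cabs_integral1_le; first exact: pfourier_decay.
move=> t; rewrite cabsM cabs_expi mul1r (le_trans (hC _)) // ler_wpM2l //.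
by rewrite ler_piMl ?bump_le1 ?(ltW (bump_gt0 _)).
Qed.

Lemma pfourier_has_pd0 phi z : Schwartz phi ->
  has_pd ord0 (pfourier phi) z (pfourier (partial ord0 phi) z).
Proof.
case: z => x y sp; have sp' := schwartz_partial ord0 sp.
rewrite has_pd0E; under eq_fun do rewrite pfourierE; rewrite pfourierE.
have [_ [C hC]] := schwartz_decay sp'.
have C0 := decay2_bound_ge0 hC.
apply: (@cderive_integral _ (fun s t => expi (- (t * y)) * phi (s, t))
  (fun s t => expi (- (t * y)) * partial ord0 phi (s, t)) x C).
- move=> s t; apply: is_cderiveZ.
  by have /has_pd0E := schwartz_has_pd ord0 (s, t) sp.
- by move=> s; apply: pfourier_decay; exact: schwartz_decay.
- move=> s t _; rewrite cabsM cabs_expi mul1r (le_trans (hC _)) // ler_wpM2l //.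
  by rewrite ler_piMl ?bump_le1 ?(ltW (bump_gt0 _)).
Qed.

Lemma pfourier_has_pd1 phi z : Schwartz phi ->
  has_pd ord_max (pfourier phi) z (pfourier ((- ci) *: mulc ord_max phi) z).
Proof.
case: z => x y sp; have sp' := schwartz_mulc ord_max sp.
rewrite has_pd1E; under eq_fun do rewrite pfourierE; rewrite pfourierE.
have [_ [C hC]] := schwartz_decay sp'.
have C0 := decay2_bound_ge0 hC.
apply: (@cderive_integral _ (fun s t => expi (- (t * s)) * phi (x, t))
  (fun s t => expi (- (t * s)) * ((- ci) *: mulc ord_max phi) (x, t)) y C).
- move=> s t; apply: is_cderive_eq.
    apply: (@is_cderiveM _ (fun s => expi (- (t * s))) (fun=> phi (x, t)));
      last exact: is_cderive_cst.
    apply: (@is_cderive_expi _ (fun s => - (t * s)) s (- t)).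
    by apply: is_derive_eq; rewrite /GRing.scale /= mulr1.
  rewrite !fctE -[(- ci) *: _]/((- ci) * _) /mulc /coord /= rmorphN /=; ring.
- by move=> s; apply: pfourier_decay; exact: schwartz_decay.
- move=> s t _; rewrite cabsM cabs_expi mul1r cabsM cabsN cabs_ci mul1r.
  rewrite (le_trans (hC _)) // ler_wpM2l //.
  by rewrite ler_piMl ?bump_le1 ?(ltW (bump_gt0 _)).
Qed.

Lemma pfourier_mulc0 phi : Schwartz phi ->
  mulc ord0 (pfourier phi) = pfourier (mulc ord0 phi).
Proof.
move=> sp; apply/funext => -[x y]; rewrite /mulc !pfourierE /coord /=.
rewrite -integral1Z; last exact: pfourier_decay (schwartz_decay sp).
by apply: eq_cintegral => t; ring.
Qed.

(** Integration by parts: the t-derivative of [expi (- (t * y)) * phi (x, t)] has integral 0. *)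
Lemma pfourier_partial1 phi : Schwartz phi ->
  pfourier (partial ord_max phi) = ci *: mulc ord_max (pfourier phi).
Proof.
move=> sp; have sp' := schwartz_partial ord_max sp; apply/funext => -[x y].
have d1 := pfourier_decay x y (schwartz_decay sp).
have d2 := pfourier_decay x y (schwartz_decay sp').
pose g t := expi (- (t * y)) * phi (x, t).
pose g' t := - ci * y%:C * (expi (- (t * y)) * phi (x, t)) +
  expi (- (t * y)) * partial ord_max phi (x, t).
have gd t : is_cderive g t (g' t).
  apply: is_cderive_eq.
    apply: (@is_cderiveM _ (fun t => expi (- (t * y))) (fun t => phi (x, t))).
      apply: (@is_cderive_expi _ (fun t => - (t * y)) t (- y)).
      by apply: is_derive_eq; rewrite /GRing.scale /= ?mulr0 ?add0r ?addr0 ?mulr1.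
    exact: (schwartz_has_pd ord_max (x, t) sp).
  by rewrite /g' rmorphN /=; ring.
have := integral1_derive gd d1 (decay1D (decay1Z _ d1) d2).
rewrite (integral1D (decay1Z _ d1) d2) integral1Z // => E.
rewrite !fctE -[ci *: _]/(ci * _) /mulc /coord /= !pfourierE.
by apply/eqP; rewrite -subr_eq0 -E; apply/eqP; ring.
Qed.

Lemma pfourier_mulc1 phi : Schwartz phi ->
  mulc ord_max (pfourier phi) = pfourier ((- ci) *: partial ord_max phi).
Proof.
move=> sp; rewrite (op_linear_scale _ pfourier_lin); last exact: schwartz_partial.
by rewrite pfourier_partial1 // scalerA mulNr sqr_ci opprK scale1r.
Qed.

Lemma op_continuous_pfourier : op_continuous (@pfourier R).
Proof.
apply: (@op_continuous_intertwining _ _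
  (fun j phi => if j == ord0 then partial ord0 phi else (- ci) *: mulc ord_max phi)
  (fun j phi => if j == ord0 then mulc ord0 phi else (- ci) *: partial ord_max phi)).
- move=> j; have [->|->] := ord2P j; first exact: op_continuous_partial.
  exact: op_continuousZ (op_continuous_mulc _).
- move=> j; have [->|->] := ord2P j; first exact: op_continuous_mulc.
  exact: op_continuousZ (op_continuous_partial _).
- move=> j phi z; have [->|->] := ord2P j; first exact: pfourier_has_pd0.
  exact: pfourier_has_pd1.
- move=> j phi; have [->|->] := ord2P j; first exact: pfourier_mulc0.
  exact: pfourier_mulc1.
- exists 2%N, (2 * bump_mass * 4); split; first by rewrite !mulr_ge0 // bump_mass_ge0.
  move=> phi d sp d0 hd z; rewrite -mulrA.
  by apply: cabs_pfourier_le; [exact: schwartz_decay|exact: small_decay hd].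
Qed.

Lemma schwartz_pfourier phi : Schwartz phi -> Schwartz (pfourier phi).
Proof. by case: op_continuous_pfourier => h _; exact: h. Qed.

End PartialFourier.

(** * Gaussians and their partial Fourier transforms *)

Section Gaussian.
Context {R : realType}.
Implicit Types (f g phi psi : R * R -> R[i]) (z : R * R) (j : 'I_2) (c : R[i])
  (a x y s t u : R).

(** With u = n v, the bound is v^n <= (1 + v)^n <= e^(n v). *)
Lemma expr_expRN_le u n : 0 <= u -> u ^+ n * expR (- u) <= n%:R ^+ n.
Proof.
move=> u0; case: n => [|n]; first by rewrite !expr0 mul1r -expR0 ler_expR oppr_le0.
rewrite expRN ler_pdivrMr ?expR_gt0 //.
have n0 : 0 < n.+1%:R :> R by rewrite ltr0n.
have -> : u = n.+1%:R * (u / n.+1%:R) by rewrite mulrC divfK // gt_eqF.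
have v0 : 0 <= u / n.+1%:R by rewrite divr_ge0 // ltW.
rewrite expRM_natl exprMn ler_pM2l ?exprn_gt0 // lerXn2r ?nnegrE ?expR_ge0 //.
by apply: le_trans (expR_ge1Dx _); rewrite lerDr.
Qed.

(** Taken in two variables so as to lie in S(R^2) and to be within reach of [pfourier]; its slice at
    x = 0 supplies the one-dimensional Gaussian. *)
Definition gaussian a z : R[i] := (expR (- (a / 2) * (z.1 ^+ 2 + z.2 ^+ 2)))%:C.

Lemma has_pd_expR j (r : R * R -> R) z (d : R) :
  has_pd j (fun z => (r z)%:C) z d%:C ->
  has_pd j (fun z => (expR (r z))%:C) z (d%:C * (expR (r z))%:C).
Proof.
move=> [hr _]; rewrite /has_pd.
pose s t := if j == ord0 then r (t, z.2) else r (z.1, t).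
have E : (fun t => complex.Re (slice (fun z => (r z)%:C) j z t)) = s.
  by apply/funext => t; rewrite /slice /s; case: ifP.
rewrite E /= in hr.
rewrite (_ : slice _ j z = fun t => (expR (s t))%:C); last first.
  by apply/funext => t; rewrite /slice /s; case: ifP.
have sE : s (coord j z) = r z.
  by rewrite /s /coord; case: (j == ord0); case: (z).
rewrite -rmorphM /= -sE; apply: is_cderive_real.
have := is_derive1_comp (is_derive_expR (s (coord j z))) hr.
by rewrite mulrC.
Qed.

Lemma gaussian_has_pd a j z :
  has_pd j (gaussian a) z ((- a * coord j z)%:C * gaussian a z).
Proof.
apply: has_pd_expR.
rewrite (_ : (fun z => _) = fun z => (- (a / 2))%:C *
    ((coord ord0 z)%:C * (coord ord0 z)%:C + (coord ord_max z)%:C * (coord ord_max z)%:C)); last first.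
  by apply/funext => w; rewrite -!(rmorphM, rmorphD) /= -!expr2.
apply: has_pd_eq.
  by apply: has_pdZ; apply: has_pdD; apply: has_pdM; exact: has_pd_coord.
rewrite -!(rmorphM, rmorphD) /=; congr (_%:C).
by have [->|->] := ord2P j; rewrite /coord /=; field.
Qed.

Lemma expr_gaussian_le a m (w : R) : 0 < a -> 0 <= w ->
  w ^+ m * expR (- (a / 2) * w) <= (2 / a) ^+ m * m%:R ^+ m.
Proof.
move=> a0 w0; have u0 : 0 <= a / 2 * w by rewrite mulr_ge0 // divr_ge0 // ltW.
rewrite mulNr {1}(_ : w = 2 / a * (a / 2 * w)); last by field; rewrite gt_eqF.
rewrite exprMn -[leLHS]mulrA; apply: ler_wpM2l; last exact: expr_expRN_le.
by rewrite exprn_ge0 // divr_ge0 // ltW.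
Qed.

Lemma poly_bounded_gaussian a f : 0 < a -> poly_bounded f ->
  exists K, forall z, cabs (f z * gaussian a z) <= K.
Proof.
move=> a0 [k [K hK]]; have K0 := bound_ge0 hK.
(* The weight is at most w = 3 + |z|^2, and w^k e^(-a w / 2) is bounded by [expr_gaussian_le]; the
   shift by 3 costs e^(3 a / 2). *)
exists (K * (expR (3 * a / 2) * ((2 / a) ^+ k * k%:R ^+ k))) => z.
rewrite cabsM cabs_real ger0_norm ?expR_ge0 //.
apply: (le_trans (ler_wpM2r (expR_ge0 _) (hK z))); rewrite -[leLHS]mulrA ler_wpM2l //.
have W : weight z <= 3 + (z.1 ^+ 2 + z.2 ^+ 2).
  rewrite /weight -[z.1 ^+ 2]real_normK ?num_real // -[z.2 ^+ 2]real_normK ?num_real //.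
  by have := sqr_ge0 (`|z.1| - 1); have := sqr_ge0 (`|z.2| - 1); nra.
have W0 := ltW (weight_gt0 z).
have := expr_gaussian_le k a0 (le_trans W0 W).
move/(ler_wpM2l (expR_ge0 (3 * a / 2))); apply: le_trans.
rewrite [leRHS]mulrCA -expRD (_ : 3 * a / 2 + _ = - (a / 2) * (z.1 ^+ 2 + z.2 ^+ 2)); last by ring.
by rewrite ler_wpM2r ?expR_ge0 // lerXn2r // nnegrE ?(le_trans W0).
Qed.

(** Polynomial multiples of the Gaussian form a class closed under derivatives and coordinate
    multiplications. *)
Lemma schwartz_gaussian a : 0 < a -> Schwartz (gaussian a).
Proof.
move=> a0.
have d (p : mpoly 2 R[i]) j z : has_pd j (fun z => eval2 p z * gaussian a z) z
    (eval2 (mderiv j p + mpolyC 2 (- a)%:C * mpolyX R[i] (mnm1 j) * p) z * gaussian a z).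
  apply: has_pd_eq (has_pdM (eval2_has_pd j p z) (gaussian_has_pd a j z)) _.
  by rewrite eval2D !eval2M eval2C eval2X rmorphM /=; ring.
apply: (@schwartz_coind _ (fun f => exists p : mpoly 2 R[i], f = fun z => eval2 p z * gaussian a z)).
- by move=> _ j z [p ->]; have [] := has_pdP (d p j z).
- by move=> _ [p ->]; exact: poly_bounded_gaussian (poly_bounded_eval2 p).
- by move=> _ j [p ->]; eexists; apply/funext => z; exact: partial_eq (d p j z).
- move=> _ j [p ->]; exists (mpolyX R[i] (mnm1 j) * p); apply/funext => z.
  by rewrite eval2M eval2X /mulc mulrA.
- by exists (mpolyC 2 1); apply/funext => z; rewrite eval2C mul1r.
Qed.

Lemma is_cderive0_cst (h : R -> R[i]) x y : (forall t, is_cderive h t 0) -> h x = h y.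
Proof.
move=> dh; apply: complexP.
- by apply: (@is_derive_0_is_cst _ (fun t => complex.Re (h t))) => t; case: (dh t).
- by apply: (@is_derive_0_is_cst _ (fun t => complex.Im (h t))) => t; case: (dh t).
Qed.

(** The Gaussian solves g' = - a t g, so its transform solves F' = - (u / a) F, and e^(u^2 / (2 a))
    F is constant. *)
Lemma pfourier_gaussian a u : 0 < a ->
  pfourier (gaussian a) (0, u) =
  (expR (- (u ^+ 2 / (2 * a))))%:C * pfourier (gaussian a) (0, 0).
Proof.
move=> a0; have sg := schwartz_gaussian a0.
have a_neq0 : a%:C != 0 by rewrite eq_complex /= eqxx andbT gt_eqF.
have E : partial ord_max (gaussian a) = (- a)%:C *: mulc ord_max (gaussian a).
  apply/funext => z; rewrite (partial_eq (gaussian_has_pd a ord_max z)).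
  by rewrite rmorphM -mulrA.
pose h t := (expR (t ^+ 2 / (2 * a)))%:C * pfourier (gaussian a) (0, t).
have dh t : is_cderive h t 0.
  apply: is_cderive_eq.
    apply: (@is_cderiveM _ (fun t => (expR (t ^+ 2 / (2 * a)))%:C)).
      apply: (@is_cderive_real _ (fun t => expR (t ^+ 2 / (2 * a))) t
        (t / a * expR (t ^+ 2 / (2 * a)))).
      apply: is_derive_eq; rewrite /GRing.scale /=.
      by field; rewrite gt_eqF.
    exact: (pfourier_has_pd1 (0, t) sg).
  have -> : (- ci) *: mulc ord_max (gaussian a) =
      (ci / a%:C) *: partial ord_max (gaussian a).
    by rewrite E scalerA rmorphN /= mulrN divfK.
  rewrite (op_linear_scale _ pfourier_lin); last exact: schwartz_partial.
  rewrite pfourier_partial1 // !fctE /mulc /coord /=.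
  have ta : (t / a)%:C = t%:C / a%:C by rewrite rmorphM fmorphV.
  rewrite -[(ci / a%:C) *: _]/(ci / a%:C * _) -[ci *: _]/(ci * _) rmorphM /= ta.
  transitivity ((1 + ci * ci) * (t%:C / a%:C * (expR (t ^+ 2 / (2 * a)))%:C * pfourier (gaussian a) (0, t))).
    by ring.
  by rewrite sqr_ci subrr mul0r.
have := is_cderive0_cst u 0 dh; rewrite /h expr0n /= mul0r expR0 mul1r => <-.
by rewrite mulrA -rmorphM /= -expRD addNr expR0 mul1r.
Qed.

Local Notation mu := (@lebesgue_measure R).

(** The value at 0 is read off from the total mass 1 of the normal law of deviation 1 / s; it equals
    sqrt(2 pi) / s, that is 2 pi times the peak of the normal law of deviation s. *)
Lemma pfourier_gaussianE (s u : R) : 0 < s ->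
  pfourier (gaussian (s ^+ 2)) (0, u) = (2 * pi * normal_pdf 0 s u)%:C.
Proof.
move=> s0; rewrite pfourier_gaussian ?exprn_gt0 //.
have si0 : s^-1 != 0 by rewrite invr_eq0 gt_eqF.
have E0 : pfourier (gaussian (s ^+ 2)) (0, 0) = ((normal_peak s^-1)^-1)%:C.
  rewrite pfourierE.
  have Rint : Rintegral mu setT (normal_pdf 0 s^-1) = 1.
    by rewrite /Rintegral integral_normal_pdf.
  transitivity (integral1 (fun t => ((normal_peak s^-1)^-1 * normal_pdf 0 s^-1 t)%:C)).
    apply: eq_cintegral => t.
    rewrite mulr0 oppr0 expi0 mul1r normal_pdfE // /gaussian /= mulrA.
    rewrite mulVf ?mul1r ?gt_eqF ?normal_peak_gt0 //; congr (expR _)%:C.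
    by rewrite /= subr0 expr0n /= add0r; field; rewrite gt_eqF.
  apply: complexP => /=; last by rewrite /Rintegral integral0.
  rewrite RintegralZl ?Rint ?mulr1 //; exact: integrable_normal_pdf.
have Epeak : (normal_peak s^-1)^-1 = 2 * pi * normal_peak s.
  rewrite /normal_peak invrK exprVn; set p := _ * pi *+ 2; set q := _ * pi *+ 2.
  have q0 : 0 < q by rewrite /q pmulrn_lgt0 // mulr_gt0 ?pi_gt0 ?exprn_gt0.
  have p0 : 0 < p by rewrite /p pmulrn_lgt0 // mulr_gt0 ?pi_gt0 ?invr_gt0 ?exprn_gt0.
  apply: (@mulIf _ (Num.sqrt q)); first by rewrite gt_eqF // sqrtr_gt0.
  rewrite divfK ?gt_eqF ?sqrtr_gt0 // -sqrtrM ?ltW //.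
  have -> : p * q = (2 * pi) ^+ 2 by rewrite /p /q; field; rewrite gt_eqF.
  by rewrite sqrtr_sqr ger0_norm // mulr_ge0 // pi_ge0.
have Eexp : expR (- (u ^+ 2 / (2 * s ^+ 2))) = normal_fun 0 s u.
  by rewrite /normal_fun subr0; congr (expR _); field; rewrite gt_eqF.
rewrite E0 Epeak Eexp -rmorphM /= normal_pdfE ?gt_eqF //; congr (_%:C).
by ring.
Qed.

End Gaussian.

Lemma eq_integral1 (R : realType) (g h : R -> R[i]) :
  (forall t, g t = h t) -> integral1 g = integral1 h.
Proof. by move=> /funext ->. Qed.

Lemma ReB (R : realType) (c d : R[i]) :
  complex.Re (c - d) = complex.Re c - complex.Re d.
Proof. by case: c d => ? ? [? ?]. Qed.

Lemma ImB (R : realType) (c d : R[i]) :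
  complex.Im (c - d) = complex.Im c - complex.Im d.
Proof. by case: c d => ? ? [? ?]. Qed.

(** * Fourier inversion in one variable by Gaussian regularisation *)

Section Inversion.
Context {R : realType}.
Implicit Types (phi psi : R * R -> R[i]) (x y s t u : R).
Local Notation mu := (@lebesgue_measure R).

Lemma ccontinuous_normal_pdf s (m : R) : s != 0 ->
  ccontinuous (fun t => (normal_pdf m s t)%:C).
Proof. by move=> s0; apply: ccontinuous_real; exact: continuous_normal_pdf. Qed.

(** Doubling the deviation absorbs |u|. With v = u^2 / (8 s^2) the two exponents are -4v and -v, and
    |u| <= 2 s (1 + 3v) <= 2 s e^(3v), the first inequality coming from (|u| - 2s)^2 >= 0. The ratio
    2 of the peaks completes the constant 4 s. It bounds the first absolute moment of the normal
    law. *)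
Lemma norm_normal_pdf_le s u : 0 < s ->
  `|u| * normal_pdf 0 s u <= 4 * s * normal_pdf 0 (2 * s) u.
Proof.
move=> s0; have s2 : 0 < 2 * s by rewrite mulr_gt0.
rewrite !normal_pdfE ?gt_eqF // /normal_fun subr0.
have Ep : normal_peak s = 2 * normal_peak (2 * s).
  rewrite /normal_peak; set p := _ * pi *+ 2; set q := _ * pi *+ 2.
  have -> : q = 2 ^+ 2 * p by rewrite /p /q exprMn mulrnAr mulrA.
  by rewrite sqrtrM ?sqr_ge0 // sqrtr_sqr ger0_norm // invfM mulrA divff ?mul1r.
rewrite Ep.
set v := u ^+ 2 / (8 * s ^+ 2).
have v0 : 0 <= v.
  by apply: divr_ge0; [exact: sqr_ge0|apply: mulr_ge0 => //; exact: sqr_ge0].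
have -> : - u ^+ 2 / (s ^+ 2 *+ 2) = - v - 3 * v.
  by rewrite /v; field; rewrite gt_eqF.
have -> : - u ^+ 2 / ((2 * s) ^+ 2 *+ 2) = - v by rewrite /v; field; rewrite gt_eqF.
rewrite expRD.
have key : `|u| * expR (- (3 * v)) <= 2 * s.
  rewrite expRN ler_pdivrMr ?expR_gt0 //.
  apply: (@le_trans _ _ (2 * s * (1 + 3 * v))); last first.
    by rewrite ler_pM2l //; exact: expR_ge1Dx.
  have Ev : u ^+ 2 = v * (8 * s ^+ 2) by rewrite /v divfK // gt_eqF // mulr_gt0 // exprn_gt0.
  rewrite -[u ^+ 2]real_normK ?num_real // in Ev.
  have := sqr_ge0 (`|u| - 2 * s); set w := `|u| in Ev * => h.
  have : w ^+ 2 = 8 * v * s ^+ 2 by rewrite Ev; ring.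
  move=> {}Ev; have : 0 <= v * s ^+ 2 by rewrite mulr_ge0 ?sqr_ge0.
  rewrite -(ler_pM2l s0); nra.
set e := expR (- v) in key *; set e3 := expR _ in key *; set pk := normal_peak _.
have e0 : 0 <= e by exact: expR_ge0.
have pk0 : 0 <= pk by exact: normal_peak_ge0.
have := ler_wpM2l (mulr_ge0 pk0 e0) key; nra.
Qed.

(** Up to the factor [normal_peak s], a slice of the Schwartz Gaussian of parameter s^-2. *)
Lemma decay1_normal_pdf s : 0 < s -> decay1 (fun t => (normal_pdf 0 s t)%:C : R[i]).
Proof.
move=> s0; have si0 : 0 < s^-1 by rewrite invr_gt0.
have d := pfourier_decay 0 0 (schwartz_decay (schwartz_gaussian (exprn_gt0 2 si0))).
have := decay1Z (normal_peak s)%:C d.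
congr decay1; apply/funext => t.
rewrite mulr0 oppr0 expi0 mul1r normal_pdfE ?gt_eqF // -rmorphM /=; congr (_ * expR _)%:C.
by rewrite /= subr0 expr0n /= add0r; field; rewrite gt_eqF.
Qed.

Lemma integral1_normal_pdf s : 0 < s ->
  integral1 (fun t => (normal_pdf 0 s t)%:C) = 1 :> R[i].
Proof.
move=> s0; apply: complexP => /=; last by rewrite /Rintegral integral0.
by rewrite /Rintegral integral_normal_pdf // gt_eqF.
Qed.

Lemma lipschitz_snd phi : Schwartz phi -> exists L, 0 <= L /\
  forall x t u, cabs (phi (x, t) - phi (x, u)) <= L * `|t - u|.
Proof.
move=> sp; have [_ [C hC]] := schwartz_decay (schwartz_partial ord_max sp).
have C0 := decay2_bound_ge0 hC.
have {}hC z : cabs (partial ord_max phi z) <= C.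
  apply: (le_trans (hC z)); rewrite ler_piMr //.
  by rewrite mulr_ile1 ?(ltW (bump_gt0 _)) ?bump_le1.
exists (C + C); split => [|x t u]; first exact: addr_ge0.
have d s : is_cderive (fun t => phi (x, t)) s (partial ord_max phi (x, s)).
  exact: (schwartz_has_pd ord_max (x, s) sp).
apply: (le_trans (cabs_le_ReIm _)); rewrite mulrDl.
rewrite ReB ImB; apply: lerD.
- apply: (@lipschitz_of_derive _ (fun t => complex.Re (phi (x, t)))
    (fun t => complex.Re (partial ord_max phi (x, t)))) => [w|w _].
    by case: (d w).
  exact: le_trans (Re_le_cabs _) (hC _).
- apply: (@lipschitz_of_derive _ (fun t => complex.Im (phi (x, t)))
    (fun t => complex.Im (partial ord_max phi (x, t)))) => [w|w _].
    by case: (d w).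
  exact: le_trans (Im_le_cabs _) (hC _).
Qed.

(* The inverse transform of [pfourier phi] cut off by a Gaussian: a Gaussian mean of
   [phi (x, .)] around [- y]. *)
Definition smoothed s phi x y : R[i] :=
  integral1 (fun t => expi (- (t * y)) * (gaussian (s ^+ 2) (0, t) * pfourier phi (x, t))).

(** Integrating over the frequency first leaves the transform of the Gaussian at u + y, which is 2
    pi times a normal density; a translation by y recentres it. *)
Lemma smoothedE s phi x y : 0 < s -> Schwartz phi -> smoothed s phi x y =
  (2 * pi)%:C * integral1 (fun t => (normal_pdf 0 s t)%:C * phi (x, t - y)).
Proof.
move=> s0 sp; have dp := schwartz_decay sp.
have [cp [C hC]] := dp.
have dg := schwartz_decay (schwartz_gaussian (exprn_gt0 2 s0)).
have [cg [G hG]] := dg.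
pose f (z : R * R) := expi (- (z.1 * (y + z.2))) * (gaussian (s ^+ 2) (0, z.1) * phi (x, z.2)).
have df : decay2 f.
  apply: (decay2M (K := 1)).
  - split.
      apply: ccontinuousM.
        apply: (ccontinuous_comp _ cg) => z.
        by exact: (cvg_pair (cvg_cst 0) cvg_fst).
      apply: (ccontinuous_comp _ cp) => z.
      by exact: (cvg_pair (cvg_cst x) cvg_snd).
    exists (G * bump 0 * (C * bump x)) => z; rewrite cabsM.
    apply: (le_trans (ler_pM (cabs_ge0 _) (cabs_ge0 _) (hG _) (hC _))) => /=.
    by rewrite le_eqVlt; apply/orP; left; apply/eqP; ring.
  - apply: ccontinuous_expi => z; apply: cvgN; apply: cvgM; first exact: cvg_fst.
    by apply: cvgD; [exact: cvg_cst|exact: cvg_snd].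
  - by move=> t; rewrite cabs_expi.
have [F1 F2] := fubini_decay df.
transitivity (integral2 f).
  rewrite F1 /smoothed; apply: eq_cintegral => t.
  rewrite pfourierE -integral1Z; last exact: pfourier_decay.
  rewrite -integral1Z; last by apply: decay1Z; exact: pfourier_decay.
  apply: eq_cintegral => u; rewrite /f /=.
  rewrite (_ : - (t * (y + u)) = - (t * y) + - (u * t)); last by ring.
  by rewrite expiD; ring.
rewrite F2.
have E u : integral1 (fun t => f (t, u)) = (2 * pi * normal_pdf 0 s (u + y))%:C * phi (x, u).
  rewrite -(pfourier_gaussianE _ s0) pfourierE mulrC -integral1Z; last first.
    exact: pfourier_decay.
  by apply: eq_cintegral => t; rewrite /f /= [u + y]addrC; ring.
rewrite (eq_integral1 E).
have ds : decay1 (fun t => (normal_pdf 0 s t)%:C * phi (x, t - y)).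
  have d1 := decay1_shift (- y) (decay2_slice1 x dp).
  apply: decay1M d1 _ _.
    by apply: ccontinuous_normal_pdf; rewrite gt_eqF.
  move=> t; rewrite cabs_real ger0_norm ?normal_pdf_ge0 //.
  by apply: normal_pdf_ub; rewrite gt_eqF.
rewrite -integral1Z // -(@integral1_translation _ (fun t => (2 * pi)%:C *
  ((normal_pdf 0 s t)%:C * phi (x, t - y))) y); last first.
  by have [] := decay1Z (2 * pi)%:C ds.
by apply: eq_cintegral => u; rewrite addrK rmorphM mulrA.
Qed.

(** The density has mass 1, so the difference is 2 pi times the mean of phi (x, t - y) - phi (x, -
    y), controlled by a Lipschitz constant [L] and the first absolute moment, of order s. In the
    constant, 4 comes from [norm_normal_pdf_le] and the inner 2 from [cabs_cintegral_le]. *)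
Lemma smoothed_cvg phi x y : Schwartz phi -> exists C, forall s, 0 < s ->
  cabs (smoothed s phi x y - (2 * pi)%:C * phi (x, - y)) <= C * s.
Proof.
move=> sp; have dp := schwartz_decay sp.
have [L [L0 hL]] := lipschitz_snd sp.
exists (2 * pi * (2 * (4 * L))) => s s0.
have dn := decay1_normal_pdf s0.
have d1 : decay1 (fun t => (normal_pdf 0 s t)%:C * phi (x, t - y)).
  apply: decay1M (decay1_shift (- y) (decay2_slice1 x dp)) _ _.
    by case: dn.
  move=> t; rewrite cabs_real ger0_norm ?normal_pdf_ge0 //.
  by apply: normal_pdf_ub; rewrite gt_eqF.
have E : smoothed s phi x y - (2 * pi)%:C * phi (x, - y) = (2 * pi)%:C *
    integral1 (fun t => (normal_pdf 0 s t)%:C * phi (x, t - y) +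
      (- phi (x, - y)) * (normal_pdf 0 s t)%:C).
  rewrite smoothedE // integral1D ?integral1Z ?integral1_normal_pdf //; last exact: decay1Z.
  by rewrite mulr1; ring.
rewrite E cabsM cabs_real ger0_norm ?mulr_ge0 ?pi_ge0 // -!mulrA.
rewrite !ler_pM2l ?pi_gt0 //.
have s2 : 0 < 2 * s by rewrite mulr_gt0.
have i2 : mu.-integrable setT (EFin \o (normal_pdf 0 (2 * s))).
  by apply: integrable_normal_pdf; rewrite gt_eqF.
have hi : mu.-integrable setT (EFin \o (fun t => L * 4 * s * normal_pdf 0 (2 * s) t)).
  exact: (integrableZl _ (L * 4 * s) i2).
set g := (fun t : R => _ + _).
have gi : cintegrable mu g.
  by apply: decay1_integrable; apply: decay1D => //; exact: decay1Z.
have gle t : cabs (g t) <= L * 4 * s * normal_pdf 0 (2 * s) t.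
  have -> : g t = (normal_pdf 0 s t)%:C * (phi (x, t - y) - phi (x, - y)).
    by rewrite /g; ring.
  rewrite cabsM cabs_real ger0_norm ?normal_pdf_ge0 //.
  have := norm_normal_pdf_le t s0; have := hL x (t - y) (- y).
  rewrite opprK subrK => h1 h2.
  apply: (le_trans (ler_wpM2l (normal_pdf_ge0 _ _ _) h1)).
  by have := ler_wpM2l L0 h2; lra.
apply: (le_trans (cabs_cintegral_le gi hi gle)).
rewrite RintegralZl // ler_pM2l //.
have -> : Rintegral mu setT (normal_pdf 0 (2 * s)) = 1.
  by rewrite /Rintegral integral_normal_pdf // gt_eqF.
by rewrite le_eqVlt; apply/orP; left; apply/eqP; ring.
Qed.

(** The cut-off costs 1 - e^(-s^2 t^2 / 2) <= s^2 t^2, and t^2 times the transform of [phi] is still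
    dominated by [bump]. *)
Lemma smoothed_error phi x y : Schwartz phi -> exists C, forall s, 0 < s ->
  cabs (pfourier (pfourier phi) (x, y) - smoothed s phi x y) <= C * s ^+ 2.
Proof.
move=> sp; have sf := schwartz_pfourier sp.
have df := schwartz_decay sf.
have [_ [C hC]] := schwartz_decay (schwartz_mulc ord_max (schwartz_mulc ord_max sf)).
exists (2 * bump_mass * (C * bump x)) => s s0.
have dg := decay2_slice1 0 (schwartz_decay (schwartz_gaussian (exprn_gt0 2 s0))).
have g1 t : 0 <= expR (- (s ^+ 2 / 2) * (0 ^+ 2 + t ^+ 2)) <= (1 : R).
  rewrite expR_ge0 -expR0 ler_expR mulNr oppr_le0 mulr_ge0 ?divr_ge0 ?sqr_ge0 //.
  by rewrite addr_ge0 ?sqr_ge0.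
have d1 := pfourier_decay x y df.
have d2 : decay1 (fun t => expi (- (t * y)) *
    (gaussian (s ^+ 2) (0, t) * pfourier phi (x, t))).
  have := decay1M (K := 1) d1 dg.1.
  have cg1 t : cabs (gaussian (s ^+ 2) (0, t)) <= 1.
    by rewrite cabs_real ger0_norm /=; have /andP[] := g1 t.
  move=> /(_ cg1); congr decay1; apply/funext => t; ring.
have -> : pfourier (pfourier phi) (x, y) - smoothed s phi x y =
  integral1 (fun t => expi (- (t * y)) * pfourier phi (x, t) +
    (-1) * (expi (- (t * y)) * (gaussian (s ^+ 2) (0, t) * pfourier phi (x, t)))).
  rewrite integral1D // ?integral1Z //; last exact: decay1Z.
  by rewrite mulN1r pfourierE.
rewrite -mulrA; apply: (@cabs_integral1_le _ _ (C * bump x * s ^+ 2)).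
  by apply: decay1D => //; exact: decay1Z.
move=> t.
have -> : expi (- (t * y)) * pfourier phi (x, t) +
    (-1) * (expi (- (t * y)) * (gaussian (s ^+ 2) (0, t) * pfourier phi (x, t))) =
  expi (- (t * y)) * ((1 - expR (- (s ^+ 2 / 2) * (0 ^+ 2 + t ^+ 2)))%:C
    * pfourier phi (x, t)).
  by rewrite rmorphB /= /gaussian /=; ring.
rewrite cabsM cabs_expi mul1r cabsM cabs_real ger0_norm; last first.
  by rewrite subr_ge0; have /andP[] := g1 t.
have h1 : 1 - expR (- (s ^+ 2 / 2) * (0 ^+ 2 + t ^+ 2)) <= s ^+ 2 * t ^+ 2.
  have := expR_ge1Dx (- (s ^+ 2 / 2) * (0 ^+ 2 + t ^+ 2)).
  rewrite expr0n /= add0r => h; have : 0 <= s ^+ 2 * t ^+ 2 by rewrite mulr_ge0 ?sqr_ge0.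
  by lra.
apply: (le_trans (ler_wpM2r (cabs_ge0 _) h1)).
have := hC (x, t); rewrite /mulc /coord /= !cabsM !cabs_real mulrA -expr2 real_normK ?num_real //.
move=> h2; have := ler_wpM2l (sqr_ge0 s) h2; lra.
Qed.

Lemma pfourier_inversion phi x y : Schwartz phi ->
  pfourier (pfourier phi) (x, y) = (2 * pi)%:C * phi (x, - y).
Proof.
move=> sp; have [A hA] := smoothed_error x y sp; have [B hB] := smoothed_cvg x y sp.
apply/eqP; rewrite -subr_eq0 -cabs_eq0 eq_le cabs_ge0 andbT.
apply/ler_addgt0Pr => e e0; rewrite add0r.
have D0 : 0 < `|A| + `|B| + 1 by rewrite ltr_wpDl ?addr_ge0.
(* With s <= 1 the error A s^2 is at most |A| s, so both errors are linear in s. *)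
pose s := Num.min 1 (e / (`|A| + `|B| + 1)).
have s0 : 0 < s by rewrite lt_min ltr01 divr_gt0.
have s1 : s <= 1 by rewrite ge_min lexx.
have se : s * (`|A| + `|B| + 1) <= e.
  by rewrite -ler_pdivlMr // ge_min lexx orbT.
rewrite -(subrKA (smoothed s phi x y)) (le_trans (cabsD _ _)) //.
apply: (le_trans (lerD (hA s s0) (hB s s0))).
apply: le_trans se.
have s2 : s ^+ 2 <= s by rewrite expr2 ler_piMl // ltW.
have a1 : A * s ^+ 2 <= `|A| * s.
  apply: (@le_trans _ _ (`|A| * s ^+ 2)); first by rewrite ler_wpM2r ?sqr_ge0 ?ler_norm.
  by rewrite ler_wpM2l.
have b1 : B * s <= `|B| * s by rewrite ler_wpM2r ?ler_norm // ltW.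
have := ltW s0; lra.
Qed.

End Inversion.

(** * Isomorphisms of the Schwartz space *)

Section ChainRule.
Context {R : realType}.

(** Caratheodory's criterion: [g] is the slope of [f] at [t0], completed by [D]. One mean value step
    per coordinate writes the slope as p h0 + r h1 at intermediate points, and the continuity of
    [h0] and [h1] gives the limit. *)
Lemma is_derive_line (h h0 h1 : R * R -> R) (a b p r t0 : R) :
  (forall x y : R, is_derive x (1 : R) (fun s => h (s, y)) (h0 (x, y))) ->
  (forall x y : R, is_derive y (1 : R) (fun s => h (x, s)) (h1 (x, y))) ->
  continuous h0 -> continuous h1 ->
  is_derive t0 (1 : R) (fun t => h (a + t * p, b + t * r))
    (p * h0 (a + t0 * p, b + t0 * r) + r * h1 (a + t0 * p, b + t0 * r)).
Proof.
move=> d0 d1 c0 c1; set z := (a + t0 * p, b + t0 * r).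
set f := fun t => _; set D := _ + _.
pose g t := if t == t0 then D else (f t - f t0) / (t - t0).
apply/is_derive1_caratheodory; exists g; split.
- move=> t; rewrite /g; case: eqVneq => [->|tt]; first by rewrite !subrr mulr0.
  by rewrite divfK // subr_eq0.
- apply/cvgrPdist_le => e e0.
  have gt0 : g t0 = D by rewrite /g eqxx.
  pose k := e / (`|p| + `|r| + 1).
  have M0 : 0 < `|p| + `|r| + 1 by rewrite ltr_wpDl ?addr_ge0.
  have k0 : 0 < k by rewrite divr_gt0.
  have /cvgrPdist_le /(_ k k0) /(@nbhs_ballP _ (R * R)%type)[r0 /= r00 B0] := c0 z.
  have /cvgrPdist_le /(_ k k0) /(@nbhs_ballP _ (R * R)%type)[r1 /= r10 B1] := c1 z.
  apply/nbhs_ballP; exists (Num.min r0 r1 / (`|p| + `|r| + 1)) => /=.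
    by rewrite divr_gt0 // lt_min r00 r10.
  move=> t; rewrite /ball /= distrC ltr_pdivlMr // lt_min => /andP[t1 t2].
  rewrite gt0 /g; case: eqVneq => [_|tt]; first by rewrite subrr normr0 ltW.
  have T0 : 0 <= `|t - t0| by [].
  have [c hc Ec] := MVT_any (a + t0 * p) (a + t * p) (fun x => d0 x (b + t * r)).
  have [q hq Eq] := MVT_any (b + t0 * r) (b + t * r) (d1 (a + t0 * p)).
  have dp : a + t * p - (a + t0 * p) = p * (t - t0) by ring.
  have dr : b + t * r - (b + t0 * r) = r * (t - t0) by ring.
  rewrite dp in hc Ec; rewrite dr in hq Eq.
  have E : f t - f t0 = (p * h0 (c, b + t * r) + r * h1 (a + t0 * p, q)) * (t - t0).
    rewrite /f -(subrKA (h (a + t0 * p, b + t * r))) Ec Eq; ring.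
  rewrite E mulfK ?subr_eq0 //.
  have small (v w : R) : `|v| <= `|p| + `|r| + 1 -> `|t - t0| * (`|p| + `|r| + 1) < w ->
      `|v * (t - t0)| < w.
    by move=> hv; apply: le_lt_trans; rewrite normrM mulrC ler_wpM2l.
  have pM : `|p| <= `|p| + `|r| + 1 by rewrite -addrA lerDl addr_ge0.
  have rM : `|r| <= `|p| + `|r| + 1 by rewrite addrAC lerDr addr_ge0.
  have k1 : `|h0 z - h0 (c, b + t * r)| <= k.
    apply: B0; split; rewrite /ball /= distrC.
      by apply: (le_lt_trans hc); exact: small.
    by rewrite dr; exact: small.
  have k2 : `|h1 z - h1 (a + t0 * p, q)| <= k.
    apply: B1; split; rewrite /ball /= distrC; first by rewrite subrr normr0.
    by apply: (le_lt_trans hq); exact: small.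
  have -> : D - (p * h0 (c, b + t * r) + r * h1 (a + t0 * p, q)) =
      p * (h0 z - h0 (c, b + t * r)) + r * (h1 z - h1 (a + t0 * p, q)).
    by rewrite /D; ring.
  apply: (le_trans (ler_normD _ _)); rewrite !normrM.
  have a1 := ler_wpM2l (normr_ge0 p) k1; have a2 := ler_wpM2l (normr_ge0 r) k2.
  apply: (le_trans (lerD a1 a2)).
  have ke : k * (`|p| + `|r| + 1) = e by rewrite /k divfK // gt_eqF.
  by have := ltW k0; lra.
- by rewrite /g eqxx.
Qed.

Lemma is_cderive_line (phi : R * R -> R[i]) (a b p r t0 : R) : Schwartz phi ->
  is_cderive (fun t => phi (a + t * p, b + t * r)) t0
    (p%:C * partial ord0 phi (a + t0 * p, b + t0 * r) +
     r%:C * partial ord_max phi (a + t0 * p, b + t0 * r)).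
Proof.
move=> sp.
have [c1 c2] := schwartz_ccontinuous (schwartz_partial ord0 sp).
have [c3 c4] := schwartz_ccontinuous (schwartz_partial ord_max sp).
split; rewrite ?ReD ?ImD ?ReM ?ImM /= !mul0r ?subr0 ?addr0.
- apply: (@is_derive_line (fun z => complex.Re (phi z))
    (fun z => complex.Re (partial ord0 phi z))
    (fun z => complex.Re (partial ord_max phi z))) => // x y.
    by case: (schwartz_has_pd ord0 (x, y) sp).
  by case: (schwartz_has_pd ord_max (x, y) sp).
- apply: (@is_derive_line (fun z => complex.Im (phi z))
    (fun z => complex.Im (partial ord0 phi z))
    (fun z => complex.Im (partial ord_max phi z))) => // x y.
    by case: (schwartz_has_pd ord0 (x, y) sp).
  by case: (schwartz_has_pd ord_max (x, y) sp).
Qed.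

End ChainRule.

(** * Invertible linear changes of variables *)

Section LinearChange.
Context {R : realType}.
Implicit Types (f g phi psi : R * R -> R[i]) (z : R * R) (j : 'I_2).

Section Matrix.
Variables a b c d : R.

Definition lin_change phi : R * R -> R[i] :=
  fun z => phi (a * z.1 + b * z.2, c * z.1 + d * z.2).

Lemma lin_change_has_pd0 phi z : Schwartz phi -> has_pd ord0 (lin_change phi) z
  (lin_change (a%:C *: partial ord0 phi + c%:C *: partial ord_max phi) z).
Proof.
case: z => x y sp; rewrite has_pd0E /lin_change /=.
have := is_cderive_line (b * y) (d * y) a c x sp.
rewrite ![_ + x * _]addrC ![x * _]mulrC; congr is_cderive.
by apply/funext => t; congr phi; congr pair; ring.
Qed.

Lemma lin_change_has_pd1 phi z : Schwartz phi -> has_pd ord_max (lin_change phi) z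
  (lin_change (b%:C *: partial ord0 phi + d%:C *: partial ord_max phi) z).
Proof.
case: z => x y sp; rewrite has_pd1E /lin_change /=.
have := is_cderive_line (a * x) (c * x) b d y sp.
rewrite ![y * _]mulrC; congr is_cderive.
by apply/funext => t; congr phi; congr pair; ring.
Qed.

Variables a' b' c' d' : R.
Hypothesis inv1 : forall x y, a' * (a * x + b * y) + b' * (c * x + d * y) = x.
Hypothesis inv2 : forall x y, c' * (a * x + b * y) + d' * (c * x + d * y) = y.

Lemma lin_change_mulc0 phi : mulc ord0 (lin_change phi) =
  lin_change (a'%:C *: mulc ord0 phi + b'%:C *: mulc ord_max phi).
Proof.
apply/funext => -[x y]; rewrite /mulc /lin_change /coord /= !fctE /=.
rewrite -[a'%:C *: _]/(a'%:C * _) -[b'%:C *: _]/(b'%:C * _) !mulrA -mulrDl.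
by rewrite -!rmorphM -rmorphD /= inv1.
Qed.

Lemma lin_change_mulc1 phi : mulc ord_max (lin_change phi) =
  lin_change (c'%:C *: mulc ord0 phi + d'%:C *: mulc ord_max phi).
Proof.
apply/funext => -[x y]; rewrite /mulc /lin_change /coord /= !fctE /=.
rewrite -[c'%:C *: _]/(c'%:C * _) -[d'%:C *: _]/(d'%:C * _) !mulrA -mulrDl.
by rewrite -!rmorphM -rmorphD /= inv2.
Qed.

(** The coordinates of a point are combinations of those of its image, with the entries of the
    inverse matrix a', b', c', d'. Multiplications therefore pass through the change of variables,
    and derivatives do so by the chain rule. *)
Lemma op_continuous_lin_change : op_continuous lin_change.
Proof.
have cont (p r : R) X Y : op_continuous X -> op_continuous Y ->
    op_continuous (fun phi : R * R -> R[i] => p%:C *: X phi + r%:C *: Y phi).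
  by move=> cX cY; exact: op_continuous_lin cX (op_continuousZ _ cY).
apply: (@op_continuous_intertwining _ _
  (fun j phi => (if j == ord0 then a else b)%:C *: partial ord0 phi +
    (if j == ord0 then c else d)%:C *: partial ord_max phi)
  (fun j phi => (if j == ord0 then a' else c')%:C *: mulc ord0 phi +
    (if j == ord0 then b' else d')%:C *: mulc ord_max phi)).
- by move=> j; apply: cont; exact: op_continuous_partial.
- by move=> j; apply: cont; exact: op_continuous_mulc.
- by move=> j phi z; have [->|->] := ord2P j; [exact: lin_change_has_pd0|exact: lin_change_has_pd1].
- by move=> j phi _; have [->|->] := ord2P j; [exact: lin_change_mulc0|exact: lin_change_mulc1].
- exists 2%N, 4; split=> // phi e sp e0 he z.
  apply: (le_trans (small_decay (leqnn 2) he _)).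
  by rewrite ler_piMr ?mulr_ge0 // mulr_ile1 ?(ltW (bump_gt0 _)) ?bump_le1.
Qed.

End Matrix.

End LinearChange.

(** * Automorphisms with a transpose on Schwartz functions *)

Section Isomorphisms.
Context {R : realType}.
Implicit Types (f g h phi psi : R * R -> R[i]) (z : R * R) (j : 'I_2)
  (K L : (R * R -> R[i]) -> R * R -> R[i]) (u v : distr R).

Lemma schwartz_slowly_increasing phi : Schwartz phi -> SlowlyIncreasing phi.
Proof.
move=> sp; apply: (@slowly_increasing_coind _ (@Schwartz R)) => //.
- by move=> f j z sf; have [] := has_pdP (schwartz_has_pd j z sf).
- move=> f sf; have [d d0 hd] := schwartz_small 2 sf.
  apply: (@poly_bounded_bounded _ _ (4 * d)) => z.
  apply: (le_trans (small_decay (leqnn 2) hd z)).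
  rewrite ler_piMr ?mulr_ge0 // mulr_ile1 ?(ltW (bump_gt0 _)) ?bump_le1 //.
- by move=> f j; exact: schwartz_partial.
Qed.

Definition pairing f g : R[i] := integral2 (fun z => f z * g z).

Lemma pairingC f g : pairing f g = pairing g f.
Proof.
rewrite /pairing; congr integral2; apply/funext => z; exact: mulrC.
Qed.

Lemma decay2_mul f g : Schwartz f -> Schwartz g -> decay2 (fun z => f z * g z).
Proof.
move=> sf sg; apply: schwartz_decay.
exact: (schwartz_mulop (schwartz_slowly_increasing sf) sg).
Qed.

(** A transpose that preserves S(R^2) makes composition with [K] preserve the distributions given by
    Schwartz functions. *)
Definition transposable K : Prop := exists2 K', forall f, Schwartz f -> Schwartz (K' f) &
  forall f phi, Schwartz f -> Schwartz phi -> pairing f (K phi) = pairing (K' f) phi.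

Record schwartz_iso K L : Prop := SchwartzIso {
  iso_continuous : op_continuous K;
  iso_inv_continuous : op_continuous L;
  iso_linear : op_linear K;
  iso_inv_linear : op_linear L;
  iso_invK : forall phi, Schwartz phi -> K (L phi) = phi;
  isoK : forall phi, Schwartz phi -> L (K phi) = phi;
  iso_transposable : transposable K;
  iso_inv_transposable : transposable L }.

Lemma iso_sym K L : schwartz_iso K L -> schwartz_iso L K.
Proof. by case=> *; exact: SchwartzIso. Qed.

Lemma iso_schwartz K L phi : schwartz_iso K L -> Schwartz phi -> Schwartz (K phi).
Proof. by case=> -[h _] *; exact: h. Qed.

Lemma transposable_comp K L : (forall phi, Schwartz phi -> Schwartz (L phi)) ->
  transposable K -> transposable L -> transposable (K \o L).
Proof.
move=> sL [K' K1 K2] [L' L1 L2]; exists (L' \o K') => [f sf|f phi sf sp] /=.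
  exact/L1/K1.
by rewrite K2 //; [rewrite L2 //; exact: K1|exact: sL].
Qed.

Lemma iso_comp K1 L1 K2 L2 : schwartz_iso K1 L1 -> schwartz_iso K2 L2 ->
  schwartz_iso (K1 \o K2) (L2 \o L1).
Proof.
move=> i1 i2; have s1 phi := @iso_schwartz _ _ phi i1; have s2 phi := @iso_schwartz _ _ phi i2.
have t1 phi := @iso_schwartz _ _ phi (iso_sym i1); have t2 phi := @iso_schwartz _ _ phi (iso_sym i2).
case: i1 => a1 a2 a3 a4 a5 a6 a7 a8; case: i2 => b1 b2 b3 b4 b5 b6 b7 b8; split.
- exact: op_continuous_comp.
- exact: op_continuous_comp.
- exact: op_linear_comp.
- exact: op_linear_comp.
- by move=> phi sp /=; rewrite b5 ?a5 //; exact: t1.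
- by move=> phi sp /=; rewrite a6 ?b6 //; exact: s2.
- exact: transposable_comp.
- exact: transposable_comp.
Qed.

Lemma iso_ext K L K' L' : (forall phi, Schwartz phi -> K phi = K' phi) ->
  (forall phi, Schwartz phi -> L phi = L' phi) -> schwartz_iso K L -> schwartz_iso K' L'.
Proof.
move=> EK EL i; have s phi := @iso_schwartz _ _ phi i.
have t phi := @iso_schwartz _ _ phi (iso_sym i).
case: i => a1 a2 a3 a4 a5 a6 [Kt a7 a7'] [Lt a8 a8']; split.
- exact: op_continuous_ext EK a1.
- exact: op_continuous_ext EL a2.
- by move=> c phi psi sp ss; rewrite -!EK //; [exact: a3|exact: schwartz_lin].
- by move=> c phi psi sp ss; rewrite -!EL //; [exact: a4|exact: schwartz_lin].
- by move=> phi sp; rewrite -EL // -EK ?a5 //; exact: t.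
- by move=> phi sp; rewrite -EK // -EL ?a6 //; exact: s.
- by exists Kt => // f phi sf sp; rewrite -EK // a7'.
- by exists Lt => // f phi sf sp; rewrite -EL // a8'.
Qed.

(* If the transpose of an isomorphism is an isomorphism, its inverse is the
   transpose of the inverse. *)
Lemma transposable_inv K L K' L' :
  (forall phi, Schwartz phi -> Schwartz (L phi)) ->
  (forall phi, Schwartz phi -> Schwartz (L' phi)) ->
  (forall phi, Schwartz phi -> K (L phi) = phi) ->
  (forall phi, Schwartz phi -> K' (L' phi) = phi) ->
  (forall f phi, Schwartz f -> Schwartz phi -> pairing f (K phi) = pairing (K' f) phi) ->
  transposable L.
Proof.
move=> sL sL' KL KL' tr; exists L' => // f phi sf sp.
rewrite -[in LHS](KL' f) // -tr ?KL //; [exact: sL'|exact: sL].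
Qed.

Lemma in_schwartz_comp K L u : schwartz_iso K L ->
  in_schwartz u -> in_schwartz (fun phi => u (K phi)).
Proof.
move=> i [f]; rewrite -SchwartzE => sf uf.
have s phi := @iso_schwartz _ _ phi i.
case: i => _ _ _ _ _ _ [K' K1 K2] _.
exists (K' f); first by rewrite -SchwartzE; exact: K1.
move=> phi; rewrite -SchwartzE => sp.
by rewrite uf -?SchwartzE; [exact: K2|exact: s].
Qed.

Lemma in_schwartz_deq u v : deq u v -> in_schwartz u -> in_schwartz v.
Proof. by move=> uv [f sf uf]; exists f => // phi sp; rewrite -uv // uf. Qed.

Lemma in_schwartz_iso K L u : schwartz_iso K L ->
  in_schwartz (fun phi => u (K phi)) -> in_schwartz u.
Proof.
move=> i h; have := in_schwartz_comp (iso_sym i) h.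
apply: in_schwartz_deq => phi; rewrite -SchwartzE => sp.
by rewrite (iso_invK i).
Qed.

Definition swapf phi : R * R -> R[i] := fun z => phi (z.2, z.1).

Lemma swapf_lin_change : swapf = lin_change 0 1 1 0.
Proof.
apply/funext => phi; apply/funext => z.
by rewrite /swapf /lin_change !mul0r !mul1r add0r addr0.
Qed.

Lemma op_continuous_swapf : op_continuous swapf.
Proof.
rewrite swapf_lin_change; apply: (@op_continuous_lin_change _ _ _ _ _ 0 1 1 0) => x y; ring.
Qed.

Lemma schwartz_swapf phi : Schwartz phi -> Schwartz (swapf phi).
Proof. by case: op_continuous_swapf => h _; exact: h. Qed.

Lemma swapf_transpose f phi : Schwartz f -> Schwartz phi ->
  pairing f (swapf phi) = pairing (swapf f) phi.
Proof.
move=> sf sp; rewrite /pairing.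
have [-> _] := fubini_decay (decay2_mul sf (schwartz_swapf sp)).
by have [_ ->] := fubini_decay (decay2_mul (schwartz_swapf sf) sp).
Qed.

Lemma iso_swapf : schwartz_iso swapf swapf.
Proof.
have K phi : swapf (swapf phi) = phi by apply/funext => -[].
have t : transposable swapf.
  by exists swapf; [exact: schwartz_swapf|exact: swapf_transpose].
by split => //; exact: op_continuous_swapf.
Qed.

(** Multiplication formula: for each fixed x the two sides are the two iterated integrals of [h]. *)
Lemma pfourier_transpose f phi : Schwartz f -> Schwartz phi ->
  pairing f (pfourier phi) = pairing (pfourier f) phi.
Proof.
move=> sf sp; rewrite /pairing.
have df := schwartz_decay sf; have dp := schwartz_decay sp.
have [-> _] := fubini_decay (decay2_mul sf (schwartz_pfourier sp)).
have [-> _] := fubini_decay (decay2_mul (schwartz_pfourier sf) sp).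
apply: eq_integral1 => x.
pose h (z : R * R) := expi (- (z.2 * z.1)) * (f (x, z.1) * phi (x, z.2)).
have dh : decay2 h.
  have [cf [A hA]] := df; have [cp [B hB]] := dp.
  apply: (decay2M (K := 1)).
  - split.
      apply: ccontinuousM.
        by apply: (ccontinuous_comp _ cf) => z; exact: (cvg_pair (cvg_cst x) cvg_fst).
      by apply: (ccontinuous_comp _ cp) => z; exact: (cvg_pair (cvg_cst x) cvg_snd).
    exists (A * bump x * (B * bump x)) => z; rewrite cabsM.
    apply: (le_trans (ler_pM (cabs_ge0 _) (cabs_ge0 _) (hA _) (hB _))) => /=.
    by rewrite le_eqVlt; apply/orP; left; apply/eqP; ring.
  - apply: ccontinuous_expi => z; apply: cvgN; apply: cvgM; first exact: cvg_snd.
    exact: cvg_fst.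
  - by move=> t; rewrite cabs_expi.
have [F1 F2] := fubini_decay dh.
transitivity (integral2 h); [rewrite F1|rewrite F2]; apply: eq_integral1 => y.
- rewrite pfourierE -integral1Z; last exact: pfourier_decay.
  by apply: eq_integral1 => t; rewrite /h /=; ring.
- rewrite pfourierE mulrC -integral1Z; last exact: pfourier_decay.
  by apply: eq_integral1 => t; rewrite /h /= [y * t]mulrC; ring.
Qed.

Definition pfourier_inv phi : R * R -> R[i] :=
  fun z => ((2 * pi)^-1)%:C * pfourier phi (z.1, - z.2).

Lemma pfourier_invE : pfourier_inv =
  (fun phi => ((2 * pi)^-1)%:C *: (lin_change 1 0 0 (-1) \o pfourier) phi).
Proof.
apply/funext => phi; apply/funext => z; rewrite /pfourier_inv /= /lin_change !fctE /=.
by rewrite mul1r !mul0r addr0 add0r mulN1r.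
Qed.

Lemma op_continuous_pfourier_inv : op_continuous pfourier_inv.
Proof.
rewrite pfourier_invE; apply/op_continuousZ/op_continuous_comp; last first.
  exact: op_continuous_pfourier.
by apply: (@op_continuous_lin_change _ _ _ _ _ 1 0 0 (-1)) => x y; ring.
Qed.

Lemma schwartz_pfourier_inv phi : Schwartz phi -> Schwartz (pfourier_inv phi).
Proof. by case: op_continuous_pfourier_inv => h _; exact: h. Qed.

Lemma pfourier_invK phi : Schwartz phi -> pfourier_inv (pfourier phi) = phi.
Proof.
move=> sp; apply/funext => -[x y]; rewrite /pfourier_inv /= pfourier_inversion //.
by rewrite opprK mulrA -rmorphM /= mulVf ?mul1r // gt_eqF // mulr_gt0 // pi_gt0.
Qed.

(** By inversion [pfourier_inv] is a multiple of the third power of [pfourier]. It therefore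
    commutes with [pfourier], and the left inverse is a right inverse too. *)
Lemma pfourierK phi : Schwartz phi -> pfourier (pfourier_inv phi) = phi.
Proof.
move=> sp; have sf := schwartz_pfourier sp.
pose c : R[i] := ((2 * pi)^-1 ^+ 2)%:C.
have E psi : Schwartz psi -> pfourier_inv psi = c *: pfourier (pfourier (pfourier psi)).
  move=> ss; apply/funext => -[x y]; rewrite !fctE pfourier_inversion; last exact: schwartz_pfourier.
  rewrite -[_ *: _]/(_ * _) mulrA -rmorphM /= /pfourier_inv /=; congr (_%:C * _).
  by rewrite expr2 -mulrA mulVf ?mulr1 // gt_eqF // mulr_gt0 // pi_gt0.
rewrite E // (op_linear_scale _ pfourier_lin); last by do 3 apply: schwartz_pfourier.
by rewrite -E // pfourier_invK.
Qed.

Lemma pfourier_inv_lin : op_linear pfourier_inv.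
Proof.
move=> c phi psi sp ss; apply/funext => z.
rewrite /pfourier_inv pfourier_lin // !fctE -![c *: _]/(c * _); ring.
Qed.

Lemma iso_pfourier : schwartz_iso pfourier pfourier_inv.
Proof.
split.
- exact: op_continuous_pfourier.
- exact: op_continuous_pfourier_inv.
- exact: pfourier_lin.
- exact: pfourier_inv_lin.
- exact: pfourierK.
- exact: pfourier_invK.
- by exists pfourier; [exact: schwartz_pfourier|exact: pfourier_transpose].
- apply: (@transposable_inv pfourier _ pfourier pfourier_inv).
  + exact: schwartz_pfourier_inv.
  + exact: schwartz_pfourier_inv.
  + exact: pfourierK.
  + exact: pfourierK.
  + exact: pfourier_transpose.
Qed.

Lemma iso_mulop g h : SlowlyIncreasing g -> SlowlyIncreasing h ->
  (forall z, g z * h z = 1) -> schwartz_iso (mulop g) (mulop h).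
Proof.
move=> sg sh gh.
have tr k : SlowlyIncreasing k -> transposable (mulop k).
  move=> sk; exists (mulop k) => [f|f phi _ _]; first exact: schwartz_mulop.
  by rewrite /pairing /mulop; congr integral2; apply/funext => z; ring.
split.
- exact: op_continuous_mulop.
- exact: op_continuous_mulop.
- exact: mulop_lin.
- exact: mulop_lin.
- by move=> phi _; apply/funext => z; rewrite /mulop mulrA gh mul1r.
- by move=> phi _; apply/funext => z; rewrite /mulop mulrA [h z * _]mulrC gh mul1r.
- exact: tr.
- exact: tr.
Qed.

Definition midpoint phi : R * R -> R[i] := fun z => phi ((z.1 + z.2) / 2, z.1 - z.2).
Definition midpoint_inv phi : R * R -> R[i] :=
  fun z => phi (z.1 + z.2 / 2, z.1 - z.2 / 2).

Lemma midpointE : midpoint = lin_change 2^-1 2^-1 1 (-1).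
Proof.
apply/funext => phi; apply/funext => z.
by rewrite /midpoint /lin_change; congr phi; congr pair; ring.
Qed.

Lemma midpoint_invE : midpoint_inv = lin_change 1 2^-1 1 (- 2^-1).
Proof.
apply/funext => phi; apply/funext => z.
by rewrite /midpoint_inv /lin_change; congr phi; congr pair; ring.
Qed.

Lemma op_continuous_midpoint : op_continuous midpoint.
Proof.
by rewrite midpointE; apply: (@op_continuous_lin_change _ _ _ _ _ 1 2^-1 1 (- 2^-1)) => x y; field.
Qed.

Lemma op_continuous_midpoint_inv : op_continuous midpoint_inv.
Proof.
by rewrite midpoint_invE; apply: (@op_continuous_lin_change _ _ _ _ _ 2^-1 2^-1 1 (-1)) => x y; field.
Qed.

(* Both sides equal the integral of f (y + t, y) phi (y + t / 2, t). *)
Lemma midpoint_transpose f phi : Schwartz f -> Schwartz phi ->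
  pairing f (midpoint phi) = pairing (midpoint_inv f) phi.
Proof.
move=> sf sp.
have [sM _] := op_continuous_midpoint; have [sI _] := op_continuous_midpoint_inv.
have [c1 _] : op_continuous (lin_change (1 : R) 1 1 0).
  by apply: (@op_continuous_lin_change _ _ _ _ _ 0 1 1 (-1)) => x y; ring.
have [c2 _] : op_continuous (lin_change (1 : R) 2^-1 0 1).
  by apply: (@op_continuous_lin_change _ _ _ _ _ 1 (- 2^-1) 0 1) => x y; ring.
have d1 := decay2_mul sf (sM _ sp).
have d2 := decay2_mul (sI _ sf) sp.
have d3 := decay2_mul (c1 _ sf) (c2 _ sp).
have [F1 F2] := fubini_decay d3.
rewrite /pairing; have [_ ->] := fubini_decay d1; have [_ ->] := fubini_decay d2.
transitivity (integral2 (fun z => lin_change 1 1 1 0 f z * lin_change 1 2^-1 0 1 phi z)).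
- rewrite F1; apply: eq_integral1 => y.
  have [cc _] := decay2_slice2 y d1.
  rewrite -(integral1_translation y cc); apply: eq_integral1 => t.
  rewrite /midpoint /lin_change /=.
  by congr (f (_, _) * phi (_, _)); field.
- rewrite F2; apply: eq_integral1 => t.
  have [cc _] := decay2_slice2 t d3.
  rewrite -(integral1_translation (- (t / 2)) cc); apply: eq_integral1 => x.
  rewrite /midpoint_inv /lin_change /=.
  by congr (f (_, _) * phi (_, _)); field.
Qed.

Lemma iso_midpoint : schwartz_iso midpoint midpoint_inv.
Proof.
have [sM _] := op_continuous_midpoint; have [sI _] := op_continuous_midpoint_inv.
split=> //.
- exact: op_continuous_midpoint.
- exact: op_continuous_midpoint_inv.
- by move=> phi _; apply/funext => -[x y]; rewrite /midpoint /midpoint_inv /=;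
    congr phi; congr pair; field.
- by move=> phi _; apply/funext => -[x y]; rewrite /midpoint /midpoint_inv /=;
    congr phi; congr pair; field.
- by exists midpoint_inv => //; exact: midpoint_transpose.
- exists midpoint => // f phi sf sp.
  by rewrite pairingC -midpoint_transpose // pairingC.
Qed.

End Isomorphisms.

(** * Operator substitution *)

Section OperatorSubstitution.
Context {R : realType}.
Implicit Types (V W : lmodType R[i]).

(** Only a partial equivalence: its diagonal [E u u] delimits the vectors on which commutation
    relations are available. [per_zero] is the one instance of reflexivity required, as the base of
    sums. *)
Record linear_per V (E : V -> V -> Prop) : Prop := LinearPer {
  per_sym : forall u v, E u v -> E v u;
  per_trans : forall u v w, E u v -> E v w -> E u w;
  per_add : forall u u' v v', E u u' -> E v v' -> E (u + v) (u' + v');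
  per_scale : forall (c : R[i]) u v, E u v -> E (c *: u) (c *: v);
  per_zero : E 0 0 }.

Definition lin V W (A : V -> W) : Prop :=
  forall (c : R[i]) u v, A (c *: u + v) = c *: A u + A v.

Definition respects V W (E : V -> V -> Prop) (E' : W -> W -> Prop) (A : V -> W) : Prop :=
  forall u v, E u v -> E' (A u) (A v).

Lemma lin0 V W (A : V -> W) : lin A -> A 0 = 0.
Proof.
move=> lA; have := lA (-1) 0 0.
by rewrite scaler0 addr0 scaleN1r addrC subrr.
Qed.

Lemma linD V W (A : V -> W) u v : lin A -> A (u + v) = A u + A v.
Proof. by move=> lA; have := lA 1 u v; rewrite !scale1r. Qed.

Lemma linBZ V W (A : V -> W) c u v : lin A -> A (u - c *: v) = A u - c *: A v.
Proof.
by move=> lA; have := lA (- c) v u; rewrite !scaleNr [- _ + u]addrC [- _ + A u]addrC.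
Qed.

Lemma lin_iter V (A : V -> V) n : lin A -> lin (iter n A).
Proof. by move=> lA; elim: n => // n IH c u v; rewrite !iterS IH lA. Qed.

Lemma lin_comp V W (U : lmodType R[i]) (A : W -> U) (B : V -> W) : lin A -> lin B -> lin (A \o B).
Proof. by move=> lA lB c u v; rewrite /= lB lA. Qed.

Section PerFacts.
Variables (V : lmodType R[i]) (E : V -> V -> Prop).
Hypothesis perE : linear_per E.

Lemma per_opp u v : E u v -> E (- u) (- v).
Proof. by move=> uv; have := per_scale perE (-1) uv; rewrite !scaleN1r. Qed.

Lemma per_sub u u' v v' : E u u' -> E v v' -> E (u - v) (u' - v').
Proof. by move=> h h'; apply: per_add => //; exact: per_opp. Qed.

Lemma per_sum I (s : seq I) (F G : I -> V) : (forall i, E (F i) (G i)) ->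
  E (\sum_(i <- s) F i) (\sum_(i <- s) G i).
Proof.
move=> h; elim: s => [|i s IH]; first by rewrite !big_nil; exact: per_zero.
by rewrite !big_cons; exact: per_add.
Qed.

Lemma respects_iter (A : V -> V) n : respects E E A -> respects E E (iter n A).
Proof. by move=> rA u v uv; elim: n => //= n; exact: rA. Qed.

End PerFacts.

Definition opmonomial V n (X : 'I_n -> V -> V) (m : multinom n) (v : V) : V :=
  foldr (fun k w => iter (m k) (X k) w) v (enum 'I_n).

(** The support varies with [p]. Summing over all monomials below a common degree gives several
    polynomials the same index set, which linearity in [p] requires. *)
Lemma opsubstE V n k (p : mpoly n R[i]) (X : 'I_n -> V -> V) v : (msize p <= k)%N ->
  opsubst p X v = \sum_(m : bmultinom n k) mcoeff m p *: opmonomial X m v.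
Proof.
move=> pk; rewrite /opsubst (ssrcomplements.big_mksub (bmultinom n k)) ?msupp_uniq //=; last first.
  by move=> x /msize_mdeg_lt /leq_trans; apply.
rewrite big_rmcond //= => m /memN_msupp_eq0 ->.
by rewrite scale0r.
Qed.

Lemma opsubst_lin V n (X : 'I_n -> V -> V) v :
  lin (fun p : mpoly n R[i] => opsubst p X v).
Proof.
move=> c p q.
pose k := maxn (msize (c *: p + q)) (maxn (msize p) (msize q)).
rewrite !(@opsubstE _ _ k); try by rewrite /k !leq_max leqnn ?orbT.
rewrite scaler_sumr -big_split; apply: eq_bigr => m _ /=.
by rewrite mcoeffD mcoeffZ scalerDl scalerA.
Qed.

Lemma opsubstX V n (X : 'I_n -> V -> V) (m : multinom n) v :
  opsubst (mpolyX R[i] m) X v = opmonomial X m v.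
Proof. by rewrite /opsubst msuppX big_seq1 mcoeffX eqxx scale1r. Qed.

Section Intertwining.
Variables (V W : lmodType R[i]) (E : V -> V -> Prop) (E' : W -> W -> Prop).
Hypotheses (perE : linear_per E) (perE' : linear_per E').
Variables (n : nat) (X : 'I_n -> V -> V) (Y : 'I_n -> W -> W) (A : V -> W).
Hypothesis (rX : forall k, respects E E (X k)) (rY : forall k, respects E' E' (Y k)).
Hypothesis (linA : lin A) (rA : respects E E' A).
Hypothesis XY : forall k u, E u u -> E' (A (X k u)) (Y k (A u)).

Lemma opmonomial_respects m : respects E E (opmonomial X m).
Proof.
move=> u v uv; rewrite /opmonomial; elim: (enum _) => //= k s.
exact: respects_iter.
Qed.

Lemma opsubst_respects p : respects E E (opsubst p X).
Proof.
move=> u v uv; apply: per_sum => // m; apply: per_scale => //.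
exact: opmonomial_respects.
Qed.

Lemma iter_intertwine k i u : E u u -> E' (A (iter i (X k) u)) (iter i (Y k) (A u)).
Proof.
move=> uu; elim: i => [|i IH] /=; first exact: rA.
apply: (per_trans perE' (XY k _)); first exact: respects_iter.
exact: rY.
Qed.

Lemma opmonomial_intertwine m u : E u u ->
  E' (A (opmonomial X m u)) (opmonomial Y m (A u)).
Proof.
move=> uu; rewrite /opmonomial; elim: (enum _) => [|k s IH] /=; first exact: rA.
apply: (per_trans perE' (iter_intertwine _ _ _)); last exact: respects_iter.
elim: s {IH} => //= l s IH; exact: respects_iter.
Qed.

(** Both sides order the factors alike, so the relations on generators propagate factor by factor
    without commuting any of them. *)
Lemma opsubst_intertwine p u : E u u -> E' (A (opsubst p X u)) (opsubst p Y (A u)).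
Proof.
move=> uu; rewrite /opsubst.
have -> : A (\sum_(m <- msupp p) mcoeff m p *: opmonomial X m u) =
    \sum_(m <- msupp p) mcoeff m p *: A (opmonomial X m u).
  elim: (msupp p) => [|m s IH]; first by rewrite !big_nil lin0.
  by rewrite !big_cons linA IH.
apply: per_sum => // m; apply: per_scale => //; exact: opmonomial_intertwine.
Qed.

End Intertwining.

Lemma enum_ord4 : enum 'I_4 = [:: inord 0; inord 1; inord 2; inord 3].
Proof.
by apply: (inj_map val_inj); rewrite val_enum_ord /= !inordK.
Qed.

Section WeylRelations.
Variables (V : lmodType R[i]) (E : V -> V -> Prop) (perE : linear_per E).
Variables X1 X2 Y1 Y2 : V -> V.
Hypotheses (lX1 : lin X1) (lX2 : lin X2) (lY1 : lin Y1) (lY2 : lin Y2).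
Hypotheses (rX1 : respects E E X1) (rX2 : respects E E X2)
  (rY1 : respects E E Y1) (rY2 : respects E E Y2).
Hypothesis X21 : forall u, E u u -> E (X2 (X1 u)) (X1 (X2 u)).
Hypothesis Y21 : forall u, E u u -> E (Y2 (Y1 u)) (Y1 (Y2 u)).
Hypothesis Y1X2 : forall u, E u u -> E (Y1 (X2 u)) (X2 (Y1 u)).
Hypothesis Y2X1 : forall u, E u u -> E (Y2 (X1 u)) (X1 (Y2 u)).
Hypothesis Y1X1 : forall u, E u u -> E (Y1 (X1 u)) (X1 (Y1 u) - 'i *: u).
Hypothesis Y2X2 : forall u, E u u -> E (Y2 (X2 u)) (X2 (Y2 u) - 'i *: u).

Lemma comm_iter (A B : V -> V) n u : respects E E A -> respects E E B ->
  (forall u, E u u -> E (B (A u)) (A (B u))) ->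
  E u u -> E (B (iter n A u)) (iter n A (B u)).
Proof.
move=> rA rB AB uu; elim: n => [|n IH] /=; first exact: rB.
apply: (per_trans perE (AB _ _)); first exact: respects_iter.
exact: rA.
Qed.

(** Iterating [B, A] = -i gives [B, A^n] = -i n A^(n-1); at n = 0 the truncated predecessor is
    harmless because of the factor n. *)
Lemma comm_iter_derive (A B : V -> V) n u : lin A -> respects E E A -> respects E E B ->
  (forall u, E u u -> E (B (A u)) (A (B u) - 'i *: u)) ->
  E u u -> E (B (iter n A u)) (iter n A (B u) - ('i * n%:R) *: iter n.-1 A u).
Proof.
move=> lA rA rB AB uu; elim: n => [|n IH] /=.
  by rewrite mulr0 scale0r subr0; exact: rB.
have rn := respects_iter n rA uu.
apply: (per_trans perE (AB _ rn)).
have -> : A (iter n A (B u)) - ('i * n.+1%:R) *: iter n A u =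
    A (iter n A (B u) - ('i * n%:R) *: iter n.-1 A u) - 'i *: iter n A u.
  rewrite linBZ // -addrA -opprD; congr (_ - _).
  have -> : ('i * n%:R) *: A (iter n.-1 A u) = ('i * n%:R) *: iter n A u.
    by case: n {IH rn} => [|n] //=; rewrite mulr0 !scale0r.
  by rewrite -scalerDl -natr1 mulrDr mulr1.
by apply: per_sub => //; [exact: rA|exact: per_scale].
Qed.

Local Notation X := (ops4 X1 X2 Y1 Y2).

Lemma respects_ops4 k : respects E E (X k).
Proof. by case: k => [[|[|[|[|//]]]] i]; rewrite /ops4 /=. Qed.

Lemma opmonomial4 (m : multinom 4) u : opmonomial X m u =
  iter (m (inord 0)) X1 (iter (m (inord 1)) X2
    (iter (m (inord 2)) Y1 (iter (m (inord 3)) Y2 u))).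
Proof. by rewrite /opmonomial enum_ord4 /= /ops4 !inordK. Qed.

Lemma inord4_eq i j : (i < 4)%N -> (j < 4)%N -> ((inord i : 'I_4) == inord j) = (i == j).
Proof. by move=> i4 j4; rewrite -val_eqE /= !inordK. Qed.

Lemma opsubst_respects4 p u : E u u -> E (opsubst p X u) (opsubst p X u).
Proof. by move=> uu; apply: opsubst_respects => //; exact: respects_ops4. Qed.

Lemma extend_from_monomials (A B : mpoly 4 R[i] -> V) : lin A -> lin B ->
  (forall m, E (A (mpolyX R[i] m)) (B (mpolyX R[i] m))) -> forall b, E (A b) (B b).
Proof.
move=> lA lB AB; elim/mpolyind => [|c m p _ _ IH].
  by rewrite !lin0 //; exact: per_zero.
by rewrite lA lB; apply: per_add => //; exact: per_scale.
Qed.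

Lemma lin_LM j : lin (@LM R j).
Proof. by move=> c p q; rewrite /LM mulrDr scalerAr. Qed.

Lemma lin_LD j : lin (@LD R j).
Proof.
move=> c p q; rewrite /LD mulrDr mderivD mderivZ scalerDr opprD -!scalerAr.
by rewrite scalerBr !scalerA [c * _]mulrC addrACA.
Qed.

Lemma varXM k (m : multinom 4) :
  varX k * mpolyX R[i] m = mpolyX R[i] (mnm_add (mnm1 (inord k)) m).
Proof. by rewrite /varX mpolyXD. Qed.

(** Substitution writes monomials in the order X1, X2, Y1, Y2. A new factor on the left is brought
    to its place by the commutation relations; for X1 it is there already. *)
Lemma opsubst_LM0 b u : E u u -> E (opsubst (LM 0 b) X u) (X1 (opsubst b X u)).
Proof.
move=> uu; apply: (@extend_from_monomials (fun b => opsubst (LM 0 b) X u)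
  (fun b => X1 (opsubst b X u))) b.
- exact: lin_comp (opsubst_lin _ _) (lin_LM 0).
- exact: lin_comp lX1 (opsubst_lin _ _).
move=> m; rewrite /LM varXM !opsubstX !opmonomial4 !mnmDE !mnm1E !inord4_eq //= !add0n.
apply: rX1; do 3 (apply: respects_iter => //).
exact: respects_iter.
Qed.

Lemma opsubst_LM1 b u : E u u -> E (opsubst (LM 1 b) X u) (X2 (opsubst b X u)).
Proof.
move=> uu; apply: (@extend_from_monomials (fun b => opsubst (LM 1 b) X u)
  (fun b => X2 (opsubst b X u))) b.
- exact: lin_comp (opsubst_lin _ _) (lin_LM 1).
- exact: lin_comp lX2 (opsubst_lin _ _).
move=> m; rewrite /LM varXM !opsubstX !opmonomial4 !mnmDE !mnm1E !inord4_eq //= !add0n.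
apply: (per_sym perE); apply: comm_iter => //.
by do 3 (apply: respects_iter => //).
Qed.

(** Carrying Y1 past X1^k leaves the extra term -i k X1^(k-1), which is the derivative term in the
    definition of [LD]. *)
Lemma opsubst_LD0 b u : E u u -> E (opsubst (LD 0 b) X u) (Y1 (opsubst b X u)).
Proof.
move=> uu; apply: (@extend_from_monomials (fun b => opsubst (LD 0 b) X u)
  (fun b => Y1 (opsubst b X u))) b.
- exact: lin_comp (opsubst_lin _ _) (lin_LD 0).
- exact: lin_comp lY1 (opsubst_lin _ _).
move=> m; rewrite /LD varXM mderivX scalerA.
have lo := opsubst_lin X u.
rewrite addrC -scaleNr lo !opsubstX !opmonomial4 !mnmDE !mnmBE !mnm1E !inord4_eq //=.
rewrite !add0n !subn0 subn1 scaleNr addrC.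
set w := iter (m (inord 2)) Y1 _.
have ww : E w w by do 2 (apply: respects_iter => //).
have w2 : E (iter (m (inord 1)) X2 w) (iter (m (inord 1)) X2 w) by apply: respects_iter.
apply: (per_sym perE).
apply: (per_trans perE (comm_iter_derive _ lX1 rX1 rY1 Y1X1 w2)).
apply: per_sub => //.
  by apply: respects_iter => //; exact: comm_iter.
by apply: per_scale => //; apply: respects_iter.
Qed.

Lemma opsubst_LD1 b u : E u u -> E (opsubst (LD 1 b) X u) (Y2 (opsubst b X u)).
Proof.
move=> uu; apply: (@extend_from_monomials (fun b => opsubst (LD 1 b) X u)
  (fun b => Y2 (opsubst b X u))) b.
- exact: lin_comp (opsubst_lin _ _) (lin_LD 1).
- exact: lin_comp lY2 (opsubst_lin _ _).
move=> m; rewrite /LD varXM mderivX scalerA.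
have lo := opsubst_lin X u.
rewrite addrC -scaleNr lo !opsubstX !opmonomial4 !mnmDE !mnmBE !mnm1E !inord4_eq //=.
rewrite !add0n !subn0 subn1 scaleNr addrC.
set w := iter (m (inord 3)) Y2 u.
have ww : E w w by apply: respects_iter.
set w1 := iter (m (inord 2)) Y1 w.
have w11 : E w1 w1 by apply: respects_iter.
have w2 : E (iter (m (inord 1)) X2 w1) (iter (m (inord 1)) X2 w1) by apply: respects_iter.
apply: (per_sym perE).
apply: (per_trans perE (comm_iter _ rX1 rY2 Y2X1 w2)).
apply: (per_trans perE (respects_iter _ rX1 (comm_iter_derive _ lX2 rX2 rY2 Y2X2 w11))).
have -> : iter (m (inord 0)) X1 (iter (m (inord 1)) X2 (Y2 w1) -
    ('i * (m (inord 1))%:R) *: iter (m (inord 1)).-1 X2 w1) =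
  iter (m (inord 0)) X1 (iter (m (inord 1)) X2 (Y2 w1)) -
    ('i * (m (inord 1))%:R) *: iter (m (inord 0)) X1 (iter (m (inord 1)).-1 X2 w1).
  by rewrite addrC -scaleNr (lin_iter _ lX1) scaleNr addrC.
apply: per_sub => //.
  by do 2 (apply: respects_iter => //); exact: comm_iter.
by apply: per_scale => //; do 2 (apply: respects_iter => //).
Qed.

(** For fixed [u], the map sending [b] to [opsubst b X u] intertwines the left multiplications on
    coefficients with the operators themselves. [opsubst_intertwine], with equality of polynomials
    as source relation, extends this from the generators to [c]. *)
Lemma opsubst_pdo_comp c b u : E u u ->
  E (opsubst (pdo_comp c b) X u) (opsubst c X (opsubst b X u)).
Proof.
move=> uu; pose W : lmodType R[i] := mpoly 4 R[i].
pose L : 'I_4 -> W -> W := ops4 (@LM R 0) (@LM R 1) (@LD R 0) (@LD R 1).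
apply: (@opsubst_intertwine W V (@eq W) E perE 4 L X
  (fun b => opsubst b X u) _ respects_ops4 (opsubst_lin _ _) _ _ c b erefl).
- by move=> k p q ->.
- by move=> p q ->; exact: opsubst_respects4.
- case=> [[|[|[|[|//]]]] i] p _; rewrite /L /ops4 /=.
  + exact: opsubst_LM0.
  + exact: opsubst_LM1.
  + exact: opsubst_LD0.
  + exact: opsubst_LD1.
Qed.

Lemma respects_add (A B : V -> V) : respects E E A -> respects E E B ->
  respects E E (fun v => A v + B v).
Proof. by move=> rA rB u v uv; apply: per_add => //; [exact: rA|exact: rB]. Qed.

Lemma respects_sub (A B : V -> V) : respects E E A -> respects E E B ->
  respects E E (fun v => A v - B v).
Proof. by move=> rA rB u v uv; apply: per_sub => //; [exact: rA|exact: rB]. Qed.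

(** The same intertwining as for [pdo_comp], started at the polynomial 1, which acts as the
    identity. *)
Lemma opsubst_pdo_A q u : E u u ->
  E (opsubst (pdo_A q) X u)
    (opsubst q (ops2 (fun v => Y1 v + Y2 v) (fun v => X2 v - X1 v)) u).
Proof.
move=> uu; have e1 : opsubst (1 : mpoly 4 R[i]) X u = u.
  rewrite -mpolyX0 opsubstX opmonomial4 !mnm0E //.
rewrite -[in X in E _ X]e1.
pose W : lmodType R[i] := mpoly 4 R[i].
pose L : 'I_2 -> W -> W := ops2 (fun b => LD 0 b + LD 1 b) (fun b => LM 1 b - LM 0 b).
pose Y := ops2 (fun v => Y1 v + Y2 v) (fun v => X2 v - X1 v).
have rY k : respects E E (Y k).
  by case: k => [[|[|//]] i]; rewrite /Y /ops2 /=; [exact: respects_add|exact: respects_sub].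
have lo := opsubst_lin X u.
apply: (@opsubst_intertwine W V (@eq W) E perE 2 L Y
  (fun b => opsubst b X u) _ rY (opsubst_lin _ _) _ _ q 1 erefl).
- by move=> k p r ->.
- by move=> p r ->; exact: opsubst_respects4.
- case=> [[|[|//]] i] p _; rewrite /L /Y /ops2 /=.
  + rewrite (linD _ _ lo); apply: per_add => //; [exact: opsubst_LD0|exact: opsubst_LD1].
  + have := linBZ 1 (LM 1 p) (LM 0 p) lo; rewrite !scale1r => ->.
    apply: per_sub => //; [exact: opsubst_LM1|exact: opsubst_LM0].
Qed.

End WeylRelations.

End OperatorSubstitution.

(** * The Lojasiewicz inequality *)

Section EventualSigns.
Context {R : rcfType}.
Implicit Types (s m : R) (G : {poly {poly R}}).

(* Constancy on the cusp [0 < m <= s ^- N, s0 <= s]. *)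
Definition ultimately_constant (T : Type) (f : R -> R -> T) : Prop :=
  exists c s0 N, [/\ 1 <= s0 & forall s m, s0 <= s -> 0 < m -> m * s ^+ N <= 1 -> f s m = c].

(** Raising the exponent shrinks the cusp, so finitely many cusps contain a common one. *)
Lemma cusp_le s m N N' : 1 <= s -> 0 < m -> (N <= N')%N -> m * s ^+ N' <= 1 ->
  m * s ^+ N <= 1.
Proof.
move=> s1 m0 NN'; apply: le_trans; rewrite ler_pM2l //.
exact: ler_weXn2l.
Qed.

Lemma ultimately_constant2 T1 T2 T (h : T1 -> T2 -> T) f1 f2 :
  ultimately_constant f1 -> ultimately_constant f2 ->
  ultimately_constant (fun s m => h (f1 s m) (f2 s m)).
Proof.
move=> [c1 [s1 [N1 [s11 H1]]]] [c2 [s2 [N2 [s21 H2]]]].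
exists (h c1 c2), (Num.max s1 s2), (N1 + N2)%N; split; first by rewrite le_max s11.
move=> s m; rewrite ge_max => /andP[s1s s2s] m0 ms.
have s_1 : 1 <= s by exact: le_trans s1s.
rewrite H1 ?H2 //; apply: (cusp_le s_1 m0 _ ms); first exact: leq_addl.
exact: leq_addr.
Qed.

Lemma ultimately_constant1 T1 T (h : T1 -> T) f :
  ultimately_constant f -> ultimately_constant (fun s m => h (f s m)).
Proof.
by move=> Uf; have := ultimately_constant2 (fun x _ => h x) Uf Uf.
Qed.

Lemma ultimately_constant_cst T (c : T) : ultimately_constant (fun _ _ => c).
Proof. by exists c, 1, 0%N. Qed.

Lemma poly_ultimate_sign (a : {poly R}) : a != 0 ->
  exists c s0 b, [/\ 0 < c, 1 <= s0 & forall s, s0 <= s -> c <= (-1) ^+ b * a.[s]].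
Proof.
move=> a0.
have [la|la|la0] := ltrgt0P (lead_coef a).
- have [s0 H] := polyrcf.poly_pinfty_gt_lc la.
  exists (lead_coef a), (Num.max 1 s0), 0%N; split=> //; first by rewrite le_max lexx.
  by move=> s; rewrite ge_max mul1r => /andP[_ /H].
- have la' : 0 < lead_coef (- a) by rewrite lead_coefN oppr_gt0.
  have [s0 H] := polyrcf.poly_pinfty_gt_lc la'.
  exists (lead_coef (- a)), (Num.max 1 s0), 1%N; split=> //; first by rewrite le_max lexx.
  by move=> s; rewrite ge_max expr1 mulN1r -hornerN => /andP[_ /H].
- by move/eqP: la0; rewrite lead_coef_eq0 (negbTE a0).
Qed.

Lemma poly_growth (a : {poly R}) : exists C n, 0 <= C /\ forall s, 1 <= s -> `|a.[s]| <= C * s ^+ n.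
Proof.
elim/poly_ind: a => [|a c [C [n [C0 H]]]].
  by exists 0, 0%N; split=> // s _; rewrite horner0 normr0 mul0r.
exists (C + `|c|), n.+1; split; first exact: addr_ge0.
move=> s s1; rewrite hornerMXaddC (le_trans (ler_normD _ _)) // mulrDl lerD //.
  rewrite normrM (ger0_norm (le_trans ler01 s1)) exprSr mulrA ler_wpM2r ?H //.
  exact: le_trans ler01 s1.
by rewrite ler_peMr // exprn_ege1.
Qed.

Lemma poly2_growth G : exists C n, 0 <= C /\
  forall s m, 1 <= s -> 0 < m -> m <= 1 -> `|G.[m%:P].[s]| <= C * s ^+ n.
Proof.
elim/poly_ind: G => [|K a [C [n [C0 H]]]].
  by exists 0, 0%N; split=> // s m _ _ _; rewrite !horner0 normr0 mul0r.
have [C' [n' [C'0 H']]] := poly_growth a.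
exists (C + C'), (n + n')%N; split; first exact: addr_ge0.
move=> s m s1 m0 m1; rewrite hornerMXaddC hornerD hornerM hornerC.
have s0 : 0 <= s by exact: le_trans ler01 s1.
rewrite (le_trans (ler_normD _ _)) // mulrDl lerD //.
  rewrite normrM (ger0_norm (ltW m0)) (le_trans (ler_piMr _ _)) // (le_trans (H _ _ s1 m0 m1)) //.
  by rewrite ler_wpM2l // ler_weXn2l // leq_addr.
by rewrite (le_trans (H' _ s1)) // ler_wpM2l // ler_weXn2l // leq_addl.
Qed.

(** Induction on G = K m + a(s), a polynomial in m over polynomials in s. If a = 0 the sign is that
    of K. Otherwise |a(s)| >= c for large s, while |K m| <= C s^n m <= C / s on the cusp of exponent
    n + 1. *)
Lemma sg_ultimately_constant G : ultimately_constant (fun s m => Num.sg G.[m%:P].[s]).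
Proof.
elim/poly_ind: G => [|K a IH].
  exists 0, 1, 0%N; split=> // s m _ _ _; by rewrite !horner0 sgr0.
have [->|a0] := eqVneq a 0.
  have [c [s0 [N [s01 H]]]] := IH.
  exists c, s0, N; split=> // s m s0s m0 ms.
  by rewrite hornerMXaddC addr0 hornerM hornerC sgrM (gtr0_sg m0) mulr1 H.
have [c [s0 [b [c0 s01 H]]]] := poly_ultimate_sign a0.
have [C [n [C0 HK]]] := poly2_growth K.
(* The added (C + 1) / c guarantees C < c s, so that the term in m cannot change the sign of
   a(s). *)
exists ((-1) ^+ b), (s0 + (C + 1) / c), n.+1.
have cC : 0 < (C + 1) / c by rewrite divr_gt0 // ltr_wpDl.
split; first by rewrite (le_trans s01) // lerDl ltW.
move=> s m ss m0 ms.
have s0s : s0 <= s by apply: le_trans ss; rewrite lerDl ltW.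
have s1 : 1 <= s by exact: le_trans s0s.
have sp : 0 < s by exact: lt_le_trans ltr01 s1.
have m1 : m <= 1 by have := cusp_le s1 m0 (leq0n _) ms; rewrite expr0 mulr1.
have Cs : C < c * s.
  rewrite mulrC -ltr_pdivrMr //; apply: lt_le_trans ss; apply: (@lt_le_trans _ _ ((C + 1) / c)).
    by rewrite ltr_pM2r ?invr_gt0 // ltrDl.
  by rewrite lerDr; exact: le_trans s01.
have Km : `|K.[m%:P].[s] * m| < c.
  rewrite normrM (gtr0_norm m0).
  apply: (@le_lt_trans _ _ (C * s ^+ n * m)); first by rewrite ler_wpM2r ?(ltW m0) ?HK.
  rewrite -(ltr_pM2r sp) (le_lt_trans _ Cs) //.
  rewrite -!mulrA -[leRHS]mulr1 ler_wpM2l //.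
  by move: ms; rewrite exprSr; congr (_ <= _); ring.
rewrite hornerMXaddC hornerD hornerM hornerC.
have {}H := H s s0s.
have : 0 < (-1) ^+ b * (K.[m%:P].[s] * m + a.[s]).
  have : - `|K.[m%:P].[s] * m| <= (-1) ^+ b * (K.[m%:P].[s] * m).
    rewrite lerNl (le_trans (ler_norm _)) // normrN normrM normrX normrN1 expr1n mul1r.
    exact: lexx.
  by rewrite mulrDr; lra.
move/gtr0_sg; rewrite sgrM => /(congr1 ( *%R ((-1) ^+ b))).
rewrite mulr1 mulrA sgrX sgrN1 -exprD addnn -mul2n exprM sqrrN expr1n expr1n mul1r.
by [].
Qed.

Lemma rterm_poly2 (t : GRing.term R) : GRing.rterm t ->
  exists G, forall s m, GRing.eval [:: s; m] t = G.[m%:P].[s].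
Proof.
elim: t => //=.
(* Variables 0 and 1 are s and m; a lookup beyond the environment returns 0. *)
- case=> [|[|n]] _; [exists ('X)%:P | exists 'X | exists 0] => s m /=;
    by rewrite ?hornerE ?nth_nil.
- by move=> r _; exists r%:P%:P => s m; rewrite !hornerC.
- by move=> n _; exists n%:R => s m; rewrite -polyC_natr hornerC hornerMn hornerC.
- move=> t1 IH1 t2 IH2 /andP[/IH1[G1 H1] /IH2[G2 H2]].
  by exists (G1 + G2) => s m; rewrite !hornerD H1 H2.
- by move=> t IH /IH[G H]; exists (- G) => s m; rewrite !hornerN H.
- by move=> t IH n /IH[G H]; exists (G *+ n) => s m; rewrite !hornerMn H.
- move=> t1 IH1 t2 IH2 /andP[/IH1[G1 H1] /IH2[G2 H2]].
  by exists (G1 * G2) => s m; rewrite !hornerM H1 H2.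
- by move=> t IH n /IH[G H]; exists (G ^+ n) => s m; rewrite !horner_exp H.
Qed.

Lemma qf_ultimately_constant (f : ordered_qelim.ord.formula R) :
  ordered_qelim.ord.qf_form f -> ordered_qelim.ord.rformula f ->
  ultimately_constant (fun s m => ordered_qelim.ord.qf_eval [:: s; m] f).
Proof.
(* Each comparison of two terms is a function of the sign of their difference. *)
have sgP t1 t2 (h : R -> bool) (k : R -> R -> bool) : (forall x y, k x y = h (Num.sg (x - y))) ->
  GRing.rterm t1 && GRing.rterm t2 ->
  ultimately_constant (fun s m => k (GRing.eval [:: s; m] t1) (GRing.eval [:: s; m] t2)).
  move=> kh /andP[/rterm_poly2[G1 H1] /rterm_poly2[G2 H2]].
  have [c [s0 [N [s01 H]]]] := ultimately_constant1 h (sg_ultimately_constant (G1 - G2)).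
  exists c, s0, N; split=> // s m s0s m0 ms; rewrite kh H1 H2 -(H s m) //.
  by rewrite hornerD hornerN hornerD hornerN.
elim: f => //=.
- by move=> b _ _; exact: ultimately_constant_cst.
- move=> t1 t2 _; apply: (@sgP t1 t2 (fun x => x == 0) (fun x y => x == y)) => x y.
  by rewrite sgr_eq0 subr_eq0.
- move=> t1 t2 _; apply: (@sgP t1 t2 (fun x => x < 0) (fun x y => x < y)) => x y.
  by rewrite sgr_lt0 subr_lt0.
- move=> t1 t2 _; apply: (@sgP t1 t2 (fun x => x <= 0) (fun x y => x <= y)) => x y.
  by rewrite sgr_le0 subr_le0.
- move=> f1 IH1 f2 IH2 /andP[q1 q2] /andP[r1 r2].
  by apply: ultimately_constant2; [exact: IH1 | exact: IH2].
- move=> f1 IH1 f2 IH2 /andP[q1 q2] /andP[r1 r2].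
  by apply: ultimately_constant2; [exact: IH1 | exact: IH2].
- move=> f1 IH1 f2 IH2 /andP[q1 q2] /andP[r1 r2].
  by apply: (ultimately_constant2 implb); [exact: IH1 | exact: IH2].
- by move=> f IH q r; apply: ultimately_constant1; exact: IH.
Qed.

Definition rcf_proj (i : nat) bc : ordered_qelim.ord.formula R :=
  qe_rcf.qfr_to_formula (qe_rcf.wproj i bc).

(** Quantifier elimination replaces [f] by a quantifier free formula with the same truth value at
    [s; m], to which the sign analysis applies. *)
Lemma formula_ultimately_constant (f : ordered_qelim.ord.formula R) :
  ordered_qelim.ord.rformula f ->
  exists2 b : R -> R -> bool, ultimately_constant b &
    forall s m, b s m <-> ordered_qelim.ord.holds [:: s; m] f.
Proof.
move=> rf; exists (fun s m => ordered_qelim.ord.qf_eval [:: s; m]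
    (ordered_qelim.ord.quantifier_elim rcf_proj f)).
  have /andP[qf rqf] := ordered_qelim.ord.quantifier_elim_wf
    (wproj := rcf_proj) (@qe_rcf.wf_QE_wproj R) rf.
  exact: qf_ultimately_constant.
move=> s m; apply: iff_sym; apply: rwP.
exact: (ordered_qelim.ord.quantifier_elim_rformP (wproj := rcf_proj)
  (@qe_rcf.wf_QE_wproj R) (@qe_rcf.valid_QE_wproj R)).
Qed.

End EventualSigns.

(** * Polynomial lower bound for a nonvanishing polynomial *)

Section Lojasiewicz.
Context {R : realType}.
Implicit Types (p q : mpoly 2 R[i]) (z : R * R) (j : 'I_2).

Lemma ccontinuous_eval2 p : ccontinuous (eval2 p).
Proof.
elim/mpoly_ring_ind: p => [c|k|p q Hp Hq|p q Hp Hq].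
- by rewrite eval2C; exact: ccontinuous_cst.
- rewrite eval2X; apply: ccontinuous_real => z; rewrite /coord.
  by case: (k == ord0); [exact: cvg_fst|exact: cvg_snd].
- by rewrite eval2D; exact: ccontinuousD.
- by rewrite eval2M; exact: ccontinuousM.
Qed.

(** Variables 0 and 1 are reserved for s and m, so x and y carry the numbers 2 and 3. *)
Lemma eval2_rterm q : exists tr ti : GRing.term R, [/\ GRing.rterm tr, GRing.rterm ti &
  forall s m x y, GRing.eval [:: s; m; x; y] tr = complex.Re (eval2 q (x, y)) /\
                  GRing.eval [:: s; m; x; y] ti = complex.Im (eval2 q (x, y))].
Proof.
elim/mpoly_ring_ind: q => [c|k|p q [pr [pi [rr ri H]]] [qr [qi [rr' ri' H']]]
  |p q [pr [pi [rr ri H]]] [qr [qi [rr' ri' H']]]].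
- exists (GRing.Const (complex.Re c)), (GRing.Const (complex.Im c)).
  by split=> // s m x y; rewrite eval2C.
- exists (GRing.Var R (2 + k)), (GRing.Const 0); split=> // s m x y.
  by rewrite eval2X /coord; have [->|->] := ord2P k.
- exists (GRing.Add pr qr), (GRing.Add pi qi).
  split=> [||s m x y] /=; rewrite ?rr ?ri ?rr' ?ri' //.
  have [Hr Hi] := H s m x y; have [Hr' Hi'] := H' s m x y.
  by rewrite eval2D ReD ImD Hr Hi Hr' Hi'.
- exists (GRing.Add (GRing.Mul pr qr) (GRing.Opp (GRing.Mul pi qi))),
    (GRing.Add (GRing.Mul pr qi) (GRing.Mul pi qr)).
  split=> [||s m x y] /=; rewrite ?rr ?ri ?rr' ?ri' //.
  have [Hr Hi] := H s m x y; have [Hr' Hi'] := H' s m x y.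
  by rewrite eval2M ReM ImM Hr Hi Hr' Hi'.
Qed.

(** The inverse of [p] is continuous, hence bounded on the compact square. *)
Lemma positive_min_on_square (p : R * R -> R) (S : R) : continuous p ->
  (forall z, 0 < p z) ->
  exists2 c, 0 < c & forall x y, `|x| <= S -> `|y| <= S -> c <= p (x, y).
Proof.
move=> cp p0.
pose K : set (R * R) := `[- S, S]%classic `*` `[- S, S]%classic.
have cK : compact K by apply: compact_setX; exact: segment_compact.
have : compact ((fun z => (p z)^-1) @` K).
  apply: continuous_compact => //; apply: continuous_subspaceT => z.
  by apply: cvgV; [rewrite gt_eqF | exact: cp].
move=> /compact_bounded[k [_ H]].
exists (Num.max 1 (k + 1))^-1; first by rewrite invr_gt0 lt_max ltr01.
move=> x y; rewrite !ler_norml => xS yS.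
rewrite -[p _]invrK lef_pV2 ?posrE ?invr_gt0 ?lt_max ?ltr01 //.
apply: le_trans (ler_norm _) _; apply: H; first by rewrite lt_max ltrDl ltr01 orbT.
by exists (x, y) => //; split; rewrite /= in_itv.
Qed.

(* Lojasiewicz: the truth value of [inf {|q z|^2 : |z|^2 <= s} <= m] is
   given by a quantifier free formula, hence ultimately constant; by
   compactness it is not ultimately true. *)
Lemma lojasiewicz q : (forall z, eval2 q z <> 0) ->
  exists N (c : R), 0 < c /\ forall z, c <= cabs (eval2 q z) * weight z ^+ N.
Proof.
move=> q0; have [tr [ti [rr ri H]]] := eval2_rterm q.
pose p z := complex.Re (eval2 q z) ^+ 2 + complex.Im (eval2 q z) ^+ 2.
have p0 z : 0 < p z.
  rewrite /p lt_neqAle addr_ge0 ?sqr_ge0 // andbT eq_sym; apply/eqP => /eqP.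
  rewrite paddr_eq0 ?sqr_ge0 // !sqrf_eq0 => /andP[/eqP a /eqP b].
  by apply: (q0 z); apply: complexP.
have cp : continuous p.
  have [cr ci'] := ccontinuous_eval2 q.
  by move=> z; apply: cvgD; apply: cvgM; [exact: cr|exact: cr|exact: ci'|exact: ci'].
pose f : ordered_qelim.ord.formula R := ordered_qelim.ord.Exists 2
  (ordered_qelim.ord.Exists 3 (ordered_qelim.ord.And
    (ordered_qelim.ord.Le (GRing.Add (GRing.Mul (GRing.Var R 2) (GRing.Var R 2))
      (GRing.Mul (GRing.Var R 3) (GRing.Var R 3))) (GRing.Var R 0))
    (ordered_qelim.ord.Le (GRing.Add (GRing.Mul tr tr) (GRing.Mul ti ti)) (GRing.Var R 1)))).
have rf : ordered_qelim.ord.rformula f by rewrite /= rr ri.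
have [b [t [s0 [N [s01 Hb]]]] bP] := formula_ultimately_constant rf.
have fE s m : ordered_qelim.ord.holds [:: s; m] f <->
    exists x y, x * x + y * y <= s /\ p (x, y) <= m.
  split=> /= -[x [y [h1 h2]]]; exists x, y; move: h1 h2;
    by have [-> ->] := H s m x y; rewrite /p !expr2.
have [tT|tF] := boolP t.
  have [c c0 Hc] := positive_min_on_square s0 cp p0.
  (* Strictly below the lower bound [c] of |q|^2 on the square, and inside the cusp at s0. *)
  pose m := Num.min (c / 2) (s0 ^- N).
  have m0 : 0 < m by rewrite lt_min divr_gt0 // invr_gt0 exprn_gt0 // (lt_le_trans ltr01).
  have : b s0 m.
    rewrite Hb // /m.
    by rewrite -ler_pdivlMr ?exprn_gt0 ?(lt_le_trans ltr01) // mul1r ge_min lexx orbT.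
  move=> /bP/fE[x [y [xy pm]]].
  (* As s0 >= 1, the bound |u|^2 <= s0 yields |u| <= s0. *)
  have sq_le u v : u * u + v * v <= s0 -> `|u| <= s0.
    move=> uv; have [s0u|//] := ltP s0 `|u|.
    have : `|u| * `|u| <= s0 by rewrite -normrM ger0_norm ?mulr_self_ge0 //; nra.
    by nra.
  have := Hc x y (sq_le _ _ xy).
  rewrite addrC in xy => /(_ (sq_le _ _ xy)) cle.
  have : m <= c / 2 by rewrite /m ge_min lexx.
  lra.
(* The truth value is false on the whole cusp, in particular on its edge m = s^-N. *)
have large s z : s0 <= s -> z.1 * z.1 + z.2 * z.2 <= s -> s ^- N < p z.
  move=> s0s zs; rewrite ltNge; apply/negP => ps.
  have s_gt0 : 0 < s by rewrite (lt_le_trans ltr01) // (le_trans s01).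
  have : b s (s ^- N) by apply/bP/fE; exists z.1, z.2; split=> //; case: z zs ps.
  rewrite Hb ?invr_gt0 ?exprn_gt0 //; first by rewrite (negbTE tF).
  by rewrite mulVf // expf_neq0 // gt_eqF.
exists N, (Num.min 1 (s0 ^- N)).
split; first by rewrite lt_min ltr01 invr_gt0 exprn_gt0 // (lt_le_trans ltr01).
move=> z.
have w1 := weight_ge1 z.
have s0p : 0 < s0 by rewrite (lt_le_trans ltr01).
have wp := weight_gt0 z.
(* The value s = s0 (weight z)^2 is at least s0 and at least |z|^2. *)
have pz : (s0 * weight z ^+ 2) ^- N < p z.
  apply: large; first by rewrite ler_peMr ?(ltW s0p) // exprn_ege1.
  have : z.1 * z.1 + z.2 * z.2 <= weight z ^+ 2.
    rewrite -!expr2 -(real_normK (num_real z.1)) -(real_normK (num_real z.2)) /weight.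
    by have := normr_ge0 z.1; have := normr_ge0 z.2; nra.
  by move=> h; apply: le_trans h _; rewrite ler_peMl // exprn_ge0 // ltW.
have Np : 0 < s0 ^+ N by rewrite exprn_gt0.
have pw : s0 ^- N < (cabs (eval2 q z) * weight z ^+ N) ^+ 2.
  have -> : (cabs (eval2 q z) * weight z ^+ N) ^+ 2 = p z * (weight z ^+ 2) ^+ N.
    by rewrite exprMn sqr_cabs -!exprM mulnC.
  by rewrite -ltr_pdivrMr ?exprn_gt0 // -invfM -exprMn.
have d0 : 0 <= cabs (eval2 q z) * weight z ^+ N.
  by rewrite mulr_ge0 ?cabs_ge0 // exprn_ge0 // ltW.
(* With d = |q z| (weight z)^N, either d >= 1, or d >= d^2 > s0^-N. *)
rewrite ge_min; have [//|lt1] := leP 1 (cabs (eval2 q z) * weight z ^+ N).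
by rewrite orFb (ltW (lt_le_trans pw _)) // expr2 ler_piMr // ltW.
Qed.

End Lojasiewicz.

(** * Symbols and the Fourier transform on the plane *)

Section Symbols.
Context {R : realType}.
Implicit Types (p q : mpoly 2 R[i]) (P : mpoly 2 R) (z : R * R) (j : 'I_2).

Lemma ReN (c : R[i]) : complex.Re (- c) = - complex.Re c.
Proof. by case: c. Qed.

Lemma ImN (c : R[i]) : complex.Im (- c) = - complex.Im c.
Proof. by case: c. Qed.

Lemma is_cderiveV (h : R -> R[i]) t d : h t != 0 -> is_cderive h t d ->
  is_cderive (fun s => (h s)^-1) t (- d * (h t)^-1 ^+ 2).
Proof.
move=> h0 [h1 h2].
pose n s : R := complex.Re (h s) ^+ 2 + complex.Im (h s) ^+ 2.
have invE (c : R[i]) : c^-1 = (complex.Re c / (complex.Re c ^+ 2 + complex.Im c ^+ 2)) +i*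
    (- complex.Im c / (complex.Re c ^+ 2 + complex.Im c ^+ 2)).
  by case: c => a b; apply: complexP => //=; rewrite mulNr.
have n0 : n t != 0 by rewrite /n -sqr_cabs expf_neq0 // cabs_eq0.
have dn : is_derive t (1 : R) n (2 * (complex.Re (h t) * complex.Re d +
    complex.Im (h t) * complex.Im d)).
  by apply: is_derive_eq; rewrite /GRing.scale /=; ring.
have dV := is_deriveV n0 dn.
split.
- rewrite (_ : (fun s => _) = (fun s => complex.Re (h s)) * (fun s => (n s)^-1)).
    apply: is_derive_eq; rewrite [(h t)^-1]invE.
    rewrite expr2 !ReM !ImM ReN.
    rewrite ImN /=.
    by rewrite /GRing.scale /=; move: n0; rewrite /n => n0; field.
  by apply/funext => s; rewrite invE.
- rewrite (_ : (fun s => _) = (- (fun s => complex.Im (h s))) * (fun s => (n s)^-1)).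
    apply: is_derive_eq; rewrite [(h t)^-1]invE.
    rewrite expr2 !ImM !ReM ReN.
    rewrite ImN /=.
    by rewrite /GRing.scale /= !fctE; move: n0; rewrite /n => n0; field.
  by apply/funext => s; rewrite invE.
Qed.

Lemma evalR2D P P' z : evalR2 (P + P') z = evalR2 P z + evalR2 P' z.
Proof. exact: mevalD. Qed.

Lemma evalR2M P P' z : evalR2 (P * P') z = evalR2 P z * evalR2 P' z.
Proof. exact: mevalM. Qed.

Lemma evalR2_eval2 P z : (evalR2 P z)%:C = eval2 (map_mpoly (real_complex R) P) z.
Proof.
elim/mpoly_ring_ind: P => [c|k|p q Hp Hq|p q Hp Hq].
- by rewrite map_mpolyC eval2C /evalR2 mevalC.
- by rewrite map_mpolyX eval2X /evalR2 mevalXU.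
- rewrite (_ : map_mpoly _ (p + q) = map_mpoly (real_complex R) p + map_mpoly (real_complex R) q).
    rewrite eval2D evalR2D; apply: etrans (congr2 (fun c d => c + d) Hp Hq).
    by apply: complexP; rewrite /= ?addr0.
  exact: (raddfD (map_mpoly (real_complex R))).
- rewrite (_ : map_mpoly _ (p * q) = map_mpoly (real_complex R) p * map_mpoly (real_complex R) q).
    rewrite eval2M evalR2M; apply: etrans (congr2 (fun c d => c * d) Hp Hq).
    by apply: complexP; rewrite /= ?mul0r ?mulr0 ?subr0 ?addr0.
  exact: (rmorphM (map_mpoly (real_complex R))).
Qed.

Lemma map_mpoly_mderiv j P :
  mderiv j (map_mpoly (real_complex R) P) = map_mpoly (real_complex R) (mderiv j P).
Proof. by apply/mpolyP => m; rewrite mcoeff_mderiv !mcoeff_map_mpoly /= mcoeff_mderiv rmorphMn. Qed.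

Lemma evalR2_has_pd j P z :
  has_pd j (fun z => (evalR2 P z)%:C) z (evalR2 (mderiv j P) z)%:C.
Proof.
rewrite (_ : (fun z => _) = eval2 (map_mpoly (real_complex R) P)).
  by rewrite evalR2_eval2 -map_mpoly_mderiv; exact: eval2_has_pd.
by apply/funext => u; rewrite evalR2_eval2.
Qed.

Lemma evalR2N P z : evalR2 (- P) z = - evalR2 P z.
Proof. exact: mevalN. Qed.

(** The functions p q^-k e^(iP), with q and P fixed, are closed under derivation, which raises k by
    one. They include the symbols of sigma and sigma_1, the inverses of these symbols, and the
    characters. *)
Definition rational_phase p q k P : R * R -> R[i] :=
  fun z => eval2 p z * (eval2 q z)^-1 ^+ k * expi (evalR2 P z).

Lemma rational_phase_has_pd j p q k P z : (forall z, eval2 q z <> 0) ->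
  has_pd j (rational_phase p q k P) z (rational_phase
    (mderiv j p * q + mpolyC 2 (- k%:R) * p * mderiv j q +
     mpolyC 2 ci * p * q * map_mpoly (real_complex R) (mderiv j P)) q k.+1 P z).
Proof.
move=> q0.
have qz : eval2 q z != 0 by apply/eqP.
have dV : has_pd j (fun z => (eval2 q z)^-1) z (- eval2 (mderiv j q) z * (eval2 q z)^-1 ^+ 2).
  rewrite /has_pd; have := is_cderiveV _ (eval2_has_pd j q z).
  rewrite slice_coord => /(_ qz); rewrite (_ : slice (fun z => (eval2 q z)^-1) j z = fun s => (slice (eval2 q) j z s)^-1) //.
  by apply/funext => s; rewrite /slice; case: ifP.
have dX l : has_pd j (fun z => (eval2 q z)^-1 ^+ l) z
    (- l%:R * eval2 (mderiv j q) z * (eval2 q z)^-1 ^+ l.+1).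
  elim: l => [|l IH].
    under eq_fun do rewrite expr0; apply: has_pd_eq (has_pd_cst _ _ _) _.
    by rewrite oppr0 !mul0r.
  under eq_fun do rewrite exprS; apply: has_pd_eq (has_pdM dV IH) _.
  rewrite -[in RHS]natr1 !exprS; ring.
have := has_pdM (has_pdM (eval2_has_pd j p z) (dX k)) (has_pd_expi (evalR2_has_pd j P z)).
move=> h; apply: has_pd_eq h _; rewrite /rational_phase.
rewrite !eval2D !eval2M !eval2C -evalR2_eval2 /=.
rewrite !exprS; move: ((eval2 q z)^-1 ^+ k) => V; move: qz.
move: (eval2 q z) (eval2 p z) (eval2 (mderiv j q) z) (eval2 (mderiv j p) z) => Q F Q' F' Qz.
by move: (expi _) (_%:C) => e d; field.
Qed.

(** The phase has modulus 1 because P is real, and the powers of 1/q have polynomial growth by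
    [lojasiewicz]. *)
Lemma slowly_increasing_rational_phase p q k P : (forall z, eval2 q z <> 0) ->
  SlowlyIncreasing (rational_phase p q k P).
Proof.
move=> q0.
apply: (@slowly_increasing_coind _ (fun f => exists p k, f = rational_phase p q k P)).
- by move=> _ j z [p' [k' ->]]; have [] := has_pdP (rational_phase_has_pd j p' k' P z q0).
- move=> _ [p' [k' ->]]; rewrite /rational_phase.
  apply: poly_boundedM; last by apply: (@poly_bounded_bounded _ _ 1) => z; rewrite cabs_expi.
  apply: poly_boundedM; first exact: poly_bounded_eval2.
  have [N [c [c0 H]]] := lojasiewicz q0.
  have pV : poly_bounded (fun z => (eval2 q z)^-1).
    exists N, c^-1 => z; rewrite cabsV.
    have q1 : 0 < cabs (eval2 q z) by rewrite lt_neqAle cabs_ge0 eq_sym cabs_eq0 andbT; apply/eqP.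
    by rewrite -[leLHS]mulr1 ler_pdivrMl // mulrCA ler_pdivlMl // mulr1.
  elim: k' => [|k' IH]; first by under eq_fun do rewrite expr0; exact: poly_bounded_cst.
  by under eq_fun do rewrite exprS; exact: poly_boundedM.
- move=> _ j [p' [k' ->]]; eexists; eexists; apply/funext => z.
  exact: partial_eq (rational_phase_has_pd j p' k' P z q0).
- by exists p, k.
Qed.

End Symbols.

(** * The plane transform and the exchange of derivatives with multiplications *)

Section FourierPlane.
Context {R : realType}.
Implicit Types (f g phi psi : R * R -> R[i]) (z : R * R) (j : 'I_2) (K : (R * R -> R[i]) -> R * R -> R[i]).

Lemma partial_pfourier0 phi : Schwartz phi ->
  partial ord0 (pfourier phi) = pfourier (partial ord0 phi).
Proof. by move=> sp; apply/funext => z; exact: partial_eq (pfourier_has_pd0 z sp). Qed.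

Lemma partial_pfourier1 phi : Schwartz phi ->
  partial ord_max (pfourier phi) = (- ci) *: pfourier (mulc ord_max phi).
Proof.
move=> sp; apply/funext => z; rewrite (partial_eq (pfourier_has_pd1 z sp)).
by rewrite (op_linear_scale _ pfourier_lin) //; exact: schwartz_mulc.
Qed.

Lemma mulc_pfourier1 phi : Schwartz phi ->
  mulc ord_max (pfourier phi) = (- ci) *: pfourier (partial ord_max phi).
Proof.
move=> sp; rewrite pfourier_mulc1 // (op_linear_scale _ pfourier_lin) //.
exact: schwartz_partial.
Qed.

Lemma swapfZ c phi : swapf (c *: phi) = c *: swapf phi.
Proof. by []. Qed.

Lemma partial_swapf0 phi : Schwartz phi ->
  partial ord0 (swapf phi) = swapf (partial ord_max phi).
Proof.
move=> sp; apply/funext => z; rewrite swapf_lin_change.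
rewrite (partial_eq (lin_change_has_pd0 _ _ _ _ _ sp)) /lin_change.
by rewrite !scale0r add0r scale1r.
Qed.

Lemma partial_swapf1 phi : Schwartz phi ->
  partial ord_max (swapf phi) = swapf (partial ord0 phi).
Proof.
move=> sp; apply/funext => z; rewrite swapf_lin_change.
rewrite (partial_eq (lin_change_has_pd1 _ _ _ _ _ sp)) /lin_change.
by rewrite !scale0r addr0 scale1r.
Qed.

Lemma decay2_fourier phi x y : Schwartz phi ->
  decay2 (fun z => expi (- (z.1 * x + z.2 * y)) * phi z).
Proof.
move=> sp; apply: (decay2M (K := 1) (schwartz_decay sp)); last by move=> z; rewrite cabs_expi.
apply: ccontinuous_expi => z; apply: cvgN; apply: cvgD.
  by apply: cvgM; [exact: cvg_fst|exact: cvg_cst].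
by apply: cvgM; [exact: cvg_snd|exact: cvg_cst].
Qed.

Lemma fourierE phi : Schwartz phi -> fourier phi = swapf (pfourier (swapf (pfourier phi))).
Proof.
move=> sp; apply/funext => -[x y]; rewrite /fourier /swapf /= pfourierE.
have [-> _] := fubini_decay (decay2_fourier x y sp).
apply: eq_integral1 => t; rewrite pfourierE -integral1Z; last exact: pfourier_decay (schwartz_decay sp).
by apply: eq_integral1 => s; rewrite mulrA -expiD opprD.
Qed.

(** The other order of integration. Applied to [fourier_inv], it gives a composite that is literally
    inverse to the factorisation in [fourierE]. *)
Lemma fourierE' phi : Schwartz phi -> fourier phi = pfourier (swapf (pfourier (swapf phi))).
Proof.
move=> sp; apply/funext => -[x y]; rewrite /fourier pfourierE.
have [_ ->] := fubini_decay (decay2_fourier x y sp).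
apply: eq_integral1 => t; rewrite /swapf /= pfourierE -integral1Z; last first.
  exact: (pfourier_decay t x (schwartz_decay (schwartz_swapf sp))).
by apply: eq_integral1 => s; rewrite mulrA -expiD opprD addrC.
Qed.

Lemma fourier_inv_fourier phi z :
  fourier_inv phi z = ((2 * pi) ^- 2)%:C * fourier phi (- z.1, - z.2).
Proof.
rewrite /fourier_inv /fourier; congr (_ * _); congr integral2; apply/funext => w /=.
by congr (expi _ * _); ring.
Qed.

Lemma fourier_invE phi : Schwartz phi ->
  fourier_inv phi = pfourier_inv (swapf (pfourier_inv (swapf phi))).
Proof.
move=> sp; apply/funext => -[x y]; rewrite fourier_inv_fourier fourierE' //=.
rewrite /pfourier_inv /= !pfourierE.
have ss := schwartz_swapf sp.
rewrite (_ : ((2 * pi) ^- 2)%:C = ((2 * pi)^-1)%:C * ((2 * pi)^-1)%:C :> R[i]); last first.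
  by rewrite -[RHS](rmorphM (real_complex R)) /= -invfM expr2.
rewrite -mulrA -integral1Z.
  by congr (_ * _); apply: eq_integral1 => t; rewrite /swapf /=; ring.
apply: (pfourier_decay (- x) (- y)); apply: schwartz_decay.
exact: schwartz_swapf (schwartz_pfourier ss).
Qed.

Lemma iso_fourier : schwartz_iso (@fourier R) (@fourier_inv R).
Proof.
have i := @iso_comp R _ _ _ _ (iso_comp iso_swapf iso_pfourier) (iso_comp iso_swapf iso_pfourier).
apply: iso_ext i => phi sp /=; first by rewrite fourierE.
by rewrite fourier_invE.
Qed.

Lemma partial_fourier j phi : Schwartz phi ->
  partial j (fourier phi) = (- ci) *: fourier (mulc j phi).
Proof.
move=> sp; have sm k := schwartz_mulc k sp; have sF := schwartz_pfourier sp.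
have sS := schwartz_swapf sF; have sFS := schwartz_pfourier sS.
rewrite !fourierE //; have [->|->] := ord2P j.
- rewrite partial_swapf0 // partial_pfourier1 //; congr (_ *: swapf (pfourier _)).
  apply/funext => -[x y]; rewrite /swapf /= -pfourier_mulc0 //.
- rewrite partial_swapf1 // partial_pfourier0 // partial_swapf0 // partial_pfourier1 //.
  by rewrite swapfZ (op_linear_scale _ pfourier_lin) //; apply: schwartz_swapf; exact: schwartz_pfourier.
Qed.

Lemma mulc_fourier j phi : Schwartz phi ->
  mulc j (fourier phi) = (- ci) *: fourier (partial j phi).
Proof.
move=> sp; have sd k := schwartz_partial k sp; have sF := schwartz_pfourier sp.
have sS := schwartz_swapf sF; have sFS := schwartz_pfourier sS.
rewrite !fourierE //; have [->|->] := ord2P j.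
- rewrite (_ : mulc ord0 _ = swapf (mulc ord_max (pfourier (swapf (pfourier phi))))) //.
  by rewrite mulc_pfourier1 // partial_swapf1 // partial_pfourier0.
- rewrite (_ : mulc ord_max _ = swapf (mulc ord0 (pfourier (swapf (pfourier phi))))) //.
  rewrite pfourier_mulc0 //.
  rewrite (_ : mulc ord0 (swapf _) = swapf (mulc ord_max (pfourier phi))) //.
  by rewrite mulc_pfourier1 // swapfZ (op_linear_scale _ pfourier_lin) //; apply: schwartz_swapf; exact: schwartz_pfourier.
Qed.

Lemma real_complexV2 : (2^-1)%:C = 2^-1 :> R[i].
Proof. by rewrite (fmorphV (real_complex R)) /= rmorphMn. Qed.

Lemma partial_midpoint0 phi : Schwartz phi ->
  partial ord0 (midpoint phi) = midpoint (2^-1 *: partial ord0 phi + partial ord_max phi).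
Proof.
move=> sp; apply/funext => z; rewrite midpointE.
rewrite (partial_eq (lin_change_has_pd0 _ _ _ _ _ sp)) /lin_change scale1r.
by rewrite real_complexV2.
Qed.

Lemma partial_midpoint1 phi : Schwartz phi ->
  partial ord_max (midpoint phi) = midpoint (2^-1 *: partial ord0 phi - partial ord_max phi).
Proof.
move=> sp; apply/funext => z; rewrite midpointE.
rewrite (partial_eq (lin_change_has_pd1 _ _ _ _ _ sp)) /lin_change real_complexV2.
by rewrite (_ : (-1)%:C = -1) ?scaleN1r //; apply: complexP; rewrite //= oppr0.
Qed.

Lemma mulc_midpoint0 phi :
  mulc ord0 (midpoint phi) = midpoint (mulc ord0 phi + 2^-1 *: mulc ord_max phi).
Proof.
rewrite midpointE (@lin_change_mulc0 _ _ _ _ _ 1 2^-1); last by move=> x y; field.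
by rewrite real_complexV2 scale1r.
Qed.

Lemma mulc_midpoint1 phi :
  mulc ord_max (midpoint phi) = midpoint (mulc ord0 phi - 2^-1 *: mulc ord_max phi).
Proof.
rewrite midpointE (@lin_change_mulc1 _ _ _ _ _ 1 (- 2^-1)); last by move=> x y; field.
rewrite (_ : (- 2^-1)%:C = - 2^-1) ?scale1r ?scaleNr // -real_complexV2.
by apply: complexP; rewrite //= oppr0.
Qed.

End FourierPlane.

(** * Operators on distributions *)

Section DistributionCalculus.
Context {R : realType}.
Implicit Types (u v w : distr R) (f g phi psi : R * R -> R[i]) (z : R * R) (j : 'I_2)
  (K L : (R * R -> R[i]) -> R * R -> R[i]) (p q : mpoly 2 R[i]) (P : mpoly 2 R).

Definition linear_distr u : Prop := forall c phi psi, Schwartz phi -> Schwartz psi ->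
  u (c *: phi + psi) = c * u phi + u psi.

(** Linearity is built into the relation because the scalars and sums produced on test functions
    have to be moved outside the functional. *)
Definition eqd u v : Prop :=
  [/\ linear_distr u, linear_distr v & forall phi, Schwartz phi -> u phi = v phi].

Lemma eqd_per : linear_per eqd.
Proof.
have ld0 : linear_distr 0 by move=> c phi psi _ _; rewrite -[RHS]/(c * 0 + 0) mulr0 addr0.
have ldD u v : linear_distr u -> linear_distr v -> linear_distr (u + v).
  move=> lu lv c phi psi sp ss.
  rewrite -[LHS]/(u _ + v _) lu // lv // -[RHS]/(c * (u phi + v phi) + (u psi + v psi)); ring.
have ldZ a u : linear_distr u -> linear_distr (a *: u).
  move=> lu c phi psi sp ss.
  rewrite -[LHS]/(a * u _) lu // -[RHS]/(c * (a * u phi) + a * u psi); ring.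
split=> [u v [lu lv uv]|u v w [lu lv uv] [_ lw vw]|u u' v v' [lu lu' uu] [lv lv' vv]|c u v [lu lv uv]|].
- by split=> // phi sp; rewrite uv.
- by split=> // phi sp; rewrite uv // vw.
- split; [exact: ldD|exact: ldD|] => phi sp.
  by rewrite -[LHS]/(u phi + v phi) uu // vv.
- split; [exact: ldZ|exact: ldZ|] => phi sp.
  by rewrite -[LHS]/(c * u phi) uv.
- by split.
Qed.

Lemma eqdI u v : eqd u u -> eqd v v -> (forall phi, Schwartz phi -> u phi = v phi) -> eqd u v.
Proof. by move=> [lu _ _] [lv _ _]. Qed.

Lemma eqd_tempered u : tempered u -> eqd u u.
Proof.
by move=> [lu _]; split=> // c phi psi; rewrite !SchwartzE; exact: lu.
Qed.

Lemma eqdZ u c phi : eqd u u -> Schwartz phi -> u (c *: phi) = c * u phi.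
Proof.
move=> [lu _ _] sp; have u0 : u 0 = 0.
  have := lu (-1) 0 0 schwartz0 schwartz0.
  by rewrite scaler0 addr0 mulN1r addrC subrr.
by have := lu c phi 0 sp schwartz0; rewrite addr0 u0 addr0.
Qed.

Lemma eqdD u phi psi : eqd u u -> Schwartz phi -> Schwartz psi -> u (phi + psi) = u phi + u psi.
Proof. by move=> [lu _ _] sp ss; have := lu 1 phi psi sp ss; rewrite scale1r mul1r. Qed.

Lemma respects_transpose K : op_linear K -> (forall phi, Schwartz phi -> Schwartz (K phi)) ->
  respects eqd eqd (fun u phi => u (K phi)).
Proof.
move=> lK sK u v [lu lv uv]; split=> [c phi psi sp ss|c phi psi sp ss|phi sp].
- by rewrite lK // lu //; exact: sK.
- by rewrite lK // lv //; exact: sK.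
- by rewrite uv //; exact: sK.
Qed.

Lemma respects_M j : respects eqd eqd (@M R j).
Proof. exact: respects_transpose (op_linear_mulc j) (@schwartz_mulc R j). Qed.

Lemma DE j u phi : D j u phi = u (ci *: partial j phi).
Proof. by rewrite /D iE partialE. Qed.

Lemma respects_D j : respects eqd eqd (@D R j).
Proof.
rewrite (_ : @D R j = fun u phi => u (ci *: partial j phi)).
  apply: respects_transpose => [c phi psi sp ss|phi sp].
    by rewrite op_linear_partial // scalerDr !scalerA mulrC.
  exact/schwartzZ/schwartz_partial.
by apply/funext => u; apply/funext => phi; rewrite DE.
Qed.

Lemma respects_mulf g : SlowlyIncreasing g -> respects eqd eqd (mulf g).
Proof. by move=> sg; apply: (respects_transpose (mulop_lin g)) => phi; exact: schwartz_mulop. Qed.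

Lemma respects_fourierD : respects eqd eqd (@fourierD R).
Proof.
apply: respects_transpose; first exact: iso_linear iso_fourier.
by move=> phi; exact: iso_schwartz iso_fourier.
Qed.

Lemma respects_fourierD_inv : respects eqd eqd (@fourierD_inv R).
Proof.
apply: respects_transpose; first exact: iso_inv_linear iso_fourier.
by move=> phi; exact: iso_schwartz (iso_sym iso_fourier).
Qed.

Lemma fourierD_sndE u phi : fourierD_snd u phi = u (pfourier phi).
Proof. by rewrite /fourierD_snd pfourier.unlock. Qed.

Lemma respects_fourierD_snd : respects eqd eqd (@fourierD_snd R).
Proof.
rewrite (_ : @fourierD_snd R = fun u phi => u (pfourier phi)).
  exact: respects_transpose pfourier_lin (@schwartz_pfourier R).
by apply/funext => u; apply/funext => phi; rewrite fourierD_sndE.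
Qed.

Lemma respects_Tvar : respects eqd eqd (@Tvar R).
Proof.
apply: (respects_transpose (iso_linear iso_midpoint)).
by move=> phi; exact: iso_schwartz iso_midpoint.
Qed.

Lemma respects_Wig : respects eqd eqd (@Wig R).
Proof. by move=> u v uv; apply: respects_fourierD_snd; exact: respects_Tvar. Qed.

Lemma enum_ord2 : enum 'I_2 = [:: ord0; ord_max].
Proof. by apply: (inj_map val_inj); rewrite val_enum_ord. Qed.

Lemma iter_M j k u : iter k (M j) u = mulf (fun z => (coord j z)%:C ^+ k) u.
Proof.
elim: k => [|k IH].
  by apply/funext => phi; rewrite /= /mulf; congr u; apply/funext => z; rewrite expr0 mul1r.
apply/funext => phi; rewrite iterS IH /M /mulf; congr u; apply/funext => z.
by rewrite exprS; ring.
Qed.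

Lemma opsubst_M q u : eqd u u -> eqd (opsubst q (ops2 (M ord0) (M ord_max)) u) (mulf (eval2 q) u).
Proof.
move=> uu; have rs p := respects_mulf (slowly_increasing_eval2 p) uu.
have per := eqd_per.
elim/mpolyind: q => [|c m p _ _ IH].
  rewrite (lin0 (opsubst_lin _ u)) -mpolyC0 eval2C; apply: eqdI => [||phi sp].
  - exact: per_zero.
  - by rewrite -(eval2C 0); exact: rs.
  - rewrite /mulf (_ : (fun z => _) = 0 *: phi) ?eqdZ // ?mul0r //.
rewrite (opsubst_lin _ u) opsubstX.
have -> : opmonomial (ops2 (M ord0) (M ord_max)) m u = mulf (eval2 (mpolyX R[i] m)) u.
  rewrite /opmonomial enum_ord2 /= /ops2 /= !iter_M; apply/funext => phi.
  rewrite /mulf; congr u; apply/funext => z.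
  rewrite /eval2 mevalX !big_ord_recl big_ord0 mulr1.
  by rewrite (_ : lift ord0 ord0 = ord_max); [ring | exact: val_inj].
apply: (per_trans per (per_add per (per_scale per c (rs _)) IH)).
apply: eqdI => [||phi sp].
- by apply: (per_add per) => //; apply: (per_scale per).
- exact: rs.
have sm r := schwartz_mulop (slowly_increasing_eval2 r) sp.
rewrite -[LHS]/(c * u (mulop (eval2 (mpolyX R[i] m)) phi) + u (mulop (eval2 p) phi)).
rewrite -eqdZ // -eqdD //; last exact: schwartzZ.
rewrite /mulf; congr u; apply/funext => z.
by rewrite eval2D -mul_mpolyC eval2M eval2C /mulop mulrDl -mulrA.
Qed.

End DistributionCalculus.

(** * Generators through Fourier transforms, multipliers and the change of variables *)

Section Intertwinings.
Context {R : realType}.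
Implicit Types (u v w : distr R) (f g phi psi : R * R -> R[i]) (z : R * R) (j k : 'I_2)
  (K L : (R * R -> R[i]) -> R * R -> R[i]) (p q : mpoly 2 R[i]) (P : mpoly 2 R).

Let perE := @eqd_per R.

Lemma eqd_opp u v : eqd u v -> eqd (- u) (- v).
Proof. exact: (per_opp perE). Qed.

Lemma eqd_sub u u' v v' : eqd u u' -> eqd v v' -> eqd (u - v) (u' - v').
Proof. by move=> uu vv; exact: (per_sub perE). Qed.

Lemma eqd_add u u' v v' : eqd u u' -> eqd v v' -> eqd (u + v) (u' + v').
Proof. by move=> uu vv; exact: (per_add perE). Qed.

Lemma eqd_scale (c : R[i]) u v : eqd u v -> eqd (c *: u) (c *: v).
Proof. exact: (per_scale perE). Qed.

Lemma eqd_trans v u w : eqd u v -> eqd v w -> eqd u w.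
Proof. exact: (per_trans perE). Qed.

(* Matching on the head symbols keeps the unification from unfolding the
   operators. *)
Ltac well_defined := repeat first [ assumption | match goal with
  | |- eqd (M _ _) _ => apply: respects_M
  | |- eqd (D _ _) _ => apply: respects_D
  | |- eqd (fourierD _) _ => apply: respects_fourierD
  | |- eqd (fourierD_inv _) _ => apply: respects_fourierD_inv
  | |- eqd (fourierD_snd _) _ => apply: respects_fourierD_snd
  | |- eqd (Tvar _) _ => apply: respects_Tvar
  | |- eqd (Wig _) _ => apply: respects_Wig
  | |- eqd (mulf _ _) _ => apply: respects_mulf
  | |- eqd (- _) _ => apply: eqd_opp
  | |- eqd (_ + _) _ => apply: eqd_add
  | |- eqd (_ *: _) _ => apply: eqd_scale
  end ].

Let sm j phi := @schwartz_mulc R j phi.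
Let sd j phi := @schwartz_partial R j phi.
Let sF phi := @iso_schwartz R _ _ phi iso_fourier.
Let sG phi := @iso_schwartz R _ _ phi (iso_sym iso_fourier).

Lemma ciNci : ci * - ci = 1 :> R[i].
Proof. by rewrite mulrN sqr_ci opprK. Qed.

Lemma fourierD_D j u : eqd u u -> eqd (fourierD (D j u)) (M j (fourierD u)).
Proof.
move=> uu; apply: eqdI => [||phi sp]; try by well_defined.
rewrite /fourierD DE partial_fourier // scalerA ciNci scale1r.
by [].
Qed.

Lemma fourierD_M j u : eqd u u -> eqd (fourierD (M j u)) (- D j (fourierD u)).
Proof.
move=> uu; apply: eqdI => [||phi sp]; try by well_defined.
rewrite -[RHS]/(- (D j (fourierD u) phi)) DE.
rewrite -[LHS]/(u (mulc j (fourier phi))) mulc_fourier //.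
rewrite /fourierD (op_linear_scale _ (iso_linear iso_fourier)); last exact: sd.
by rewrite !eqdZ // ?mulNr //; apply: sF; exact: sd.
Qed.

Lemma mulc_fourier_inv j phi : Schwartz phi ->
  mulc j (fourier_inv phi) = ci *: fourier_inv (partial j phi).
Proof.
move=> sp; have sp' := sG sp.
rewrite -[in RHS](iso_invK iso_fourier sp) partial_fourier //.
rewrite (op_linear_scale _ (iso_inv_linear iso_fourier)); last exact/sF/sm.
by rewrite (isoK iso_fourier (sm j sp')) scalerA ciNci scale1r.
Qed.

Lemma partial_fourier_inv j phi : Schwartz phi ->
  partial j (fourier_inv phi) = ci *: fourier_inv (mulc j phi).
Proof.
move=> sp; have sp' := sG sp.
rewrite -[in RHS](iso_invK iso_fourier sp) mulc_fourier //.
rewrite (op_linear_scale _ (iso_inv_linear iso_fourier)); last exact/sF/sd.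
by rewrite (isoK iso_fourier (sd j sp')) scalerA ciNci scale1r.
Qed.

Lemma fourierD_inv_M j u : eqd u u -> eqd (fourierD_inv (M j u)) (D j (fourierD_inv u)).
Proof.
move=> uu; apply: eqdI => [||phi sp]; try by well_defined.
rewrite DE -[LHS]/(u (mulc j (fourier_inv phi))) mulc_fourier_inv //.
by rewrite /fourierD_inv (op_linear_scale _ (iso_inv_linear iso_fourier)) //; exact: sd.
Qed.

Lemma fourierD_inv_D j u : eqd u u -> eqd (fourierD_inv (D j u)) (- M j (fourierD_inv u)).
Proof.
move=> uu; apply: eqdI => [||phi sp]; try by well_defined.
rewrite /fourierD_inv DE partial_fourier_inv // scalerA sqr_ci.
rewrite eqdZ //; last exact/sG/sm.
by rewrite mulN1r.
Qed.

Lemma mulf_mulf f g u : mulf f (mulf g u) = mulf g (mulf f u).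
Proof.
by apply/funext => phi; rewrite /mulf; congr u; apply/funext => z; rewrite mulrCA.
Qed.

(** Leibniz rule: the hypothesis on [g] says D_j g = - p g. *)
Lemma mulf_D g p j u : SlowlyIncreasing g ->
  (forall z, has_pd j g z (- ci * eval2 p z * g z)) -> eqd u u ->
  eqd (mulf g (D j u)) (D j (mulf g u) + mulf (eval2 p) (mulf g u)).
Proof.
move=> sg gp uu; have sp := slowly_increasing_eval2 p.
apply: eqdI => [||phi sphi]; try by well_defined.
rewrite -[RHS]/(D j (mulf g u) phi + mulf (eval2 p) (mulf g u) phi) DE /mulf DE.
rewrite -[RHS]eqdD //; last 2 first.
- apply: (@schwartz_mulop _ g (ci *: partial j phi)) => //.
  exact/schwartzZ/schwartz_partial.
- by apply: (@schwartz_mulop _ g (mulop (eval2 p) phi)) => //; exact: schwartz_mulop.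
congr u; apply/funext => z; rewrite !fctE -[ci *: _]/(ci * _) -[ci *: _]/(ci * _).
rewrite (partial_eq (has_pdM (gp z) (schwartz_has_pd j z sphi))).
have -> : ci * (- ci * eval2 p z * g z * phi z + g z * partial j phi z) =
  - (ci * ci) * (eval2 p z * g z * phi z) + ci * g z * partial j phi z by ring.
by rewrite sqr_ci; ring.
Qed.

(** The convolution [conv] with its symbol made explicit. *)
Definition multiplier g u : distr R := fourierD_inv (mulf g (fourierD u)).

Lemma respects_multiplier g : SlowlyIncreasing g -> respects eqd eqd (multiplier g).
Proof. by move=> sg u v uv; rewrite /multiplier; well_defined. Qed.

Lemma multiplier_D g j u : SlowlyIncreasing g -> eqd u u ->
  eqd (multiplier g (D j u)) (D j (multiplier g u)).
Proof.
move=> sg uu; rewrite /multiplier.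
apply: (@eqd_trans (fourierD_inv (M j (mulf g (fourierD u))))).
  rewrite /M mulf_mulf; apply/respects_fourierD_inv/respects_mulf => //.
  exact: fourierD_D.
by apply: fourierD_inv_M; well_defined.
Qed.

Lemma fourierD_inv_mulf p u : eqd u u ->
  eqd (fourierD_inv (mulf (eval2 p) u)) (opsubst p (ops2 (D ord0) (D ord_max)) (fourierD_inv u)).
Proof.
move=> uu; apply: (@eqd_trans (fourierD_inv (opsubst p (ops2 (M ord0) (M ord_max)) u))).
  by apply: respects_fourierD_inv; apply: (per_sym perE); exact: opsubst_M.
have rM k : respects eqd eqd (ops2 (@M R ord0) (M ord_max) k).
  by have [->|->] := ord2P k; exact: respects_M.
have rD k : respects eqd eqd (ops2 (@D R ord0) (D ord_max) k).
  by have [->|->] := ord2P k; exact: respects_D.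
apply: (@opsubst_intertwine _ _ _ eqd eqd perE _ _ _ _ rM rD _ respects_fourierD_inv _ p u uu) => //.
by move=> k v vv; have [->|->] := ord2P k; exact: fourierD_inv_M.
Qed.

(** The Fourier transform turns M_j into - D_j, moving [g] past D_j costs a multiplication by p, and
    the inverse transform turns this into p(D_1, D_2). This is the origin of the operators P_1 and
    P_2 in [tilde]. *)
Lemma multiplier_M g p j u : SlowlyIncreasing g ->
  (forall z, has_pd j g z (- ci * eval2 p z * g z)) -> eqd u u ->
  eqd (multiplier g (M j u))
    (M j (multiplier g u) - opsubst p (ops2 (D ord0) (D ord_max)) (multiplier g u)).
Proof.
move=> sg gp uu; have sp := slowly_increasing_eval2 p.
have wd : eqd (mulf g (fourierD u)) (mulf g (fourierD u)) by well_defined.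
apply: (@eqd_trans (fourierD_inv (- (D j (mulf g (fourierD u)) +
    mulf (eval2 p) (mulf g (fourierD u)))))).
  apply: respects_fourierD_inv.
  apply: (@eqd_trans (mulf g (- D j (fourierD u)))).
    by apply: respects_mulf => //; exact: fourierD_M.
  rewrite -[X in eqd X]/(- mulf g (D j (fourierD u))).
  by apply: eqd_opp; apply: mulf_D; well_defined.
rewrite -[X in eqd X _]/(- (fourierD_inv (D j (mulf g (fourierD u))) +
  fourierD_inv (mulf (eval2 p) (mulf g (fourierD u))))) opprD.
apply: eqd_add; last by apply: eqd_opp; exact: fourierD_inv_mulf.
rewrite -[X in eqd _ X]opprK; apply: eqd_opp.
by apply: fourierD_inv_D; well_defined.
Qed.

Lemma multiplier_eval2 g p u : SlowlyIncreasing g -> eqd u u ->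
  eqd (multiplier (fun z => eval2 p z * g z) u)
    (opsubst p (ops2 (D ord0) (D ord_max)) (multiplier g u)).
Proof.
move=> sg uu; rewrite /multiplier.
rewrite (_ : mulf _ _ = mulf (eval2 p) (mulf g (fourierD u))).
  by apply: fourierD_inv_mulf; well_defined.
apply/funext => phi; rewrite /mulf; congr fourierD; apply/funext => z; ring.
Qed.

Lemma Tvar_M0 u : eqd u u -> eqd (Tvar (M ord0 u)) (M ord0 (Tvar u) + 2^-1 *: M ord_max (Tvar u)).
Proof.
move=> uu; apply: eqdI => [||phi sp]; try by well_defined.
rewrite -[LHS]/(u (mulc ord0 (midpoint phi))) mulc_midpoint0.
have tt : eqd (Tvar u) (Tvar u) by well_defined.
rewrite -[LHS]/(Tvar u _) eqdD //; [|exact: sm|exact/schwartzZ/sm].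
by rewrite eqdZ //; exact: sm.
Qed.

Lemma Tvar_M1 u : eqd u u -> eqd (Tvar (M ord_max u)) (M ord0 (Tvar u) - 2^-1 *: M ord_max (Tvar u)).
Proof.
move=> uu; apply: eqdI => [||phi sp]; try by well_defined.
rewrite -[LHS]/(u (mulc ord_max (midpoint phi))) mulc_midpoint1.
have tt : eqd (Tvar u) (Tvar u) by well_defined.
rewrite -[LHS]/(Tvar u _) -scaleNr eqdD //; [|exact: sm|exact/schwartzZ/sm].
by rewrite eqdZ ?mulNr //; exact: sm.
Qed.

Lemma Tvar_D0 u : eqd u u -> eqd (Tvar (D ord0 u)) (2^-1 *: D ord0 (Tvar u) + D ord_max (Tvar u)).
Proof.
move=> uu; apply: eqdI => [||phi sp]; try by well_defined.
have tt : eqd (Tvar u) (Tvar u) by well_defined.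
rewrite -[LHS]/(D ord0 u (midpoint phi)) DE partial_midpoint0 //.
rewrite -[LHS]/(Tvar u (ci *: _)) -[RHS]/(2^-1 * D ord0 (Tvar u) phi + D ord_max (Tvar u) phi) !DE.
rewrite scalerDr scalerA mulrC -scalerA eqdD // ?eqdZ //;
  try exact: schwartzZ; do ?apply: schwartzZ; exact: sd.
Qed.

Lemma Tvar_D1 u : eqd u u -> eqd (Tvar (D ord_max u)) (2^-1 *: D ord0 (Tvar u) - D ord_max (Tvar u)).
Proof.
move=> uu; apply: eqdI => [||phi sp]; try by well_defined.
have tt : eqd (Tvar u) (Tvar u) by well_defined.
rewrite -[LHS]/(D ord_max u (midpoint phi)) DE partial_midpoint1 //.
rewrite -[LHS]/(Tvar u (ci *: _)) -[RHS]/(2^-1 * D ord0 (Tvar u) phi - D ord_max (Tvar u) phi) !DE.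
rewrite scalerBr scalerA mulrC -scalerA -[- (ci *: _)]scaleN1r eqdD // ?eqdZ // ?mulN1r //;
  do ?apply: schwartzZ; exact: sd.
Qed.

Lemma fourierD_snd_M0 u : eqd u u -> eqd (fourierD_snd (M ord0 u)) (M ord0 (fourierD_snd u)).
Proof.
move=> uu; apply: eqdI => [||phi sp]; try by well_defined.
rewrite fourierD_sndE -[LHS]/(u (mulc ord0 (pfourier phi))) pfourier_mulc0 //.
by rewrite -[RHS]/(fourierD_snd u (mulc ord0 phi)) fourierD_sndE.
Qed.

Lemma fourierD_snd_M1 u : eqd u u -> eqd (fourierD_snd (M ord_max u)) (- D ord_max (fourierD_snd u)).
Proof.
move=> uu; apply: eqdI => [||phi sp]; try by well_defined.
rewrite fourierD_sndE -[LHS]/(u (mulc ord_max (pfourier phi))) mulc_pfourier1 //.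
rewrite -[RHS]/(- D ord_max (fourierD_snd u) phi) DE fourierD_sndE.
rewrite (op_linear_scale _ pfourier_lin); last exact: sd.
by rewrite !eqdZ // ?mulNr //; apply: schwartz_pfourier; exact: sd.
Qed.

Lemma fourierD_snd_D0 u : eqd u u -> eqd (fourierD_snd (D ord0 u)) (D ord0 (fourierD_snd u)).
Proof.
move=> uu; apply: eqdI => [||phi sp]; try by well_defined.
rewrite fourierD_sndE !DE partial_pfourier0 // fourierD_sndE.
by rewrite (op_linear_scale _ pfourier_lin) //; exact: sd.
Qed.

Lemma fourierD_snd_D1 u : eqd u u -> eqd (fourierD_snd (D ord_max u)) (M ord_max (fourierD_snd u)).
Proof.
move=> uu; apply: eqdI => [||phi sp]; try by well_defined.
rewrite fourierD_sndE !DE partial_pfourier1 // scalerA ciNci scale1r.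
by rewrite -[RHS]/(fourierD_snd u (mulc ord_max phi)) fourierD_sndE.
Qed.

End Intertwinings.

(** * Intertwining relations for the Wigner-like transform and its convolutions *)

Section WignerIntertwining.
Context {R : realType}.
Implicit Types (u v w : distr R) (f g phi psi : R * R -> R[i]) (z : R * R) (j k : 'I_2)
  (p q : mpoly 2 R[i]) (P : mpoly 2 R).

(** The change of variables turns M_1 into M_x + (1/2) M_t, and the transform in t turns M_t into -
    D_y. The other three generators follow the same pattern, D_t becoming M_y. *)
Lemma Wig_M0 u : eqd u u -> eqd (Wig (M ord0 u)) (M ord0 (Wig u) - 2^-1 *: D ord_max (Wig u)).
Proof.
move=> uu; have tt : eqd (Tvar u) (Tvar u) by exact: respects_Tvar.
apply: eqd_trans (respects_fourierD_snd (Tvar_M0 uu)) _.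
rewrite -[X in eqd X _]/(fourierD_snd (M ord0 (Tvar u)) + 2^-1 *: fourierD_snd (M ord_max (Tvar u))).
apply: eqd_add; first exact: fourierD_snd_M0.
by rewrite -scalerN; apply: eqd_scale; exact: fourierD_snd_M1.
Qed.

Lemma Wig_M1 u : eqd u u -> eqd (Wig (M ord_max u)) (M ord0 (Wig u) + 2^-1 *: D ord_max (Wig u)).
Proof.
move=> uu; have tt : eqd (Tvar u) (Tvar u) by exact: respects_Tvar.
apply: eqd_trans (respects_fourierD_snd (Tvar_M1 uu)) _.
rewrite -[X in eqd X _]/(fourierD_snd (M ord0 (Tvar u)) - 2^-1 *: fourierD_snd (M ord_max (Tvar u))).
apply: eqd_add; first exact: fourierD_snd_M0.
rewrite -[X in eqd _ (_ *: X)]opprK scalerN.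
by apply: eqd_opp; apply: eqd_scale; exact: fourierD_snd_M1.
Qed.

Lemma Wig_D0 u : eqd u u -> eqd (Wig (D ord0 u)) (2^-1 *: D ord0 (Wig u) + M ord_max (Wig u)).
Proof.
move=> uu; have tt : eqd (Tvar u) (Tvar u) by exact: respects_Tvar.
apply: eqd_trans (respects_fourierD_snd (Tvar_D0 uu)) _.
rewrite -[X in eqd X _]/(2^-1 *: fourierD_snd (D ord0 (Tvar u)) + fourierD_snd (D ord_max (Tvar u))).
apply: eqd_add; last exact: fourierD_snd_D1.
by apply: eqd_scale; exact: fourierD_snd_D0.
Qed.

Lemma Wig_D1 u : eqd u u -> eqd (Wig (D ord_max u)) (2^-1 *: D ord0 (Wig u) - M ord_max (Wig u)).
Proof.
move=> uu; have tt : eqd (Tvar u) (Tvar u) by exact: respects_Tvar.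
apply: eqd_trans (respects_fourierD_snd (Tvar_D1 uu)) _.
rewrite -[X in eqd X _]/(2^-1 *: fourierD_snd (D ord0 (Tvar u)) - fourierD_snd (D ord_max (Tvar u))).
apply: eqd_add; last by apply: eqd_opp; exact: fourierD_snd_D1.
by apply: eqd_scale; exact: fourierD_snd_D0.
Qed.

Lemma addr_halves (V : lmodType R[i]) (x : V) : 2^-1 *: x + 2^-1 *: x = x.
Proof. by rewrite -scalerDl (_ : 2^-1 + 2^-1 = 1) ?scale1r //; field. Qed.

(** The operators that [tilde] substitutes for D_1 and D_2 add up to D_1, the terms in M_2 and P_2
    cancelling. *)
Lemma addr_sum_half (V : lmodType R[i]) (x m p : V) :
  (2^-1 *: x + m - p) + (2^-1 *: x - m + p) = x.
Proof.
rewrite -[_ + m - p]addrA -[_ - m + p]addrA (_ : - m + p = - (m - p)).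
  by rewrite addrACA subrr addr0 addr_halves.
by rewrite opprB addrC.
Qed.

(** The operators that [tilde] substitutes for M_2 and M_1 differ by D_2. *)
Lemma subr_sum_half (V : lmodType R[i]) (x m p : V) :
  (m + 2^-1 *: x - p) - (m - 2^-1 *: x - p) = x.
Proof.
rewrite opprD opprK addrACA addNr addr0 opprB [_ *: x - m]addrC addrACA subrr add0r.
exact: addr_halves.
Qed.

Lemma partial_mulc j k phi : Schwartz phi ->
  partial j (mulc k phi) = (j == k)%:R *: phi + mulc k (partial j phi).
Proof.
move=> sp; apply/funext => z.
rewrite (partial_eq (has_pdM (has_pd_coord j k z) (schwartz_has_pd j z sp))).
by rewrite !fctE -[_ *: _]/(_ * _); case: (j == k).
Qed.

Lemma M_M j k u : M j (M k u) = M k (M j u).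
Proof. exact: mulf_mulf. Qed.

Lemma D_D u : eqd u u -> eqd (D ord_max (D ord0 u)) (D ord0 (D ord_max u)).
Proof.
move=> uu; apply: eqdI => [||phi sp]; try by do 2 apply: respects_D.
have sd l := schwartz_partial l sp.
rewrite !DE (op_linear_scale _ (op_linear_partial _) (sd ord0)).
rewrite (op_linear_scale _ (op_linear_partial _) (sd ord_max)) partial_comm //.
exact: schwartz_smooth.
Qed.

Lemma D_M j k u : eqd u u -> eqd (D j (M k u)) (M k (D j u) - ((j == k)%:R * 'i) *: u).
Proof.
move=> uu; apply: eqdI => [||phi sp].
- by apply: respects_D; exact: respects_M.
- apply: eqd_add; last by apply: eqd_opp; exact: eqd_scale.
  by apply: respects_M; exact: respects_D.
rewrite -[RHS]/(D j u (mulc k phi) - (j == k)%:R * 'i * u phi) !DE iE.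
rewrite -[LHS]/(u (mulc k (ci *: partial j phi))) partial_mulc // scalerDr.
have sd := schwartz_partial j sp; have sm := schwartz_mulc k sd.
rewrite (op_linear_scale _ (op_linear_mulc _)) // eqdD //; last 2 first.
- exact/schwartzZ/schwartzZ.
- exact: schwartzZ.
by rewrite scalerA [_ * ci]mulrC (eqdZ _ uu sp) addrAC subrr add0r.
Qed.

Let lM j : lin (@M R j). Proof. by []. Qed.
Let lD j : lin (@D R j). Proof. by []. Qed.

Let Y1X2 u : eqd u u -> eqd (D ord0 (M ord_max u)) (M ord_max (D ord0 u)).
Proof. by move=> uu; have := D_M ord0 ord_max uu; rewrite mul0r scale0r subr0. Qed.

Let Y2X1 u : eqd u u -> eqd (D ord_max (M ord0 u)) (M ord0 (D ord_max u)).
Proof. by move=> uu; have := D_M ord_max ord0 uu; rewrite mul0r scale0r subr0. Qed.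

Let YX j u : eqd u u -> eqd (D j (M j u)) (M j (D j u) - 'i *: u).
Proof. by move=> uu; have := D_M j j uu; rewrite eqxx mul1r. Qed.

Let X21 u : eqd u u -> eqd (M ord_max (M ord0 u)) (M ord0 (M ord_max u)).
Proof. by move=> uu; rewrite M_M; do 2 apply: respects_M. Qed.

Lemma eqd_pdo_comp c b u : eqd u u -> eqd (pdo (pdo_comp c b) u) (pdo c (pdo b u)).
Proof.
exact: (@opsubst_pdo_comp R (distr R) eqd eqd_per _ _ _ _ (lM _) (lM _) (lD _) (lD _)
  (respects_M _) (respects_M _) (respects_D _) (respects_D _)
  X21 D_D Y1X2 Y2X1 (@YX ord0) (@YX ord_max) c b u).
Qed.

Lemma eqd_pdo_A q u : eqd u u -> eqd (pdo (pdo_A q) u)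
  (opsubst q (ops2 (fun v => D ord0 v + D ord_max v) (fun v => M ord_max v - M ord0 v)) u).
Proof.
exact: (@opsubst_pdo_A R (distr R) eqd eqd_per _ _ _ _ (lM _) (lM _) (lD _) (lD _)
  (respects_M _) (respects_M _) (respects_D _) (respects_D _)
  X21 D_D Y1X2 Y2X1 (@YX ord0) (@YX ord_max) q u).
Qed.

Lemma respects_pdo c : respects eqd eqd (@pdo R c).
Proof.
apply: opsubst_respects; first exact: eqd_per.
by move=> k; apply: respects_ops4; [exact: respects_M|exact: respects_M|exact: respects_D|exact: respects_D].
Qed.

Section Multiplier.
Variables (g : R * R -> R[i]) (P : mpoly 2 R).
Hypothesis sg : SlowlyIncreasing g.
Let dP j := map_mpoly (real_complex R) (mderiv j P).
Hypothesis gP : forall j z, has_pd j g z (- ci * eval2 (dP j) z * g z).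

Let QW w : distr R := multiplier g (Wig w).

Lemma respects_QW : respects eqd eqd QW.
Proof. by move=> u v uv; apply: (respects_multiplier sg); exact: respects_Wig. Qed.

Lemma QW_M0 w : eqd w w ->
  eqd (QW (M ord0 w)) (M ord0 (QW w) - 2^-1 *: D ord_max (QW w) - PD P ord0 (QW w)).
Proof.
move=> ww; have WW := respects_Wig ww.
apply: eqd_trans (respects_multiplier sg (Wig_M0 ww)) _.
rewrite -[X in eqd X _]/(multiplier g (M ord0 (Wig w)) - 2^-1 *: multiplier g (D ord_max (Wig w))).
rewrite addrAC; apply: eqd_add; first exact: multiplier_M.
by apply: eqd_opp; apply: eqd_scale; exact: multiplier_D.
Qed.

Lemma QW_M1 w : eqd w w ->
  eqd (QW (M ord_max w)) (M ord0 (QW w) + 2^-1 *: D ord_max (QW w) - PD P ord0 (QW w)).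
Proof.
move=> ww; have WW := respects_Wig ww.
apply: eqd_trans (respects_multiplier sg (Wig_M1 ww)) _.
rewrite -[X in eqd X _]/(multiplier g (M ord0 (Wig w)) + 2^-1 *: multiplier g (D ord_max (Wig w))).
rewrite addrAC; apply: eqd_add; first exact: multiplier_M.
by apply: eqd_scale; exact: multiplier_D.
Qed.

Lemma QW_D0 w : eqd w w ->
  eqd (QW (D ord0 w)) (2^-1 *: D ord0 (QW w) + M ord_max (QW w) - PD P ord_max (QW w)).
Proof.
move=> ww; have WW := respects_Wig ww.
apply: eqd_trans (respects_multiplier sg (Wig_D0 ww)) _.
rewrite -[X in eqd X _]/(2^-1 *: multiplier g (D ord0 (Wig w)) + multiplier g (M ord_max (Wig w))).
rewrite -addrA; apply: eqd_add; last exact: multiplier_M.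
by apply: eqd_scale; exact: multiplier_D.
Qed.

Lemma QW_D1 w : eqd w w ->
  eqd (QW (D ord_max w)) (2^-1 *: D ord0 (QW w) - M ord_max (QW w) + PD P ord_max (QW w)).
Proof.
move=> ww; have WW := respects_Wig ww.
apply: eqd_trans (respects_multiplier sg (Wig_D1 ww)) _.
rewrite -[X in eqd X _]/(2^-1 *: multiplier g (D ord0 (Wig w)) - multiplier g (M ord_max (Wig w))).
rewrite (_ : forall a b c : distr R, a - b + c = a - (b - c)); last first.
  by move=> a b c; rewrite opprB addrA addrAC.
apply: eqd_add; last by apply: eqd_opp; exact: multiplier_M.
by apply: eqd_scale; exact: multiplier_D.
Qed.

Lemma respects_PD j : respects eqd eqd (@PD R P j).
Proof.
apply: opsubst_respects; first exact: eqd_per.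
by move=> k; have [->|->] := ord2P k; exact: respects_D.
Qed.

Let tilde_ops : 'I_4 -> distr R -> distr R := ops4
  (fun u => M ord0 u - 2^-1 *: D ord_max u - PD P ord0 u)
  (fun u => M ord0 u + 2^-1 *: D ord_max u - PD P ord0 u)
  (fun u => 2^-1 *: D ord0 u + M ord_max u - PD P ord_max u)
  (fun u => 2^-1 *: D ord0 u - M ord_max u + PD P ord_max u).

Let respects_tilde_ops (k : 'I_4) : respects eqd eqd (tilde_ops k).
Proof.
have r1 := @respects_M R; have r2 := @respects_D R; have r3 := respects_PD.
apply: respects_ops4 => u v uv.
- by apply: eqd_sub (eqd_sub _ (eqd_scale _ _)) _; [exact: r1|exact: r2|exact: r3].
- by apply: eqd_sub (eqd_add _ (eqd_scale _ _)) _; [exact: r1|exact: r2|exact: r3].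
- by apply: eqd_sub (eqd_add (eqd_scale _ _) _) _; [exact: r2|exact: r1|exact: r3].
- by apply: eqd_add (eqd_sub (eqd_scale _ _) _) _; [exact: r2|exact: r1|exact: r3].
Qed.

Lemma respects_tilde c : respects eqd eqd (@tilde R P c).
Proof. by apply: opsubst_respects; [exact: eqd_per|exact: respects_tilde_ops]. Qed.

Lemma QW_pdo c w : eqd w w -> eqd (QW (pdo c w)) (tilde P c (QW w)).
Proof.
apply: (@opsubst_intertwine R (distr R) (distr R) eqd eqd eqd_per 4 _ tilde_ops QW
  _ respects_tilde_ops _ respects_QW) => //.
- by move=> k; apply: respects_ops4; [exact: respects_M|exact: respects_M|exact: respects_D|exact: respects_D].
- by case=> [[|[|[|[|//]]]] i] u uu; [exact: QW_M0|exact: QW_M1|exact: QW_D0|exact: QW_D1].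
Qed.

(* [QW] turns the commuting operators [D1 + D2] and [M2 - M1] into [D1] and [D2]. *)
Lemma QW_pdo_A q w : eqd w w ->
  eqd (QW (pdo (pdo_A q) w)) (opsubst q (ops2 (D ord0) (D ord_max)) (QW w)).
Proof.
move=> ww; apply: eqd_trans (respects_QW (eqd_pdo_A q ww)) _.
have r1 := @respects_M R; have r2 := @respects_D R.
apply: (@opsubst_intertwine R (distr R) (distr R) eqd eqd eqd_per 2 _ _ QW _ _ _ respects_QW) => //.
- move=> k u v uv; have [->|->] := ord2P k; first by apply: eqd_add; exact: r2.
  by apply: eqd_sub; exact: r1.
- by move=> k; have [->|->] := ord2P k; exact: r2.
- move=> k u uu; have QQ := respects_QW uu.
  have [->|->] := ord2P k.
    rewrite -[X in eqd X _]/(QW (D ord0 u) + QW (D ord_max u)).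
    apply: eqd_trans (eqd_add (QW_D0 uu) (QW_D1 uu)) _.
    rewrite addr_sum_half; exact: r2.
  rewrite -[X in eqd X _]/(QW (M ord_max u) - QW (M ord0 u)).
  apply: eqd_trans (eqd_sub (QW_M1 uu) (QW_M0 uu)) _.
  rewrite subr_sum_half; exact: r2.
Qed.

End Multiplier.

End WignerIntertwining.

(** * Uniqueness of symbols, and the symbols of sigma and sigma_1 *)

Section FourierSymbol.
Context {R : realType}.
Implicit Types (u v w tau : distr R) (f g h phi psi : R * R -> R[i]) (z : R * R)
  (p q : mpoly 2 R[i]) (P : mpoly 2 R).

(** The pairing is a value of a Fourier transform at the origin, from which it inherits
    linearity. *)
Lemma regE f phi : reg f phi = fourier (mulop f phi) (0, 0).
Proof.
rewrite /reg /fourier; congr integral2; apply/funext => z /=.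
by rewrite !mulr0 addr0 oppr0 expi0 mul1r.
Qed.

Lemma reg_eqd f : SlowlyIncreasing f -> eqd (reg f) (reg f).
Proof.
move=> sf; suff lf : linear_distr (reg f) by [].
move=> c phi psi sp ss; rewrite !regE mulop_lin //.
by rewrite (iso_linear iso_fourier) //; exact: schwartz_mulop.
Qed.

Definition character z : R * R -> R[i] :=
  fun y => expi (- (y.1 * z.1 + y.2 * z.2)).

Lemma slowly_increasing_character z : SlowlyIncreasing (character z).
Proof.
pose P : mpoly 2 R := - (mpolyX R (mnm1 ord0) * mpolyC 2 z.1 + mpolyX R (mnm1 ord_max) * mpolyC 2 z.2).
rewrite (_ : character z = rational_phase (mpolyC 2 1) (mpolyC 2 1) 0 P).
  by apply: slowly_increasing_rational_phase => w; rewrite eval2C; apply/eqP; exact: oner_neq0.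
apply/funext => w; rewrite /rational_phase eval2C expr0 !mul1r evalR2N evalR2D !evalR2M.
by rewrite /evalR2 !mevalXU !mevalC.
Qed.

(** Testing against characters times a Gaussian shows that [f] and [g], multiplied by the Gaussian,
    have equal Fourier transforms; the Gaussian has no zero. This identifies the symbol selected by
    choice in [fourier_symbol]. *)
Lemma reg_inj f g : SlowlyIncreasing f -> SlowlyIncreasing g ->
  (forall phi, Schwartz phi -> reg f phi = reg g phi) -> f = g.
Proof.
move=> sf sg fg; have sG := @schwartz_gaussian R 1 ltr01.
have E : fourier (mulop f (gaussian 1)) = fourier (mulop g (gaussian 1)).
  apply/funext => z.
  have := fg (mulop (character z) (gaussian 1)).
  rewrite /fourier /reg => H.
  transitivity (integral2 (fun y => f y * mulop (character z) (gaussian 1) y)).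
    by congr integral2; apply/funext => w; rewrite /mulop /character; ring.
  rewrite H; last by apply: schwartz_mulop => //; exact: slowly_increasing_character.
  by congr integral2; apply/funext => w; rewrite /mulop /character; ring.
have := congr1 (@fourier_inv R) E.
rewrite !(isoK iso_fourier); [|exact: schwartz_mulop|exact: schwartz_mulop].
move=> /funeqP H; apply/funext => z; have := H z; rewrite /mulop.
apply: mulIf; rewrite /gaussian; apply/eqP => /(congr1 (@complex.Re R)) /= /eqP.
by rewrite gt_eqF // expR_gt0.
Qed.

Lemma fourier_symbolE tau g : SlowlyIncreasing g ->
  (forall phi, Schwartz phi -> fourierD tau phi = reg g phi) -> fourier_symbol tau = g.
Proof.
move=> sg tg; rewrite /fourier_symbol.
have S : [set f | slowly_increasing f /\ deq (fourierD tau) (reg f)] g.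
  by split; [rewrite -SlowlyIncreasingE | move=> phi; rewrite -SchwartzE; exact: tg].
have [s1 s2] := xgetPex (fun=> 0) (ex_intro _ g S).
apply: reg_inj => //; first by rewrite SlowlyIncreasingE.
by move=> phi sp; rewrite -tg // s2 // -SchwartzE.
Qed.

Definition phase P : R * R -> R[i] := fun z => expi (- evalR2 P z).

Lemma phaseE P : phase P = rational_phase (mpolyC 2 1) (mpolyC 2 1) 0 (- P).
Proof.
by apply/funext => z; rewrite /rational_phase eval2C expr0 !mul1r evalR2N.
Qed.

Let one_neq0 z : eval2 (mpolyC 2 (1 : R[i])) z <> 0.
Proof. by rewrite eval2C; apply/eqP; exact: oner_neq0. Qed.

Lemma slowly_increasing_phase P : SlowlyIncreasing (phase P).
Proof. by rewrite phaseE; exact: slowly_increasing_rational_phase. Qed.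

Lemma phase_has_pd P j z : has_pd j (phase P) z
  (- ci * eval2 (map_mpoly (real_complex R) (mderiv j P)) z * phase P z).
Proof.
rewrite /phase; under eq_fun do rewrite -evalR2N.
apply: has_pd_eq (has_pd_expi (evalR2_has_pd j (- P) z)) _.
rewrite -evalR2_eval2 (_ : mderiv j (- P) = - mderiv j P) ?evalR2N; last exact: raddfN.
by rewrite (_ : forall x : R, (- x)%:C = - x%:C :> R[i]) ?mulrN ?mulNr // => x;
  apply: complexP; rewrite //= oppr0.
Qed.

Lemma fourierD_sigma P phi : Schwartz phi -> fourierD (sigma P) phi = reg (phase P) phi.
Proof. by move=> sp; rewrite /fourierD /sigma /fourierD_inv (isoK iso_fourier). Qed.

Lemma fourier_symbol_sigma P : fourier_symbol (sigma P) = phase P.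
Proof. exact: fourier_symbolE (slowly_increasing_phase P) (@fourierD_sigma P). Qed.

Lemma slowly_increasing_eval2_phase q P : SlowlyIncreasing (fun z => eval2 q z * phase P z).
Proof.
rewrite (_ : (fun z => _) = rational_phase q (mpolyC 2 1) 0 (- P)).
  exact: slowly_increasing_rational_phase.
by apply/funext => z; rewrite /rational_phase expr0 mulr1 evalR2N.
Qed.

(** The Fourier transform turns q(D_1, D_2) into multiplication by q. *)
Lemma fourier_symbol_sigma1 P q :
  fourier_symbol (sigma1 P q) = fun z => eval2 q z * phase P z.
Proof.
apply: fourier_symbolE; first exact: slowly_increasing_eval2_phase.
have ss : eqd (sigma P) (sigma P).
  exact: respects_fourierD_inv (reg_eqd (slowly_increasing_phase P)).
have rD k : respects eqd eqd (ops2 (@D R ord0) (D ord_max) k).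
  by have [->|->] := ord2P k; exact: respects_D.
have rM k : respects eqd eqd (ops2 (@M R ord0) (M ord_max) k).
  by have [->|->] := ord2P k; exact: respects_M.
have H : eqd (fourierD (sigma1 P q)) (opsubst q (ops2 (M ord0) (M ord_max)) (fourierD (sigma P))).
  apply: (@opsubst_intertwine R (distr R) (distr R) eqd eqd eqd_per 2 _ _ (@fourierD R)
    rD rM _ respects_fourierD _ q _ ss) => //.
  by move=> k v vv; have [->|->] := ord2P k; exact: fourierD_D.
have [_ _ {}H] := eqd_trans H (opsubst_M q (respects_fourierD ss)).
move=> phi sp; rewrite H // -[LHS]/(fourierD (sigma P) (mulop (eval2 q) phi)).
rewrite fourierD_sigma; last exact: schwartz_mulop (slowly_increasing_eval2 q) sp.
by rewrite /reg; congr integral2; apply/funext => z; rewrite /mulop; ring.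
Qed.

(** Transposition reverses the factors: on test functions the order is inverse Fourier transform,
    multiplication by [g], Fourier transform, partial transform, change of variables. Each is an
    isomorphism, the multiplication because [h] inverts [g]. *)
Lemma iso_multiplier g h : SlowlyIncreasing g -> SlowlyIncreasing h -> (forall z, g z * h z = 1) ->
  exists K L, schwartz_iso K L /\ forall u, multiplier g (Wig u) = fun phi => u (K phi).
Proof.
move=> sg sh gh.
have i := @iso_comp R _ _ _ _ (@iso_comp R _ _ _ _ iso_midpoint iso_pfourier)
  (@iso_comp R _ _ _ _ iso_fourier (@iso_comp R _ _ _ _ (iso_mulop sg sh gh) (iso_sym iso_fourier))).
eexists; eexists; split; first exact: i.
by move=> u; apply/funext => phi; rewrite /Wig /multiplier /fourierD_inv /mulf /fourierD fourierD_sndE.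
Qed.

End FourierSymbol.

Theorem theorem3p9 (R : realType) (B : mpoly 4 R[i]) (P : mpoly 2 R)
    (q : mpoly 2 R[i]) (hq : forall z : R * R, eval2 q z <> 0) :
  (forall w : distr R, tempered w ->
     deq (Q (sigma1 P q) (pdo B w))
         (tilde P (pdo_comp (pdo_A q) B) (Q (sigma P) w))) /\
  (regular (pdo B) <-> regular (tilde P (pdo_comp (pdo_A q) B))).
Proof.
set A := pdo_comp (pdo_A q) B.
have sg := slowly_increasing_phase P.
have sq := slowly_increasing_eval2_phase q P.
have QE w : Q (sigma P) w = multiplier (phase P) (Wig w).
  by rewrite /Q /conv fourier_symbol_sigma.
have Q1E w : Q (sigma1 P q) w = multiplier (fun z => eval2 q z * phase P z) (Wig w).
  by rewrite /Q /conv fourier_symbol_sigma1.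
have QQ w : eqd w w -> eqd (Q (sigma1 P q) (pdo B w)) (tilde P A (Q (sigma P) w)).
  move=> ww; rewrite Q1E !QE; have Bww := respects_pdo B ww.
  apply: eqd_trans (multiplier_eval2 q sg (respects_Wig Bww)) _.
  apply: eqd_trans (per_sym eqd_per (QW_pdo_A sg (@phase_has_pd _ P) q Bww)) _.
  apply: eqd_trans (respects_QW sg (per_sym eqd_per (eqd_pdo_comp (pdo_A q) B ww))) _.
  exact: (QW_pdo sg (@phase_has_pd _ P) A ww).
have ph z : phase P z * expi (evalR2 P z) = 1.
  by rewrite /phase mulrC expiN.
have q0 z : eval2 q z != 0 by apply/eqP; exact: hq.
have inv0 : SlowlyIncreasing (fun z => expi (evalR2 P z)).
  rewrite (_ : (fun z => _) = phase (- P)); first exact: slowly_increasing_phase.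
  by apply/funext => z; rewrite /phase evalR2N opprK.
have inv1 : SlowlyIncreasing (fun z => (eval2 q z)^-1 * expi (evalR2 P z)).
  rewrite (_ : (fun z => _) = rational_phase (mpolyC 2 1) q 1 P).
    exact: slowly_increasing_rational_phase.
  by apply/funext => z; rewrite /rational_phase eval2C mul1r expr1.
have [K [L [i QK]]] := iso_multiplier sg inv0 ph.
have ph1 z : eval2 q z * phase P z * ((eval2 q z)^-1 * expi (evalR2 P z)) = 1.
  by rewrite mulrACA ph mulfV // mulr1.
have [K1 [L1 [i1 QK1]]] := iso_multiplier sq inv1 ph1.
have deqQ w : tempered w -> deq (Q (sigma1 P q) (pdo B w)) (tilde P A (Q (sigma P) w)).
  move=> /eqd_tempered/QQ[_ _ H] phi; rewrite -SchwartzE; exact: H.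
have deqC (u v : distr R) : deq u v -> deq v u by move=> uv phi sp; rewrite uv.
split; first exact: deqQ.
split=> reg u tu.
(* [w] is the preimage of [u] under Q^(sigma), since [L] inverts [K]. *)
- move=> su; pose w : distr R := fun phi => u (L phi).
  have tw : tempered w by apply: tempered_comp (iso_inv_continuous i) (iso_inv_linear i) tu.
  have uQ : eqd u (Q (sigma P) w).
    rewrite QE QK; apply: eqdI => [||phi sp].
    + exact: eqd_tempered.
    + apply: eqd_tempered; exact: tempered_comp (iso_continuous i) (iso_linear i) tw.
    + by rewrite /w (isoK i).
  have [_ _ Tu] := respects_tilde P A uQ.
  have sw : in_schwartz w.
    (* [pdo B w] is given by a Schwartz function as soon as its image under Q^(sigma_1) is, and that
       image is [tilde P A u] up to [deq]. *)
    apply: (reg w tw); apply: (in_schwartz_iso i1).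
    rewrite -QK1 -Q1E; apply: in_schwartz_deq (deqC _ _ (deqQ w tw)) _.
    by apply: in_schwartz_deq su => phi; rewrite -SchwartzE => sp; exact: Tu.
  have [_ _ {}uQ] := uQ.
  have : in_schwartz (Q (sigma P) w) by rewrite QE QK; exact: in_schwartz_comp i sw.
  by apply: in_schwartz_deq => phi; rewrite -SchwartzE => sp; rewrite uQ.
(* Here regularity is applied to Q^(sigma) u, whose membership in S(R^2) entails that of [u]. *)
- move=> su; apply: (in_schwartz_iso i); rewrite -QK -QE.
  apply: reg.
    rewrite QE QK; exact: tempered_comp (iso_continuous i) (iso_linear i) tu.
  apply: in_schwartz_deq (deqQ u tu) _.
  by rewrite Q1E QK1; exact: in_schwartz_comp i1 su.
Qed.
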